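(* Let $(\mathcal X,\mathcal A,P)$ be a probability space, $X_1,X_2,\ldots$ independent random elements with distribution $P$, $\mathcal F$ a collection of measurable functions $\mathcal X\to\mathbb R$, and, for each $n$, $h_n:\mathcal X\to\mathbb R^{d_n}$ a feature map with leverage function $q_n$; let $L_f$, $\beta_{n,f}$, $\hat\beta_{n,f}$, $\varepsilon_{n,f}$, $M_n$, $\gamma_n^2$, $L_n^2$ be as defined in the context. Assume: (1) at least one of the following holds: (a) $P(q_n^2)=o(n)$ and $\log(\|q_n\|_\infty)=O(\log n)$ as $n\to\infty$; (b) $\|q_n\|_\infty\log(2d_n)=o(n)$ as $n\to\infty$; (2) $\mathcal F$ is at most countably infinite and admits an envelope $F:\mathcal X\to[0,\infty)$, i.e. $|f(x)|\le F(x)$ for all $f\in\mathcal F$, $x\in\mathcal X$, with $\|F\|_\infty<\infty$; (3) $\mathcal F$ is a VC-class of parameters $(v,A)\in(0,\infty)\times[1,\infty)$ with respect to the envelope $F$. If $(\log M_n^{-1})_+=O(\log n)$ as $n\to\infty$, i.e., if there is some $\alpha>0$ such that $\liminf_{n\to\infty}n^\alpha M_n>0$, then $$\sup_{f\in\mathcal F}\left\{L_f(\hat\beta_{n,f})-L_f(\beta_{n,f})\right\}=O_{\mathbb P}\left(\left\{\gamma_n^2\vee\left(L_n^2\sqrt{\frac{\log n}{n}}\right)\right\}\frac{\log n}{n}\right),\qquad n\to\infty.$$ If, moreover, $L_n^2=O\left(\gamma_n^2\sqrt{n/\log n}\right)$ as $n\to\infty$, then $$\sup_{f\in\mathcal F}\left\{L_f(\hat\beta_{n,f})-L_f(\beta_{n,f})\right\}=O_{\mathbb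 P}\left(\gamma_n^2\,\frac{\log n}{n}\right),\qquad n\to\infty.$$
   Context: Notation: $P(g)=\int g\,\mathrm dP$ and $P_n(g)=\frac1n\sum_{i=1}^n g(X_i)$ for real-, vector- or matrix-valued $g$; $\|g\|_\infty=\sup_{x\in\mathcal X}|g(x)|$; $a\vee b=\max(a,b)$, $(a)_+=a\vee0$; ${}^\top$ is transposition. Feature maps: for each $n$, $d_n\ge1$ is an integer (it may tend to infinity) and $h_n=(h_{n,1},\dots,h_{n,d_n})^\top:\mathcal X\to\mathbb R^{d_n}$ is measurable with square-integrable components and invertible Gram matrix $P(h_nh_n^\top)$. The leverage function is $q_n(x)=h_n(x)^\top P(h_nh_n^\top)^{-1}h_n(x)$, and $\|q_n\|_\infty<\infty$. Regression quantities: $L_f(b)=P[(f-h_n^\top b)^2]$ for $b\in\mathbb R^{d_n}$; $\beta_{n,f}=P(h_nh_n^\top)^{-1}P(h_nf)$ is the minimizer of $L_f$; $\varepsilon_{n,f}=f-h_n^\top\beta_{n,f}$; $\hat\beta_{n,f}=P_n(h_nh_n^\top)^{-1}P_n(h_nf)$ is the ordinary least squares estimator (a pseudo-inverse is used if $P_n(h_nh_n^\top)$ is not invertible). Further, $M_n=\sup_{f\in\mathcal F}\|\varepsilon_{n,f}\|_\infty$, $\gamma_n^2=\sup_{f\in\mathcal F}P(q_n\varepsilon_{n,f}^2)$, $L_n^2=M_n^2\|q_n\|_\infty$. VC-class: for a subset $\mathcal F$ of a metric space $(\mathcal Y,\rho)$, $\mathcal N(\mathcal F,\rho,\eta)$ is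 the smallest number of open $\rho$-balls of radius $\eta$ with centers in $\mathcal Y$ needed to cover $\mathcal F$. A class $\mathcal F$ of real functions on $(\mathcal X,\mathcal A)$ is a VC-class of parameters $(v,A)\in(0,\infty)\times[1,\infty)$ with respect to the envelope $F$ if $\mathcal N(\mathcal F,L^2(Q),\eta\|F\|_{L^2(Q)})\le(A/\eta)^v$ for every $0<\eta<1$ and every probability measure $Q$ on $(\mathcal X,\mathcal A)$. $Y_n=O_{\mathbb P}(c_n)$ means: for every $\epsilon>0$ there is $C>0$ with $\limsup_{n\to\infty}\mathbb P(|Y_n|>c_nC)\le\epsilon$. *)

(* Defs.v *)
From HB Require Import structures.
From mathcomp Require Import all_boot all_order all_algebra finmap.
From mathcomp Require Import all_classical all_reals all_analysis.
From mathcomp Require Import lra.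

Set Implicit Arguments.
Unset Strict Implicit.
Unset Printing Implicit Defensive.

Import Order.TTheory GRing.Theory Num.Theory.
Import numFieldNormedType.Exports.

Local Open Scope classical_set_scope.
Local Open Scope ring_scope.

(* Mutual independence: the product rule for every finite subfamily. *)
Definition mutually_independent (dO dX : measure_display)
    (Omega : measurableType dO) (T : measurableType dX) (R : realType)
    (Pr : probability Omega R) (I : choiceType) (X : I -> {RV Pr >-> T}) : Prop :=
  forall (J : {fset I}) (B : I -> set T),
    (forall i, i \in J -> measurable (B i)) ->
    Pr (\bigcap_(i in [set` J]) (X i @^-1` B i)) =
      (\prod_(i <- J) Pr (X i @^-1` B i))%E.

Definition iid
    (dO dX : measure_display)
    (Omega : measurableType dO) (T : measurableType dX) (R : realType)
    (Pr : probability Omega R) (P : probability T R)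
    (I : choiceType) (X : I -> {RV Pr >-> T}) : Prop :=
  mutually_independent X /\
  forall i (B : set T), measurable B -> distribution Pr (X i) B = P B.

(* Supremum over the whole space, not an essential supremum. *)
Definition supnorm (T : Type) (R : realType) (g : T -> R) : \bar R :=
  ereal_sup [set `|g x|%:E | x in [set: T]].

Definition envelope (T : Type) (R : realType) (F : set (T -> R))
    (Fenv : T -> R) : Prop :=
  (forall x, 0 <= Fenv x) /\ (forall f, F f -> forall x, `|f x| <= Fenv x).

(* The value is +oo when no finite cover exists. *)
Definition covering_number (U : Type) (R : realType) (Y : set U)
    (rho : U -> U -> \bar R) (F : set U) (r : \bar R) : \bar R :=
  ereal_inf [set (m%:R)%:E | m in [set m : nat |
    exists c : 'I_m -> U, (forall i, Y (c i)) /\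
      F `<=` \bigcup_(i in [set: 'I_m]) [set f | (rho (c i) f < r)%E]]].

Definition L2dist (dX : measure_display) (T : measurableType dX) (R : realType)
    (Q : probability T R) (f g : T -> R) : \bar R :=
  ('N[Q]_2%:E [EFin \o (f \- g)%R])%E.

(* L^2(Q) is represented by functions, without passing to Q-a.e. classes. *)
Definition VC_class (dX : measure_display) (T : measurableType dX)
    (R : realType) (F : set (T -> R)) (Fenv : T -> R) (v A : R) : Prop :=
  forall (eta : R), 0 < eta < 1 -> forall Q : probability T R,
    (covering_number [set` Lfun Q 2%:E] (L2dist Q) F
       (eta%:E * 'N[Q]_2%:E [EFin \o Fenv]) <= ((A / eta) `^ v)%:E)%E.

Definition mx_mean (dX : measure_display) (T : measurableType dX) (R : realType)
    (P : probability T R) (m k : nat) (g : T -> 'M[R]_(m, k)) : 'M[R]_(m, k) :=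
  \matrix_(i, j) \int[P]_x g x i j.

(* The sample X_1, ..., X_n is X 0, ..., X n.-1. *)
Definition mx_emp_mean (dO dX : measure_display)
    (Omega : measurableType dO) (T : measurableType dX) (R : realType)
    (X : nat -> Omega -> T) (n : nat) (w : Omega) (m k : nat)
    (g : T -> 'M[R]_(m, k)) : 'M[R]_(m, k) :=
  n%:R^-1 *: \sum_(i < n) g (X i w).

Definition gram_at (T : Type) (R : realType) (d : nat) (h : T -> 'cV[R]_d)
  (x : T) : 'M[R]_d := h x *m (h x)^T.

Definition gram (dX : measure_display) (T : measurableType dX) (R : realType)
  (P : probability T R) (d : nat) (h : T -> 'cV[R]_d) : 'M[R]_d :=
  mx_mean P (gram_at h).

Definition emp_gram (dO dX : measure_display)
  (Omega : measurableType dO) (T : measurableType dX) (R : realType)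
  (X : nat -> Omega -> T) (n : nat) (d : nat) (h : T -> 'cV[R]_d)
  (w : Omega) : 'M[R]_d := mx_emp_mean X n w (gram_at h).

Definition feature_map (dX : measure_display) (T : measurableType dX)
    (R : realType) (P : probability T R) (d : nat) (h : T -> 'cV[R]_d) : Prop :=
  [/\ (0 < d)%N,
      forall i, (fun x => h x i ord0) \in Lfun P 2%:E &
      gram P h \in unitmx].

Definition leverage (dX : measure_display) (T : measurableType dX)
    (R : realType) (P : probability T R) (d : nat) (h : T -> 'cV[R]_d)
    (x : T) : R :=
  ((h x)^T *m invmx (gram P h) *m h x) ord0 ord0.

Definition linfeat (T : Type) (R : realType) (d : nat) (h : T -> 'cV[R]_d)
  (b : 'cV[R]_d) (x : T) : R := ((h x)^T *m b) ord0 ord0.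

Definition risk (dX : measure_display) (T : measurableType dX) (R : realType)
    (P : probability T R) (d : nat) (h : T -> 'cV[R]_d) (f : T -> R)
    (b : 'cV[R]_d) : R :=
  \int[P]_x (f x - linfeat h b x) ^+ 2.

Definition beta (dX : measure_display) (T : measurableType dX) (R : realType)
    (P : probability T R) (d : nat) (h : T -> 'cV[R]_d) (f : T -> R)
    : 'cV[R]_d :=
  invmx (gram P h) *m mx_mean P (fun x => f x *: h x).

Definition residual (dX : measure_display) (T : measurableType dX)
    (R : realType) (P : probability T R) (d : nat) (h : T -> 'cV[R]_d)
    (f : T -> R) (x : T) : R :=
  f x - linfeat h (beta P h f) x.

(* The weakest requirement on a pseudo-inverse; the Moore-Penrose inverse is
   one instance. *)
Definition is_pseudo_inverse (R : realType) (d : nat) (A B : 'M[R]_d) : Prop :=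
  A *m B *m A = A.

Definition beta_ols (dO dX : measure_display)
    (Omega : measurableType dO) (T : measurableType dX) (R : realType)
    (pinv : forall d : nat, 'M[R]_d -> 'M[R]_d)
    (X : nat -> Omega -> T) (n : nat) (d : nat) (h : T -> 'cV[R]_d)
    (f : T -> R) (w : Omega) : 'cV[R]_d :=
  let G := emp_gram X n h w in
  (if G \in unitmx then invmx G else pinv d G)
    *m mx_emp_mean X n w (fun x => f x *: h x).

Definition sup_residual (dX : measure_display) (T : measurableType dX)
    (R : realType) (P : probability T R) (F : set (T -> R))
    (d : nat) (h : T -> 'cV[R]_d) : \bar R :=
  ereal_sup [set supnorm (residual P h f) | f in F].

Definition gamma_sq (dX : measure_display) (T : measurableType dX)
    (R : realType) (P : probability T R) (F : set (T -> R))
    (d : nat) (h : T -> 'cV[R]_d) : \bar R :=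
  ereal_sup
    [set (\int[P]_x (leverage P h x * residual P h f x ^+ 2)%:E)%E | f in F].

Definition L_sq (dX : measure_display) (T : measurableType dX)
    (R : realType) (P : probability T R) (F : set (T -> R))
    (d : nat) (h : T -> 'cV[R]_d) : \bar R :=
  (sup_residual P F h ^+ 2 * supnorm (leverage P h))%E.

Definition sup_excess_risk (dO dX : measure_display)
    (Omega : measurableType dO) (T : measurableType dX) (R : realType)
    (P : probability T R) (F : set (T -> R))
    (pinv : forall d : nat, 'M[R]_d -> 'M[R]_d)
    (X : nat -> Omega -> T) (n : nat) (d : nat) (h : T -> 'cV[R]_d)
    (w : Omega) : \bar R :=
  ereal_sup [set (risk P h f (beta_ols pinv X n h f w)
                  - risk P h f (beta P h f))%:E | f in F].

Definition bigO_prob (dO : measure_display) (Omega : measurableType dO)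
    (R : realType) (Pr : probability Omega R)
    (Y : nat -> Omega -> \bar R) (c : nat -> \bar R) : Prop :=
  forall eps : R, 0 < eps ->
    exists2 C : R, 0 < C &
      (limn_esup (fun n => Pr [set w | c n * C%:E < `|Y n w|]) <= eps%:E)%E.

(* (log M_n^-1)_+ = O(log n), in the extended reals because the left-hand side
   is +oo when M n = 0, unlike with the total logarithm of R.  The lemma below
   gives the equivalent form liminf n^alpha M_n > 0. *)
Definition log_inv_bigO (R : realType) (M : nat -> \bar R) : Prop :=
  exists C : R, \forall n \near \oo,
    (maxe (lne (M n)^-1) 0 <= (C * ln n%:R)%:E)%E.

Lemma log_inv_bigOP (R : realType) (M : nat -> \bar R) :
  (forall n, (0 < n)%N -> (0 <= M n)%E) ->
  log_inv_bigO M <->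
  exists2 alpha : R, 0 < alpha &
    (0 < limn_einf (fun n => (n%:R `^ alpha)%:E * M n))%E.
Proof.
move=> M0; split.
- move=> [C [N _ MC]].
  have m0 : 0 < Num.max C 1 :> R by rewrite lt_max ltr01 orbT.
  exists (Num.max C 1) => //.
  have V : \oo [set n | (1%:E <= (n%:R `^ (Num.max C 1))%:E * M n)%E].
    exists (maxn N 2) => //= n /=; rewrite geq_max => /andP[Nn n2].
    have n0 : (0 < n)%N by apply: leq_trans n2.
    have nR : 0 < n%:R :> R by rewrite ltr0n.
    have lnn : 0 <= ln n%:R :> R by rewrite ln_ge0// ler1n.
    have := MC n Nn; have := M0 n n0.
    case: (M n) => [r r0|_ _|//].
    + rewrite ge_max => /andP[+ _].
      have [->|rn0] := eqVneq r 0; first by rewrite inve0.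
      have {rn0}r0 : 0 < r by rewrite lt_neqAle eq_sym rn0 -lee_fin.
      rewrite inver (gt_eqF r0) lneV// lne_EFin// -EFinN lee_fin => h.
      rewrite -EFinM lee_fin -ler_ln ?posrE ?mulr_gt0 ?powR_gt0//.
      rewrite ln1 lnM ?posrE ?powR_gt0// ln_powR.
      rewrite -lerBlDr sub0r (le_trans h)// ler_wpM2r// le_max lexx//.
    + by rewrite gt0_muley ?lte_fin ?powR_gt0// leey.
  rewrite (@lt_le_trans _ _ 1%:E) ?lte_fin//.
  rewrite /limn_einf leeNr /limn_esup.
  pose u n := ((n%:R `^ (Num.max C 1))%:E * M n)%E.
  apply: (@le_trans _ _ (ereal_sup ((\- u)%E @` [set n | (1%:E <= u n)%E]))).
    by apply: ereal_inf_lbound; exists [set n | (1%:E <= u n)%E].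
  by apply: ge_ereal_sup => _ [n /= Vn <-]; rewrite /= EFinN leeN2.
- move=> [al al0]; rewrite /limn_einf lteNr oppe0 => /ereal_inf_lt[_ [V [N _ NV] <-] s0].
  set s := ereal_sup _ in s0.
  have [dl dl0 dls] : exists2 dl : R, 0 < dl & (s <= - dl%:E)%E.
    move: s0; case: s => [r|//|_]; last by exists 1 => //; rewrite leNye.
    by rewrite lte_fin => r0; exists (- r); rewrite ?oppr_gt0// -EFinN opprK.
  exists (al + `|ln dl| / ln 2); exists (maxn N 2) => //= n /=.
  rewrite geq_max => /andP[Nn n2].
  have n0 : (0 < n)%N by apply: leq_trans n2.
  have nR : 0 < n%:R :> R by rewrite ltr0n.
  have ln2 : 0 < ln 2 :> R by rewrite ln_gt0// ltr1n.
  have lnn : ln 2 <= ln n%:R :> R by rewrite ler_ln ?posrE// ler_nat.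
  have lnn0 : 0 <= ln n%:R :> R by rewrite (le_trans _ lnn)// ltW.
  have C0 : 0 <= (al + `|ln dl| / ln 2) * ln n%:R.
    apply: mulr_ge0 => //; apply: addr_ge0; first exact: ltW.
    by apply: divr_ge0 => //; exact: ltW.
  have : (dl%:E <= (n%:R `^ al)%:E * M n)%E.
    rewrite -leeN2 (le_trans _ dls)//; apply: ereal_sup_ubound.
    by exists n => //; exact: NV.
  have := M0 n n0; case: (M n) => [r r0|_ _|//]; last first.
    by rewrite invey ge_max lee_fin C0 andbT le0_lneNy// leNye.
  rewrite -EFinM lee_fin => h.
  have {}r0 : 0 < r.
    rewrite lt_neqAle -lee_fin r0 andbT; apply/eqP => r00.
    by move: h; rewrite -r00 mulr0 leNgt dl0.
  rewrite inver (gt_eqF r0) lneV// lne_EFin// -EFinN ge_max !lee_fin C0 andbT.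
  have : ln dl <= al * ln n%:R + ln r.
    by rewrite -ln_powR -lnM ?posrE ?powR_gt0// ler_ln ?posrE ?mulr_gt0 ?powR_gt0.
  have h2 : `|ln dl| <= `|ln dl| / ln 2 * ln n%:R.
    by rewrite -mulrA ler_peMr// mulrC ler_pdivlMr// mul1r.
  have h3 : - `|ln dl| <= ln dl by rewrite lerNl -normrN ler_norm.
  rewrite mulrDl; move: h2 h3; set a := _ / _ * _; set b := al * _; lra.
Qed.

(* Main.v *)
(* Whitening the features, v = W h with P(v v^T) = 1 and |v|^2 = q_n, turns the
   excess risk of f into |u|^2, where u solves S u = P_n(v eps_f) and S is the
   empirical second moment of v.  Hence, once S is bounded below by 1/8, the
   excess risk is at most 64 |P_n(v eps_f)|^2.

   Lower bound on S: under P(q_n^2) = o(n), Chebyshev's inequality for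
   |S - 1|^2 in Frobenius norm is enough.  Under ||q_n|| log(2 d_n) = o(n), the
   potential tr((a + n S)^-p) is followed as the sample grows: by the
   Sherman-Morrison formula and the log-convexity of j |-> v^T N^j v, its
   expectation decreases like d (a + n/2)^-p, and a small potential forces a
   large smallest eigenvalue.

   Maximal inequality: for finitely many f, the expected maximum of
   |sum_i v(X_i) eps_f(X_i)|^2 is bounded by symmetrization and the subgaussian
   growth of (th + |z|^2)^p under random signs, with only the exp(p)
   representatives of a fine net of F in the union bound, p of order log n.
   The resulting bound involves max_f P_n(q_n eps_f^2), which the same argument
   applied to q_n eps_f^2 compares with gamma_n^2 + L_n^2 sqrt(p/n).  Countable
   families follow by continuity from below.  The hypothesis on M_n makes nets
   of polynomially small radius negligible. *)

Require Import Defs.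
From HB Require Import structures.
From mathcomp Require Import all_boot all_order all_algebra finmap.
From mathcomp Require Import all_classical all_reals all_analysis.
From mathcomp Require Import measurable_realfun ring lra.
Import Order.TTheory GRing.Theory Num.Theory.
Import numFieldNormedType.Exports.
Local Open Scope classical_set_scope.
Local Open Scope ring_scope.

Set Implicit Arguments.
Unset Strict Implicit.
Unset Printing Implicit Defensive.

(** * Bounded measurable functions *)

(** The nets must be fine in L^2(P), because eps_f contains the P-projection of f, and also in the
    empirical L^2 norm, so they depend on the sample. This is why symmetrization comes first: with
    the sample frozen and only the signs random, the representatives and the scale th may depend on
    the sample freely. Independence enters only by integrating out one coordinate at a time, which
    serves the variance, the trace potential and the symmetrization alike. No spectral decomposition
    is used: scalar inequalities for eigenvalues become log-convexity of moments and positivity of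
    traces. The two Gram regimes need separate lower bounds on S, but both force ||q_n|| to grow at
    most polynomially. Together with the lower bound on M_n, this makes a net of radius n^-K precise
    enough; the logarithm of its cardinality, of order log n, sets the moment order p and hence the
    rate. *)

Definition bounded_measurable (R : realType) (d : measure_display)
    (S : measurableType d) (f : S -> R) : Prop :=
  measurable_fun [set: S] f /\ exists M, forall x, `|f x| <= M.

Section bounded_measurable.
Context (R : realType) (d : measure_display) (S : measurableType d).
Implicit Types f g : S -> R.

Lemma bm_ext f g : f =1 g -> bounded_measurable f -> bounded_measurable g.
Proof. by move=> /funext ->. Qed.

Lemma bm_cst (c : R) : bounded_measurable (fun _ : S => c).
Proof. by split; [exact: measurable_cst|exists `|c|]. Qed.

Lemma bmD f g : bounded_measurable f -> bounded_measurable g ->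
  bounded_measurable (fun x => f x + g x).
Proof.
move=> [mf [M fM]] [mg [N gN]]; split; first exact: measurable_funD.
by exists (M + N) => x; rewrite (le_trans (ler_normD _ _))// lerD.
Qed.

Lemma bmM f g : bounded_measurable f -> bounded_measurable g ->
  bounded_measurable (fun x => f x * g x).
Proof.
move=> [mf [M fM]] [mg [N gN]]; split; first exact: measurable_funM.
by exists (M * N) => x; rewrite normrM ler_pM.
Qed.

Lemma bmZ (c : R) f : bounded_measurable f ->
  bounded_measurable (fun x => c * f x).
Proof. by move=> bf; apply: bmM => //; exact: bm_cst. Qed.

Lemma bmN f : bounded_measurable f -> bounded_measurable (fun x => - f x).
Proof.
move=> bf; by apply: bm_ext (bmZ (-1) bf) => x; rewrite mulN1r.
Qed.

Lemma bmB f g : bounded_measurable f -> bounded_measurable g ->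
  bounded_measurable (fun x => f x - g x).
Proof. by move=> bf bg; apply: bmD => //; exact: bmN. Qed.

Lemma bmX n f : bounded_measurable f -> bounded_measurable (fun x => f x ^+ n).
Proof.
move=> bf; elim: n => [|n IH]; first exact: bm_cst.
by apply: bm_ext (bmM bf IH) => x; rewrite exprS.
Qed.

Lemma bm_sum (I : Type) (r : seq I) (Q : pred I) (f : I -> S -> R) :
  (forall i, bounded_measurable (f i)) ->
  bounded_measurable (fun x => \sum_(i <- r | Q i) f i x).
Proof.
move=> bf; elim: r => [|i r IH].
  by apply: bm_ext (bm_cst 0) => x; rewrite big_nil.
case Qi : (Q i).
  by apply: bm_ext (bmD (bf i) IH) => x; rewrite big_cons Qi.
by apply: bm_ext IH => x; rewrite big_cons Qi.
Qed.

Lemma bm_max f g : bounded_measurable f -> bounded_measurable g ->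
  bounded_measurable (fun x => Num.max (f x) (g x)).
Proof.
move=> [mf [M fM]] [mg [N gN]]; split; first exact: measurable_maxr.
exists (Num.max M N) => x; rewrite /Num.max; case: ifP => _.
  by rewrite (le_trans (gN x))// le_max lexx orbT.
by rewrite (le_trans (fM x))// le_max lexx.
Qed.

Lemma bm_bigmax (I : Type) (r : seq I) (f : I -> S -> R) :
  (forall i, bounded_measurable (f i)) ->
  bounded_measurable (fun x => \big[Num.max/0]_(i <- r) f i x).
Proof.
move=> bf; elim: r => [|i r IH].
  by apply: bm_ext (bm_cst 0) => x; rewrite big_nil.
by apply: bm_ext (bm_max (bf i) IH) => x; rewrite big_cons.
Qed.

Lemma bm_comp d' (S' : measurableType d') f (phi : S' -> S) :
  measurable_fun setT phi -> bounded_measurable f ->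
  bounded_measurable (fun x => f (phi x)).
Proof.
move=> mphi [mf [M fM]]; split; first exact: measurableT_comp.
by exists M.
Qed.

Lemma bm_integrable (mu : {measure set S -> \bar R}) f :
  (mu [set: S] < +oo)%E -> bounded_measurable f ->
  mu.-integrable [set: S] (EFin \o f).
Proof.
move=> fin [mf [M fM]]; apply: measurable_bounded_integrable => //.
exists M; split; first exact: num_real.
by move=> N MN x _ /=; rewrite (le_trans (fM x))// ltW.
Qed.

Section expectation.
Variable Q : probability S R.

Lemma bm_integrableP f : bounded_measurable f ->
  Q.-integrable [set: S] (EFin \o f).
Proof.
by apply: bm_integrable; rewrite -ge0_fin_numE//; exact: fin_num_measure.
Qed.

Lemma E_cst (c : R) : \int[Q]_x c = c.
Proof. by rewrite Rintegral_cst// [X in fine X](@probability_setT _ _ _ Q) mulr1. Qed.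

Lemma ED f g : bounded_measurable f -> bounded_measurable g ->
  \int[Q]_x (f x + g x) = \int[Q]_x f x + \int[Q]_x g x.
Proof. by move=> bf bg; apply: RintegralD => //; exact: bm_integrableP. Qed.

Lemma EB f g : bounded_measurable f -> bounded_measurable g ->
  \int[Q]_x (f x - g x) = \int[Q]_x f x - \int[Q]_x g x.
Proof. by move=> bf bg; apply: RintegralB => //; exact: bm_integrableP. Qed.

Lemma EZ (c : R) f : bounded_measurable f ->
  \int[Q]_x (c * f x) = c * \int[Q]_x f x.
Proof. by move=> bf; apply: RintegralZl => //; exact: bm_integrableP. Qed.

Lemma E_sum (I : Type) (r : seq I) (p : pred I) (f : I -> S -> R) :
  (forall i, bounded_measurable (f i)) ->
  \int[Q]_x (\sum_(i <- r | p i) f i x) = \sum_(i <- r | p i) \int[Q]_x f i x.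
Proof.
move=> bf; elim: r => [|i r IH].
  by under eq_Rintegral do rewrite big_nil; rewrite E_cst big_nil.
under eq_Rintegral do rewrite big_cons.
rewrite big_cons -IH; case: (p i) => //.
by rewrite ED//; exact: bm_sum.
Qed.

Lemma E_le f g : bounded_measurable f -> bounded_measurable g ->
  (forall x, f x <= g x) -> \int[Q]_x f x <= \int[Q]_x g x.
Proof. by move=> bf bg fg; apply: le_Rintegral => //; exact: bm_integrableP. Qed.

Lemma E_ge0 f : (forall x, 0 <= f x) -> 0 <= \int[Q]_x f x.
Proof. by move=> f0; exact: Rintegral_ge0. Qed.

Lemma E_EFin f : bounded_measurable f ->
  (\int[Q]_x (f x)%:E)%E = (\int[Q]_x f x)%:E.
Proof.
move=> bf; rewrite /Rintegral fineK//.
by apply: integrable_fin_num => //; exact: (bm_integrableP bf).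
Qed.

Lemma E_markov f (c b : R) : bounded_measurable f -> (forall x, 0 <= f x) ->
  0 < c -> \int[Q]_x f x <= b -> (Q [set x | (c <= f x)%R] <= (b / c)%:E)%E.
Proof.
move=> bf f0 c0 Efb; have [mf _] := bf.
have mE : measurable [set x | c <= f x].
  rewrite -[X in measurable X]setTI; have := mf measurableT _ (measurable_itv `[c, +oo[).
  by congr measurable; apply/seteqP; split => x [_ /=]; rewrite in_itv/= andbT.
have H : (c%:E * Q [set x | (c <= f x)%R] <= (\int[Q]_x f x)%:E)%E.
  rewrite -E_EFin//.
  have <- : (\int[Q]_(x in [set x | (c <= f x)%R]) (cst c%:E) x = c%:E * Q [set x | (c <= f x)%R])%E.
    exact: integral_cst.
  apply: (@le_trans _ _ (\int[Q]_(x in [set x | (c <= f x)%R]) (f x)%:E)%E); last first.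
    by apply: ge0_subset_integral => //; [exact/measurable_EFinP|move=> x _; rewrite lee_fin].
  apply: ge0_le_integral => //; first by move=> x _; rewrite lee_fin ltW.
  by apply/measurable_EFinP; apply: measurable_funTS.
rewrite mulrC EFinM lee_pdivlMl//; apply: le_trans H _.
by rewrite lee_fin.
Qed.

End expectation.
End bounded_measurable.

(** * Independence by resampling one coordinate *)

Definition update (T : Type) (y : nat -> T) (k : nat) (x : T) : nat -> T :=
  fun i => if i == k then x else y i.

(* Measurability of [Phi] for the product sigma-algebra, without constructing
   that sigma-algebra: substituting measurable coordinates into [Phi] always
   gives a measurable function. *)
Definition seq_bm (R : realType) (d : measure_display) (T : measurableType d)
    (Phi : (nat -> T) -> R) : Prop :=
  forall (d' : measure_display) (S : measurableType d') (Y : nat -> S -> T),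
    (forall i, measurable_fun [set: S] (Y i)) ->
    bounded_measurable (fun s => Phi (Y^~ s)).

Lemma bm_partial_integral (R : realType) (d1 d2 : measure_display)
    (S : measurableType d1) (T : measurableType d2) (P : probability T R)
    (f : S * T -> R) :
  bounded_measurable f -> bounded_measurable (fun s => \int[P]_x f (s, x)).
Proof.
move=> [mf [M fM]].
have bf s : bounded_measurable (fun x => f (s, x)).
  by split; [exact: measurableT_comp|exists M].
split; last first.
  exists M => s; rewrite ler_norml -{1}(E_cst P (- M)) -{2}(E_cst P M).
  by apply/andP; split; apply: E_le; rewrite ?bm_cst//; try exact: bm_cst;
    move=> x; have := fM (s, x); rewrite ler_norml => /andP[].
(* Shifting by the bound M makes the integrand nonnegative, so that Tonelli's measurability
   statement applies. *)
pose F (z : S * T) := (f z + M)%:E.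
have mF : measurable_fun [set: S] (fubini_F P F).
  apply: measurable_fun_fubini_tonelli_F.
    by apply/measurable_EFinP; exact: measurable_funD.
  by move=> z; rewrite lee_fin -lerBlDr sub0r; have := fM z; rewrite ler_norml => /andP[].
have FE s : \int[P]_x f (s, x) = fine (fubini_F P F s) - M.
  rewrite /fubini_F /F (_ : fine _ = \int[P]_x (f (s, x) + M))//.
  by rewrite ED// ?E_cst ?addrK//; exact: bm_cst.
rewrite (_ : (fun s => _) = (fun s => fine (fubini_F P F s) - M)); last exact/funext.
by apply: measurable_funB => //; exact: measurableT_comp mF.
Qed.

Lemma seq_bm_integral (R : realType) (d : measure_display) (T : measurableType d)
    (P : probability T R) (Phi : (nat -> T) -> R) (k : nat) :
  seq_bm Phi -> seq_bm (fun y => \int[P]_x Phi (update y k x)).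
Proof.
move=> bPhi d' S Y mY.
apply: (@bm_partial_integral _ _ _ S T P (fun z => Phi (update (Y^~ z.1) k z.2))).
apply: (bPhi _ _ (fun i z => update (Y^~ z.1) k z.2 i)) => i; rewrite /update.
by case: eqP => _; [exact: measurable_snd|exact: measurableT_comp].
Qed.

Section resampling.
Context (R : realType) (dX dO : measure_display) (T : measurableType dX)
  (Omega : measurableType dO) (P : probability T R) (Pr : probability Omega R)
  (X : nat -> {RV Pr >-> T}).
Hypothesis hX : iid P X.

(** A pi-system generating the sigma-algebra of all coordinates other than the k-th. *)
Definition cylinders (k : nat) : set (set Omega) :=
  [set A | exists (J : {fset nat}) (B : nat -> set T),
    [/\ forall i, measurable (B i), k \notin J &
        A = \bigcap_(i in [set` J]) (X i @^-1` B i)]].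

Lemma measurable_preimage_X i B : measurable B -> measurable (X i @^-1` B).
Proof. by move=> mB; rewrite -[X in measurable X]setTI; exact: measurable_funP. Qed.

Lemma cylinders_measurable k : cylinders k `<=` measurable.
Proof.
move=> _ [J [B [mB _ ->]]]; apply: fin_bigcap_measurable => //.
by move=> i _; exact: measurable_preimage_X.
Qed.

Lemma cylinders_setI k : setI_closed (cylinders k).
Proof.
move=> _ _ [J1 [B1 [mB1 kJ1 ->]]] [J2 [B2 [mB2 kJ2 ->]]].
pose B i := (if i \in J1 then B1 i else setT) `&` (if i \in J2 then B2 i else setT).
exists (J1 `|` J2)%fset, B; split.
- by move=> i; apply: measurableI; case: ifP.
- by rewrite in_fsetU negb_or kJ1.
- apply/seteqP; split => w.
    move=> [w1 w2] i /= _; split; case: ifP => // iJ; [exact: w1|exact: w2].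
  move=> Bw; split => i /= iJ.
    by have := Bw i; rewrite /= in_fsetU iJ /= => /(_ isT)[]; rewrite iJ.
  by have := Bw i; rewrite /= in_fsetU iJ orbT /= => /(_ isT)[]; rewrite iJ.
Qed.

(** Both sides are finite measures in A. They agree on the pi-system [cylinders k] by the product
    rule for J with k adjoined, hence on the sigma-algebra it generates. *)
Lemma cylinders_indep k A B : <<s cylinders k >> A -> measurable B ->
  (Pr (A `&` X k @^-1` B) = P B * Pr A)%E.
Proof.
move=> sA mB; have mXB := measurable_preimage_X k mB.
pose b : {nonneg R} := NngNum (fine_ge0 (measure_ge0 P B)).
have bE : b%:num%:E = P B by rewrite /= fineK//; exact: fin_num_measure.
have [hi hd] := hX.
have := @g_sigma_algebra_measure_unique _ R Omega (cylinders k)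
  (@cylinders_measurable k) (fun _ => setT) _ _ (mrestr Pr mXB) (mscale b Pr)
  (@cylinders_setI k) _ _ A sA.
rewrite /mrestr/= /mscale /= fineK; last exact: fin_num_measure.
apply.
- by move=> _; exists fset0, (fun _ => setT); split => //; rewrite set_fset0 bigcap_set0.
- by rewrite bigcup_const//; exists 0%N.
- move=> _ [J [B1 [mB1 kJ ->]]].
  pose B' i := if i == k then B else B1 i.
  have mB' i : measurable (B' i) by rewrite /B'; case: ifP.
  have := hi (k |` J)%fset B' (fun i _ => mB' i).
  rewrite big_fsetU1//= [B' k]/B' eqxx.
  have -> : \bigcap_(i in [set` (k |` J)%fset]) X i @^-1` B' i =
     \bigcap_(i in [set` J]) (X i @^-1` B1 i) `&` X k @^-1` B.
    apply/seteqP; split => w.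
      move=> Bw; split.
        move=> i /= iJ; have := Bw i; rewrite /= in_fsetU iJ orbT => /(_ isT).
        by rewrite /B'; case: eqP => // ik; rewrite -ik iJ in kJ.
      by have := Bw k; rewrite /= !inE eqxx => /(_ isT); rewrite /B' eqxx.
    move=> [w1 w2] i /=; rewrite !inE /B' => /orP[/eqP ->|iJ]; first by rewrite eqxx.
    by case: eqP => [->//|_]; exact: w1.
  have -> : Pr (X k @^-1` B) = P B by rewrite -(hd k).
  rewrite /mrestr => ->; congr (_ * _)%E.
  rewrite (hi J B1 (fun i _ => mB1 i)); apply: eq_big_seq => i iJ.
  by rewrite /B'; case: eqP => // ik; rewrite -ik iJ in kJ.
- move=> n; rewrite /mrestr; rewrite -ge0_fin_numE//; apply: fin_num_measure.
  exact: measurableI.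
Qed.

Section one_coordinate.
Variable k : nat.
(** The same points as Omega with a coarser sigma-algebra: forgetting coordinate k is then the
    identity map, and no sequence space is needed to state that the forgotten sample and X k have a
    product law. *)
Let S : measurableType _ := g_sigma_algebraType (cylinders k).

Let forget (w : Omega) : S := w.

Let measurable_forget : measurable_fun [set: Omega] forget.
Proof.
move=> _ A mA; rewrite setTI; apply: (smallest_sub _ (@cylinders_measurable k)) mA.
exact: sigma_algebra_measurable.
Qed.

Let joint (w : Omega) : S * T := (forget w, X k w).

Let measurable_joint : measurable_fun [set: Omega] joint.
Proof. by apply/measurable_fun_pairP; split => //; exact: measurable_funP. Qed.

Let forget_mfun : {mfun Omega >-> S} :=
  HB.pack forget (isMeasurableFun.Build _ _ _ _ _ measurable_forget).

Let joint_mfun : {mfun Omega >-> (S * T)%type} :=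
  HB.pack joint (isMeasurableFun.Build _ _ _ _ _ measurable_joint).

Let law : probability S R := distribution Pr forget_mfun.

Let jointE (A : set (S * T)) : measurable A ->
  ((law \x P) A = distribution Pr joint_mfun A)%E.
Proof.
apply: product_measure_unique => A1 A2 mA1 mA2.
by rewrite muleC; exact: (cylinders_indep mA1 mA2).
Qed.

(** Fubini for the product law of the sample without coordinate k and of X k. *)
Lemma resample (Phi : (nat -> T) -> R) : seq_bm Phi ->
  \int[Pr]_w Phi (X^~ w) = \int[Pr]_w \int[P]_x Phi (update (X^~ w) k x).
Proof.
move=> bPhi.
(* Coordinate k is read from the second factor, all others from the first. *)
pose Y i (z : S * T) : T := if i == k then z.2 else X i z.1.
have mY i : measurable_fun [set: S * T] (Y i).
  rewrite /Y; case: eqVneq => ik; first exact: measurable_snd.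
  apply: (@measurableT_comp _ _ _ _ _ _ (X i : S -> T)); last exact: measurable_fst.
  move=> _ B mB; rewrite setTI; apply: sub_sigma_algebra.
  exists [fset i]%fset, (fun _ => B); split => //; first by rewrite in_fset1 eq_sym.
  by apply/seteqP; split => w; [move=> wB j /=; rewrite in_fset1 => /eqP ->
    |move=> /(_ i); apply; rewrite /= in_fset1].
have bY := bPhi _ _ _ mY.
have -> : \int[Pr]_w Phi (X^~ w) = \int[(law \x P)%E]_z Phi (Y^~ z).
  rewrite /Rintegral; congr fine.
  rewrite (eq_measure_integral (distribution Pr joint_mfun)); last by move=> A mA _; exact: jointE.
  rewrite integral_pushforward//.
  - by apply: eq_integral => w _ /=; congr (Phi _)%:E; apply/funext => i;
      rewrite /Y /=; case: eqP => [->|].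
  - by apply/measurable_EFinP; case: bY.
  - by apply: bm_integrableP; exact: (bm_comp measurable_joint bY).
have iY : ((law \x P)%E).-integrable [set: S * T] (EFin \o (fun z => Phi (Y^~ z))).
  apply: bm_integrable bY; rewrite [X in (X < _)%E](jointE measurableT).
  by rewrite -ge0_fin_numE//; exact: fin_num_measure.
have YE w x : Phi (Y^~ (w, x)) = Phi (update (X^~ w) k x) by [].
have bx w : bounded_measurable (fun x => Phi (update (X^~ w) k x)).
  by apply: (bPhi _ _ (fun i x => update (X^~ w) k x i)) => i; rewrite /update; case: eqP.
have FE w : fubini_F P (EFin \o (fun z => Phi (Y^~ z))) w =
    (\int[P]_x Phi (update (X^~ w) k x))%:E.
  by rewrite /fubini_F -E_EFin.
rewrite /Rintegral; congr fine.
rewrite -integral12_prod_meas1//.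
have mF := measurable_fubini_F iY.
rewrite integral_pushforward//; first by apply: eq_integral => w _; exact: FE.
rewrite (_ : _ \o _ = EFin \o fun w => \int[P]_x Phi (update (X^~ w) k x)).
  apply: bm_integrableP.
  by apply: (seq_bm_integral P k bPhi) => i; exact: measurable_funP.
by apply/funext => w; exact: FE.
Qed.

End one_coordinate.

Lemma seq_bm_sample (Phi : (nat -> T) -> R) : seq_bm Phi ->
  bounded_measurable (fun w => Phi (X^~ w)).
Proof. by move=> bPhi; apply: bPhi => i; exact: measurable_funP. Qed.

(** The form in which independence is used below: a comparison that holds conditionally on all
    coordinates but one holds in expectation. *)
Lemma E_le_resample (k : nat) (Phi Psi : (nat -> T) -> R) :
  seq_bm Phi -> seq_bm Psi ->
  (forall y, \int[P]_x Phi (update y k x) <= \int[P]_x Psi (update y k x)) ->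
  \int[Pr]_w Phi (X^~ w) <= \int[Pr]_w Psi (X^~ w).
Proof.
move=> bPhi bPsi le; rewrite (resample k bPhi) (resample k bPsi).
by apply: E_le => [||w]; [exact: seq_bm_sample (seq_bm_integral _ _ _)..|exact: le].
Qed.
End resampling.

(** * Quadratic forms and trace powers *)

Section quadratic_forms.
Context (R : realFieldType) (d : nat).
Implicit Types (A B N : 'M[R]_d) (x y u v : 'cV[R]_d).

Definition bil A x y : R := (x^T *m A *m y) ord0 ord0.

Definition sqnorm x : R := (x^T *m x) ord0 ord0.

Definition psd A : Prop := A^T = A /\ forall x, 0 <= bil A x x.

Lemma bil_suml A x y : bil A x y = \sum_i \sum_j x i ord0 * A i j * y j ord0.
Proof.
rewrite /bil mxE exchange_big; apply: eq_bigr => j _.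
by rewrite mxE big_distrl; apply: eq_bigr => i _; rewrite mxE.
Qed.

Lemma sqnormE x : sqnorm x = \sum_i x i ord0 ^+ 2.
Proof. by rewrite /sqnorm mxE; apply: eq_bigr => i _; rewrite mxE expr2. Qed.

Lemma sqnorm_ge0 x : 0 <= sqnorm x.
Proof. by rewrite sqnormE; apply: sumr_ge0 => i _; exact: sqr_ge0. Qed.

Lemma bil1 x y : bil 1%:M x y = (x^T *m y) ord0 ord0.
Proof. by rewrite /bil mulmx1. Qed.

Lemma bilDl A x y z : bil A (x + y) z = bil A x z + bil A y z.
Proof. by rewrite /bil linearD/= !mulmxDl mxE. Qed.

Lemma bilDr A x y z : bil A z (x + y) = bil A z x + bil A z y.
Proof. by rewrite /bil mulmxDr mxE. Qed.

Lemma bilZl A a x y : bil A (a *: x) y = a * bil A x y.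
Proof. by rewrite /bil linearZ/= -!scalemxAl mxE. Qed.

Lemma bilZr A a x y : bil A x (a *: y) = a * bil A x y.
Proof. by rewrite /bil -!scalemxAr mxE. Qed.

Lemma bilDm A B x y : bil (A + B) x y = bil A x y + bil B x y.
Proof. by rewrite /bil mulmxDr mulmxDl mxE. Qed.

Lemma bilNm A x y : bil (- A) x y = - bil A x y.
Proof. by rewrite /bil mulmxN mulNmx mxE. Qed.

Lemma bilZm A a x y : bil (a *: A) x y = a * bil A x y.
Proof. by rewrite /bil -scalemxAr -scalemxAl mxE. Qed.

Lemma bilMr A B x y : bil (A *m B) x y = bil A x (B *m y).
Proof. by rewrite /bil !mulmxA. Qed.

Lemma bilMl A B x y : bil (A *m B) x y = bil B (A^T *m x) y.
Proof. by rewrite /bil trmx_mul trmxK !mulmxA. Qed.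

Lemma bil_sym A x y : A^T = A -> bil A x y = bil A y x.
Proof.
move=> sA; rewrite /bil -[in LHS](trmxK (_ *m y)) mxE.
by rewrite !trmx_mul trmxK sA mulmxA.
Qed.

Lemma bil_rank1 (w : 'cV[R]_d) x y :
  bil (w *m w^T) x y = (x^T *m w) ord0 ord0 * (w^T *m y) ord0 ord0.
Proof. by rewrite /bil !mulmxA -mulmxA mxE big_ord1. Qed.

Lemma bil_outer A (w : 'cV[R]_d) x y :
  bil A x (w *m w^T *m y) = bil A x w * bil 1%:M w y.
Proof. by rewrite /bil mulmx1 !mulmxA -mulmxA mxE big_ord1. Qed.

Lemma psd1 : psd 1%:M.
Proof. by split; [rewrite trmx1|move=> x; rewrite bil1; exact: sqnorm_ge0]. Qed.

Lemma psd_CS A x y : psd A -> bil A x y ^+ 2 <= bil A x x * bil A y y.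
Proof.
move=> [sA pA]; set a := bil A x x; set b := bil A x y; set c := bil A y y.
have q s t : 0 <= a * s ^+ 2 + b * s * t *+ 2 + c * t ^+ 2.
  have := pA (s *: x + t *: y).
  rewrite !bilDl !bilDr !bilZl !bilZr (bil_sym y x sA) -/a -/b -/c.
  by congr (0 <= _); ring.
have c0 : 0 <= c := pA y.
have := c0; rewrite le_eqVlt => /predU1P[c00|cp].
  rewrite -c00 mulr0; case: (eqVneq b 0) => [->|b0]; first by rewrite expr0n.
  (* When c = 0 the form is affine in t; this choice of t gives it the value -1 unless b = 0. *)
  have := q 1 (- (a + 1) / (2 * b)); rewrite -c00 mul0r addr0 => {}q.
  have E : b * 1 * (- (a + 1) / (2 * b)) *+ 2 = - (a + 1) by field.
  by move: q; rewrite E; lra.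
have := q c (- b).
have -> : a * c ^+ 2 + b * c * - b *+ 2 + c * (- b) ^+ 2 = c * (a * c - b ^+ 2) by ring.
by rewrite pmulr_rge0// subr_ge0.
Qed.

Lemma bil_delta A i y : bil A (delta_mx i ord0) y = (A *m y) i ord0.
Proof. by rewrite /bil trmx_delta -mulmxA -rowE mxE. Qed.

Lemma psd_tr_ge0 A : psd A -> 0 <= \tr A.
Proof.
move=> [_ pA]; apply: sumr_ge0 => i _; have := pA (delta_mx i ord0).
by rewrite bil_delta -colE mxE.
Qed.

(** Cauchy-Schwarz twice: for the form A against each basis vector, |A u|^2 <= (u^T A u) tr A, and
    for the standard form, (u^T A u)^2 <= |u|^2 |A u|^2. *)
Lemma psd_le_tr A u : psd A -> bil A u u <= sqnorm u * \tr A.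
Proof.
move=> pA; have [sA A0] := pA; have := A0 u; rewrite le_eqVlt => /predU1P[<-|ap].
  by apply: mulr_ge0; [exact: sqnorm_ge0|exact: psd_tr_ge0].
have h1 : sqnorm (A *m u) <= bil A u u * \tr A.
  rewrite sqnormE /mxtrace mulr_sumr; apply: ler_sum => i _.
  have e : bil A (delta_mx i ord0) (delta_mx i ord0) = A i i.
    by rewrite bil_delta -colE mxE.
  by rewrite -bil_delta mulrC -e; exact: psd_CS.
have h2 : bil A u u ^+ 2 <= sqnorm u * sqnorm (A *m u).
  have := psd_CS u (A *m u) psd1; rewrite !bil1.
  by rewrite (_ : (u^T *m (A *m u)) ord0 ord0 = bil A u u)// /bil mulmxA.
have h3 : bil A u u * bil A u u <= bil A u u * (sqnorm u * \tr A).
  rewrite -expr2 (le_trans h2)// mulrCA ler_wpM2l//; exact: sqnorm_ge0.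
by move: h3; rewrite ler_pM2l.
Qed.
End quadratic_forms.

Lemma logconvex_seq (R : realFieldType) (s : nat -> R) :
  (forall j, 0 <= s j) -> (forall j, s j.+1 ^+ 2 <= s j * s j.+2) ->
  forall a b, s a * s b <= s 0%N * s (a + b)%N.
Proof.
move=> s0 lc.
have step a k : s a.+1 * s (a + k)%N <= s a * s (a + k).+1.
  elim: k => [|k IH]; first by rewrite addn0 mulrC.
  rewrite addnS; have := s0 (a + k).+1; rewrite le_eqVlt => /predU1P[<-|sp].
    by rewrite mulr0 mulr_ge0.
  rewrite -(ler_pM2r sp) -mulrA -expr2.
  apply: le_trans (ler_wpM2l (s0 _) (lc _)) _.
  rewrite mulrA [leRHS]mulrAC; apply: ler_wpM2r => //.
have wl a b : (a <= b)%N -> s a * s b <= s 0%N * s (a + b)%N.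
  elim: a b => [//|a IH] b ab; rewrite addSn.
  apply: le_trans (_ : _ <= s a * s b.+1) _.
    by have := step a (b - a)%N; rewrite subnKC// ltnW.
  by rewrite -addnS; apply: IH; rewrite ltnW// ltnW.
move=> a b; have [ab|/ltnW ba] := leqP a b; first exact: wl.
by rewrite mulrC addnC; exact: wl.
Qed.

(** * Moments of a positive semidefinite matrix and rank-one updates *)

Section matrix_moments.
Context (R : realFieldType) (d : nat).
Implicit Types (A B N : 'M[R]_d) (u v : 'cV[R]_d).

Lemma trmxX N j : N^T = N -> (N ^+ j)^T = N ^+ j.
Proof.
move=> sN; elim: j => [|j IH]; first by rewrite expr0 trmx1.
by rewrite [in LHS]exprS -mulmxE trmx_mul IH sN mulmxE -exprSr.
Qed.

Lemma psdX N j : psd N -> psd (N ^+ j).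
Proof.
move=> pN; have [sN N0] := pN; split; first exact: trmxX.
elim/ltn_ind: j => -[|[|j]] IH x.
- by rewrite expr0; apply: (psd1 R d).2.
- by rewrite expr1.
- rewrite exprS exprSr -mulmxE bilMl bilMr sN; exact: IH.
Qed.

(** The j-th moment of the spectral measure of N at v. *)
Definition moment N v j : R := bil (N ^+ j) v v.

Lemma moment_ge0 N v j : psd N -> 0 <= moment N v j.
Proof. by move=> pN; apply: (psdX j pN).2. Qed.

Lemma moment0 N v : moment N v 0 = sqnorm v.
Proof. by rewrite /moment expr0 bil1. Qed.

Lemma bil_powers N v i j k : N^T = N ->
  bil (N ^+ i) (N ^+ j *m v) (N ^+ k *m v) = moment N v (j + i + k).
Proof.
move=> sN; rewrite /moment -bilMr -[in LHS](trmxX j sN) -bilMl.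
by rewrite mulmxE -!exprD addnA.
Qed.

Lemma moment_logconvex N v j : psd N ->
  moment N v j.+1 ^+ 2 <= moment N v j * moment N v j.+2.
Proof.
move=> pN; have [sN _] := pN.
have := psd_CS v (N *m v) (psdX j pN).
have e1 : bil (N ^+ j) v (N *m v) = moment N v j.+1.
  by rewrite -bilMr mulmxE -exprSr.
have e2 : bil (N ^+ j) (N *m v) (N *m v) = moment N v j.+2.
  by have := bil_powers v j 1 1 sN; rewrite expr1 add1n addn1.
by rewrite e1 e2.
Qed.

(** Log-convexity started at index 1 rather than 0: the first moment is the quantity kept small in
    [tr_rank1_update]. *)
Lemma moment_mul N v a b : psd N ->
  moment N v a.+1 * moment N v b.+1 <= moment N v 1 * moment N v (a + b).+1.
Proof.
move=> pN; apply: (@logconvex_seq _ (fun j => moment N v j.+1)) => j.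
  exact: moment_ge0.
exact: moment_logconvex.
Qed.

(** Jensen's inequality for t^p under the spectral measure, whose total mass is |v|^2. *)
Lemma moment_pow_le N v p : psd N -> (0 < p)%N ->
  moment N v 1 ^+ p <= sqnorm v ^+ p.-1 * moment N v p.
Proof.
move=> pN; elim: p => // -[|p] IH _; first by rewrite expr1 expr0 mul1r.
have m0 := moment_ge0 v _ pN.
rewrite exprS; apply: le_trans (ler_wpM2l (m0 _) (IH isT)) _.
rewrite mulrCA /= exprSr -mulrA; apply: ler_wpM2l; first exact/exprn_ge0/sqnorm_ge0.
have := @logconvex_seq _ (moment N v) m0 (fun j => moment_logconvex v j pN) 1%N p.+1.
by rewrite moment0 add1n.
Qed.

Lemma tr_outer A B (w : 'cV[R]_d) : A^T = A -> B^T = B ->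
  \tr (A *m (w *m w^T *m B)) = bil A w (B *m w).
Proof.
move=> sA sB; rewrite (_ : _ *m _ = (A *m w) *m (w^T *m B)); last by rewrite !mulmxA.
rewrite mxtrace_mulC [X in \tr X]mx11_scalar mxtrace_scalar mulr1n.
have -> : (w^T *m B *m (A *m w)) 0 0 = (w^T *m B *m (A *m w))^T 0 0 by rewrite [RHS]mxE.
by rewrite !trmx_mul trmxK sA sB /bil !mulmxA.
Qed.

Section rank_one_update.
Variables (N : 'M[R]_d) (v : 'cV[R]_d).
Hypothesis pN : psd N.
Let mu := moment N v.
Let c := (1 + mu 1%N)^-1.
Let w := N *m v.

(** The inverse of A + v v^T when N is the inverse of A, written in terms of N alone. *)
Definition rank1_update : 'M[R]_d := N - c *: (w *m w^T).
Let N' := rank1_update.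

Let sN : N^T = N. Proof. by case: pN. Qed.
Let mu0 j : 0 <= mu j. Proof. exact: moment_ge0. Qed.
Let c_gt0 : 0 < c.
Proof. by rewrite invr_gt0 ltr_pwDl. Qed.
Let c_sum : c + c * mu 1%N = 1.
Proof. by rewrite -[c in c + _]mulr1 -mulrDr mulVf// gt_eqF// ltr_pwDl. Qed.
Let cmu_le1 : c * mu 1%N <= 1.
Proof. by rewrite mulrC ler_pdivrMr ?mul1r ?lerDr// ltr_pwDl. Qed.

Let wx x : (w^T *m x) ord0 ord0 = bil N v x.
Proof. by rewrite /w trmx_mul sN. Qed.

Lemma bil_rank1_update x : bil N' x x = bil N x x - c * bil N v x ^+ 2.
Proof.
rewrite /N' /rank1_update bilDm bilNm bilZm bil_rank1 wx expr2.
by rewrite -[x^T *m w]/(x^T *m (N *m v)) mulmxA -/(bil N x v) (bil_sym x v sN).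
Qed.

Lemma psd_rank1_update : psd N'.
Proof.
split.
  by rewrite /N' /rank1_update linearB linearZ/= trmx_mul trmxK sN.
move=> x; rewrite bil_rank1_update subr_ge0.
have := psd_CS v x pN; rewrite -[bil N v v]/(moment N v 1) => h.
apply: le_trans (ler_wpM2l (ltW c_gt0) h) _.
by rewrite mulrA -[leRHS]mul1r; apply: ler_wpM2r; [case: pN|].
Qed.

Lemma rank1_update_le x : bil N' x x <= bil N x x.
Proof.
by rewrite bil_rank1_update lerBlDr lerDl; apply: mulr_ge0; [exact: ltW|exact: sqr_ge0].
Qed.

(* Sherman-Morrison *)
Lemma rank1_update_inv A : A *m N = 1%:M -> (A + v *m v^T) *m N' = 1%:M.
Proof.
move=> AN; rewrite /N' /rank1_update mulmxBr !mulmxDl AN -!scalemxAr.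
have e1 : A *m (w *m w^T) = v *m w^T by rewrite /w mulmxA mulmxA AN mul1mx.
have e2 : v *m v^T *m N = v *m w^T by rewrite /w trmx_mul sN mulmxA.
have e3 : v *m v^T *m (w *m w^T) = mu 1%N *: (v *m w^T).
  rewrite /w !mulmxA -(mulmxA v) -(mulmxA v (v^T *m N)).
  rewrite [v^T *m N *m v]mx11_scalar mul_mx_scalar -scalemxAl -!mulmxA.
  by rewrite /mu /moment expr1 /bil mulmxA !ord1.
by rewrite e1 e2 e3 scalerA -scalerDl c_sum scale1r addrK.
Qed.

(** The loss when one factor N' of a trace is exchanged for N. The bounds below show that b i j
    stays within the factor 1 - i c mu_1 of the moment mu_(i+j+2) of N itself. *)
Let b i j := bil (N' ^+ i) w (N ^+ j *m w).

Let b0 j : b 0 j = mu (j + 2).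
Proof.
have := bil_powers v 0 1 j.+1 sN; rewrite expr1 expr0 exprSr -mulmxE -mulmxA => e.
by rewrite /b expr0 e addn0 add1n addn2.
Qed.

Let bS i j : b i.+1 j = b i j.+1 - c * b i 0 * mu (j + 2).
Proof.
rewrite -b0 /b exprSr -mulmxE bilMr {2}/N' /rank1_update mulmxBl.
rewrite bilDr -[- _]scaleN1r bilZr mulN1r exprS -mulmxE mulmxA; congr (_ - _).
by rewrite -scalemxAl bilZr bil_outer !expr0 mul1mx mulrA.
Qed.

Let b_ge0 i : 0 <= b i 0.
Proof. by rewrite /b expr0 mul1mx; apply: (psdX i psd_rank1_update).2. Qed.

Let b_le i j : b i j <= mu (i + j + 2).
Proof.
elim: i j => [|i IH] j; first by rewrite b0.
rewrite bS addSnnS; apply: le_trans (IH j.+1).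
rewrite lerBlDr lerDl; apply: mulr_ge0 => //; apply: mulr_ge0 => //; exact: ltW.
Qed.

Let b_lower i j : mu (i + j + 2) * (1 - i%:R * (c * mu 1%N)) <= b i j.
Proof.
elim: i j => [|i IH] j; first by rewrite b0 mul0r subr0 mulr1.
have h : b i 0 * mu (j + 2) <= mu 1%N * mu (i.+1 + j + 2).
  apply: le_trans (ler_wpM2r (mu0 _) (b_le i 0)) _.
  have := moment_mul v i.+1 j.+1 pN; rewrite -/mu addn0 !addn2.
  by rewrite (_ : (i.+1 + j.+1).+1 = (i.+1 + j).+2) ?addnS.
have := IH j.+1; rewrite -(addSnnS i j) => {}IH; rewrite bS.
have := ler_wpM2l (ltW c_gt0) h.
move: IH; rewrite -[i.+1%:R]natr1 mulrDl mul1r.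
set m := mu (i.+1 + j + 2); rewrite !mulrA => IH {}h.
rewrite opprD addrA [leLHS]mulrBr; apply: lerB => //.
by rewrite [leRHS]mulrC.
Qed.

(* The trace of a power is telescoped by exchanging one factor [N'] for [N] at
   a time. *)
Lemma tr_rank1_update p : (0 < p)%N -> p%:R * mu 1%N <= 4^-1 ->
  \tr (N' ^+ p) <= \tr (N ^+ p) - p%:R / 2 * mu p.+1.
Proof.
move=> p0 pmu.
have trS i j : \tr (N' ^+ i.+1 *m N ^+ j) =
    \tr (N' ^+ i *m N ^+ j.+1) - c * b i j.
  rewrite [in LHS]exprSr -mulmxE -mulmxA {2}/N' /rank1_update mulmxBl.
  rewrite mulmxBr linearB/= exprS -mulmxE; congr (_ - _).
  rewrite -scalemxAl -scalemxAr linearZ/=; congr (_ * _).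
  by apply: tr_outer; apply: trmxX => //; case: psd_rank1_update.
have trI i j : (i <= p)%N ->
    \tr (N' ^+ i *m N ^+ j) <= \tr (N ^+ (i + j)) -
      i%:R * (c * (1 - p%:R * (c * mu 1%N)) * mu (i + j).+1).
  elim: i j => [|i IH] j ip; first by rewrite expr0 mul1mx mul0r subr0.
  rewrite trS; have := IH j.+1 (ltnW ip); rewrite -addSnnS => {}IH.
  rewrite -natr1 mulrDl mul1r opprD addrA; apply: lerB => //.
  rewrite -mulrA; apply: ler_wpM2l; first exact: ltW.
  apply: le_trans (b_lower i j); rewrite addn2 addSn mulrC.
  apply: ler_wpM2l => //; rewrite lerD2l lerN2; apply: ler_wpM2r.
    by apply: mulr_ge0 => //; exact: ltW.
  by rewrite ler_nat ltnW.
have := trI p 0%N (leqnn p); rewrite expr0 mulmx1 addn0 => h.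
apply: le_trans h _; rewrite lerD2l lerN2 -mulrA; apply: ler_wpM2l => //.
apply: ler_wpM2r => //.
have p1 : 1 <= p%:R :> R by rewrite ler1n.
have m4 : mu 1%N <= 4^-1.
  by apply: le_trans pmu; rewrite ler_peMl.
(* With p c mu_1 <= 1/4 this makes c (1 - p c mu_1) at least 3/5, above the required 1/2. *)
have c45 : 4 / 5 <= c.
  by have := c_sum; have := ler_wpM2l (ltW c_gt0) m4; lra.
have c1 : c <= 1.
  by rewrite invf_le1 ?ltr_pwDl// lerDl.
have x0 : 0 <= p%:R * (c * mu 1%N) by rewrite !mulr_ge0// ltW.
have x4 : p%:R * (c * mu 1%N) <= 4^-1.
  by rewrite mulrCA (le_trans _ pmu)// ler_piMl// mulr_ge0.
nra.
Qed.
End rank_one_update.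
End matrix_moments.

(** * Trace powers of resolvents *)

Section trace_powers.
Context (R : realFieldType) (d : nat).
Implicit Types (A N : 'M[R]_d).

(** Summed over eigenvalues x of N, this is Young's inequality (p+1) t x^p <= p x^(p+1) + t^(p+1).
    Eigenvalues are avoided by an induction on p in which each step is the positivity of tr(N^j (N -
    t)^2). *)
Lemma tr_power_tangent N (t : R) p : psd N -> 0 <= t ->
  t * (\tr (N ^+ p) - t ^+ p * d%:R) <=
  p%:R * (\tr (N ^+ p.+1) - t * \tr (N ^+ p)).
Proof.
move=> pN t0; have [sN _] := pN.
pose D j := \tr (N ^+ j.+1) - t * \tr (N ^+ j).
have D_incr j : t * D j <= D j.+1.
  pose B := N ^+ j.+2 + (- (2 * t)) *: N ^+ j.+1 + t ^+ 2 *: N ^+ j.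
  have pB : psd B.
    split; first by rewrite /B !linearD/= !linearZ/= !trmxX.
    move=> x; rewrite /B !bilDm !bilZm.
    have := (psdX j pN).2 (N *m x + (- t) *: x).
    rewrite !bilDl !bilDr !bilZl !bilZr.
    have e1 : bil (N ^+ j) (N *m x) (N *m x) = bil (N ^+ j.+2) x x.
      by have := bil_powers x j 1 1 sN; rewrite expr1 add1n addn1.
    have e2 : bil (N ^+ j) x (N *m x) = bil (N ^+ j.+1) x x.
      by rewrite -bilMr mulmxE -exprSr.
    rewrite (bil_sym (N *m x) x (trmxX j sN)) e1 e2.
    by congr (0 <= _); ring.
  by have := psd_tr_ge0 pB; rewrite /B !mxtraceD !mxtraceZ /D; lra.
elim: p => [|p IH]; first by rewrite expr0 mul1r mxtrace1 subrr mulr0 mul0r.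
rewrite -/(D p.+1); have {}IH : t * (\tr (N ^+ p) - t ^+ p * d%:R) <= p%:R * D p := IH.
apply: le_trans (_ : _ <= p.+1%:R * (t * D p)) _; last exact: ler_wpM2l.
rewrite mulrCA; apply: ler_wpM2l => //.
by move: IH; rewrite /D [t ^+ p.+1]exprS -natr1; lra.
Qed.

(* For [N = A^-1], a bound on [\tr (N ^+ p)] controls the largest eigenvalue of
   [N], hence the smallest one of [A]. *)
Lemma tr_power_lower A N (s : R) p u : psd N -> A *m N = 1%:M -> 0 < s ->
  (0 < p)%N -> \tr (N ^+ p) <= s^-1 ^+ p -> s * sqnorm u <= bil A u u.
Proof.
move=> pN AN s0 p0 trN; have [sN N0] := pN.
have NA : N *m A = 1%:M by exact: mulmx1C.
have q0 := sqnorm_ge0 u.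
have e1 : bil N (A *m u) (A *m u) = bil A u u.
  rewrite -bilMr NA bil1 trmx_mul /bil.
  have -> : (u^T *m A^T *m u) 0 0 = (u^T *m A^T *m u)^T 0 0 by rewrite [RHS]mxE.
  by rewrite !trmx_mul !trmxK mulmxA.
have e2 : bil N u (A *m u) = sqnorm u by rewrite -bilMr NA bil1.
have m1 : bil N u u <= sqnorm u / s.
  rewrite -(@ler_pXn2r _ p)// ?nnegrE ?divr_ge0 ?(ltW s0)//.
  have := moment_pow_le u pN p0; rewrite {1}/moment expr1 => h.
  apply: le_trans h _; rewrite exprMn exprVn -[p in _ ^+ p / _]prednK// exprSr -mulrA.
  apply: ler_wpM2l; first exact: exprn_ge0.
  apply: le_trans (psd_le_tr u (psdX p pN)) _.
  by apply: ler_wpM2l => //; rewrite -exprVn.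
have A0 : 0 <= bil A u u by rewrite -e1.
have := psd_CS u (A *m u) pN; rewrite e1 e2 => cs.
have := q0; rewrite le_eqVlt => /predU1P[<-|qp]; first by rewrite mulr0.
have h : sqnorm u * sqnorm u <= sqnorm u * (bil A u u / s).
  by rewrite -expr2 (le_trans cs)// mulrCA mulrC; apply: ler_wpM2l.
by move: h; rewrite ler_pM2l// ler_pdivlMr// mulrC.
Qed.

(** The inverse of L + \sum_(i < k) v_i v_i^T. Built by updates, it changes by exactly one
    [rank1_update] per sample point, and its measurability follows by induction. *)
Fixpoint resolvent (L : R) (v : nat -> 'cV[R]_d) (k : nat) : 'M[R]_d :=
  if k is k'.+1 then rank1_update (resolvent L v k') (v k') else L^-1%:M.

Lemma psd_resolvent (L : R) (v : nat -> 'cV[R]_d) k : 0 < L -> psd (resolvent L v k).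
Proof.
move=> L0; elim: k => [|k IH]; last exact: psd_rank1_update.
split; first by rewrite tr_scalar_mx.
move=> x; rewrite /= -scalemx1 bilZm bil1 mulr_ge0 ?invr_ge0 ?(ltW L0)//.
exact: sqnorm_ge0.
Qed.

Lemma resolvent_le (L : R) (v : nat -> 'cV[R]_d) k x : 0 < L -> bil (resolvent L v k) x x <= sqnorm x / L.
Proof.
move=> L0; elim: k => [|k IH].
  by rewrite /= -scalemx1 bilZm bil1 mulrC.
by apply: le_trans IH; apply: rank1_update_le; exact: psd_resolvent.
Qed.

Lemma resolvent_inv (L : R) (v : nat -> 'cV[R]_d) k : 0 < L ->
  (L%:M + \sum_(i < k) v i *m (v i)^T) *m resolvent L v k = 1%:M.
Proof.
move=> L0; elim: k => [|k IH].
  by rewrite big_ord0 addr0 -scalar_mxM mulfV// gt_eqF.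
rewrite big_ord_recr/= addrA; apply: rank1_update_inv => //; exact: psd_resolvent.
Qed.

(** Used as 1 - p x <= (1 + x)^-p; in the product form the sign of the left factor does not
    matter. *)
Lemma bernoulli (x : R) p : 0 <= x -> (1 + x) ^+ p * (1 - p%:R * x) <= 1.
Proof.
move=> x0; elim: p => [|p IH]; first by rewrite expr0 mul0r subr0 mul1r.
apply: le_trans IH; rewrite exprSr -mulrA; apply: ler_wpM2l.
  by rewrite exprn_ge0// addr_ge0.
have := sqr_ge0 x; have := ler0n R p; rewrite -natr1; nra.
Qed.
End trace_powers.

(** * Bounded measurable matrices *)

Lemma measurable_inv (R : realType) : measurable_fun [set: R] (@GRing.inv R).
Proof.
(* The real power -1 inverts nonnegative numbers only, hence the square; the factor x yields the
   convention 0^-1 = 0. *)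
rewrite (_ : @GRing.inv R = fun x => x * (x ^+ 2) `^ (-1)).
  apply: measurable_funM => //; apply: (measurableT_comp (measurable_powR (-1))).
  exact: measurable_funX.
apply/funext => x; rewrite powR_inv1 ?sqr_ge0//.
by have [->|x0] := eqVneq x 0; [rewrite invr0 mul0r|rewrite expr2 invfM mulrA mulfV// mul1r].
Qed.

Definition bounded_measurable_mx (R : realType) (d : measure_display)
    (S : measurableType d) (m n : nat) (F : S -> 'M[R]_(m, n)) : Prop :=
  forall i j, bounded_measurable (fun s => F s i j).

Section bounded_measurable_mx.
Context (R : realType) (d : measure_display) (S : measurableType d).

Lemma bmV (f : S -> R) : bounded_measurable f -> (forall x, 1 <= f x) ->
  bounded_measurable (fun x => (f x)^-1).
Proof.
move=> [mf _] f1; split; first by apply: measurableT_comp mf; exact: measurable_inv.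
exists 1 => x; have fx := lt_le_trans ltr01 (f1 x).
by rewrite ger0_norm ?invr_ge0 ?(ltW fx)// invf_le1.
Qed.

Lemma bmx_cst m n (A : 'M[R]_(m, n)) : bounded_measurable_mx (fun _ : S => A).
Proof. by move=> i j; exact: bm_cst. Qed.

Lemma bmxD m n (F G : S -> 'M[R]_(m, n)) : bounded_measurable_mx F ->
  bounded_measurable_mx G -> bounded_measurable_mx (fun s => F s + G s).
Proof. by move=> bF bG i j; apply: bm_ext (bmD (bF i j) (bG i j)) => s; rewrite mxE. Qed.

Lemma bmxN m n (F : S -> 'M[R]_(m, n)) : bounded_measurable_mx F ->
  bounded_measurable_mx (fun s => - F s).
Proof. by move=> bF i j; apply: bm_ext (bmN (bF i j)) => s; rewrite mxE. Qed.

Lemma bmxB m n (F G : S -> 'M[R]_(m, n)) : bounded_measurable_mx F ->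
  bounded_measurable_mx G -> bounded_measurable_mx (fun s => F s - G s).
Proof. by move=> bF bG; apply: bmxD => //; exact: bmxN. Qed.

Lemma bmxZ m n (f : S -> R) (F : S -> 'M[R]_(m, n)) : bounded_measurable f ->
  bounded_measurable_mx F -> bounded_measurable_mx (fun s => f s *: F s).
Proof. by move=> bf bF i j; apply: bm_ext (bmM bf (bF i j)) => s; rewrite mxE. Qed.

Lemma bmxM m n k (F : S -> 'M[R]_(m, n)) (G : S -> 'M[R]_(n, k)) :
  bounded_measurable_mx F -> bounded_measurable_mx G ->
  bounded_measurable_mx (fun s => F s *m G s).
Proof.
move=> bF bG i j.
apply: bm_ext (bm_sum (index_enum _) predT (fun l => bmM (bF i l) (bG l j))) => s.
by rewrite mxE.
Qed.

Lemma bmx_tr m n (F : S -> 'M[R]_(m, n)) :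
  bounded_measurable_mx F -> bounded_measurable_mx (fun s => (F s)^T).
Proof. by move=> bF i j; apply: bm_ext (bF j i) => s; rewrite mxE. Qed.

Lemma bmx_sum (I : Type) (r : seq I) m n (F : I -> S -> 'M[R]_(m, n)) :
  (forall i, bounded_measurable_mx (F i)) ->
  bounded_measurable_mx (fun s => \sum_(i <- r) F i s).
Proof.
move=> bF i j; apply: bm_ext (bm_sum r predT (fun l => bF l i j)) => s.
by rewrite summxE.
Qed.

Lemma bmxX n (F : S -> 'M[R]_n) p :
  bounded_measurable_mx F -> bounded_measurable_mx (fun s => F s ^+ p).
Proof.
move=> bF; elim: p => [|p IH]; first exact: (bmx_cst 1).
by move=> i j; apply: bm_ext (bmxM bF IH i j) => s; rewrite exprS.
Qed.

Lemma bmx_trace n (F : S -> 'M[R]_n) :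
  bounded_measurable_mx F -> bounded_measurable (fun s => \tr (F s)).
Proof. by move=> bF; apply: bm_sum => i; exact: bF. Qed.

Lemma bmx_bil n (F : S -> 'M[R]_n) (x y : S -> 'cV[R]_n) :
  bounded_measurable_mx F -> bounded_measurable_mx x -> bounded_measurable_mx y ->
  bounded_measurable (fun s => bil (F s) (x s) (y s)).
Proof. by move=> bF bx yb; apply: bmxM yb _ _; apply: bmxM bF; exact: bmx_tr. Qed.

Lemma bmx_sqnorm n (x : S -> 'cV[R]_n) :
  bounded_measurable_mx x -> bounded_measurable (fun s => sqnorm (x s)).
Proof. by move=> bx; apply: (bmxM (bmx_tr bx) bx). Qed.

Lemma bmx_resolvent n (L : R) (v : nat -> S -> 'cV[R]_n) k : 0 < L ->
  (forall i, bounded_measurable_mx (v i)) ->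
  bounded_measurable_mx (fun s => resolvent L (v^~ s) k).
Proof.
move=> L0 bv; elim: k => [|k IH]; first exact: bmx_cst.
rewrite /= /rank1_update; apply: bmxB => //; apply: bmxZ.
  apply: bmV.
    by apply: bmD; [exact: bm_cst|apply: bmx_bil => //; exact: bmxX].
  by move=> s; rewrite lerDl moment_ge0//; exact: psd_resolvent.
by apply: bmxM; [|apply: bmx_tr]; exact: bmxM.
Qed.
End bounded_measurable_mx.

Lemma resolvent_ext (R : realFieldType) n (L : R) (v v' : nat -> 'cV[R]_n) k :
  (forall i, (i < k)%N -> v i = v' i) -> resolvent L v k = resolvent L v' k.
Proof.
elim: k => [//|k IH] vv'; rewrite /= vv'// IH// => i ik.
by apply: vv'; exact: ltnW.
Qed.

Lemma update_lt (T : Type) (y : nat -> T) k x i : (i < k)%N -> update y k x i = y i.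
Proof. by rewrite /update; case: eqP => // ->; rewrite ltnn. Qed.

Lemma update_eq (T : Type) (y : nat -> T) k x : update y k x k = x.
Proof. by rewrite /update eqxx. Qed.

(** * Lower bounds on the sample Gram matrix *)

Lemma sum_CS (R : realFieldType) (I : Type) (r : seq I) (a b : I -> R) :
  (\sum_(i <- r) a i * b i) ^+ 2 <=
  (\sum_(i <- r) a i ^+ 2) * (\sum_(i <- r) b i ^+ 2).
Proof.
(* Lagrange's identity: this double sum is twice the defect in Cauchy-Schwarz. *)
have : 0 <= \sum_(i <- r) \sum_(j <- r) (a i * b j - a j * b i) ^+ 2.
  by apply: sumr_ge0 => i _; apply: sumr_ge0 => j _; exact: sqr_ge0.
have -> : \sum_(i <- r) \sum_(j <- r) (a i * b j - a j * b i) ^+ 2 =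
    \sum_(i <- r) \sum_(j <- r) (a i ^+ 2 * b j ^+ 2 + b i ^+ 2 * a j ^+ 2
      - 2 * ((a i * b i) * (a j * b j))).
  by apply: eq_bigr => i _; apply: eq_bigr => j _; ring.
under eq_bigr do rewrite sumrB big_split/= -!mulr_sumr.
rewrite sumrB big_split/= -!mulr_suml -mulr_sumr -mulr_suml.
by rewrite [X in _ + X - _]mulrC -expr2; lra.
Qed.

Section sample_gram.
Context (R : realType) (dX dO : measure_display) (T : measurableType dX)
  (Omega : measurableType dO) (P : probability T R) (Pr : probability Omega R)
  (X : nat -> {RV Pr >-> T}).
Hypothesis hX : iid P X.
Context (d : nat) (v : T -> 'cV[R]_d).
Hypothesis bv : bounded_measurable_mx v.
Hypothesis v_isotropic : forall i j, \int[P]_x (v x i ord0 * v x j ord0) = (i == j)%:R.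

Lemma E_moment (N : 'M[R]_d) p : \int[P]_x moment N (v x) p = \tr (N ^+ p).
Proof.
rewrite /moment; under eq_Rintegral do rewrite bil_suml.
have b i j : bounded_measurable (fun x => v x i ord0 * (N ^+ p) i j * v x j ord0).
  by apply: bmM => //; apply: bmM => //; exact: bm_cst.
rewrite E_sum; last by move=> i; apply: bm_sum => j; exact: b.
apply: eq_bigr => i _; rewrite E_sum; last by move=> j; exact: b.
rewrite (bigD1 i)//= [X in _ + X]big1 ?addr0 => [|j ji].
  under eq_Rintegral do rewrite mulrAC mulrC.
  by rewrite EZ ?v_isotropic ?eqxx ?mulr1//; exact: bmM.
under eq_Rintegral do rewrite mulrAC mulrC.
by rewrite EZ ?v_isotropic 1?eq_sym ?(negbTE ji) ?mulr0//; exact: bmM.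
Qed.

Lemma E_sqnorm : \int[P]_x sqnorm (v x) = d%:R.
Proof. by have := E_moment 1 0; rewrite expr0 mxtrace1; under eq_Rintegral do rewrite moment0. Qed.

Section lower_tail.
Variables (B : R) (p n : nat).
Hypotheses (B1 : 1 <= B) (vB : forall x, sqnorm (v x) <= B) (p0 : (0 < p)%N).
(** This ridge keeps p v^T N v <= p B / L = 1/4, the range in which [tr_rank1_update] applies. *)
Let L : R := 4 * p%:R * B.
Let N (y : nat -> T) k := resolvent L (v \o y) k.
(** The mean of the regularized sum over k points is L + k times the identity; the factor 1/2 lost
    in [tr_rank1_update] leaves half of the growth. *)
Let s (k : nat) : R := L + k%:R / 2.

Let p1 : 1 <= p%:R :> R. Proof. by rewrite ler1n. Qed.
Let L4 : 4 * p%:R <= L. Proof. by rewrite /L ler_peMr// mulr_ge0. Qed.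
Let L0 : 0 < L. Proof. by have := p1; have := L4; lra. Qed.
Let s0 k : 0 < s k. Proof. by rewrite ltr_pwDl// divr_ge0. Qed.

Let bZ k : seq_bm (fun y => \tr (N y k ^+ p)).
Proof.
move=> d' S Y mY; apply: bmx_trace; apply: bmxX.
apply: (bmx_resolvent (v := fun i s => v (Y i s))) => // i a b.
exact: (bm_comp (mY i) (bv a b)).
Qed.

(** Given the first k points, isotropy turns the mean of the decrease into (p/2) tr(N^(p+1)), and
    [tr_power_tangent] at t = 1 / s k bounds that trace below by an affine function of tr(N^p),
    which closes the recursion. *)
Let step k : \int[Pr]_w \tr (N (X^~ w) k.+1 ^+ p) <=
  (1 - (p.+1)%:R / (2 * s k)) * \int[Pr]_w \tr (N (X^~ w) k ^+ p)
  + d%:R / (2 * s k) * (s k)^-1 ^+ p.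
Proof.
set c1 := 1 - _; set c2 := _ * _ ^+ p.
have bN := seq_bm_sample X (bZ k).
rewrite -EZ// -[c2](E_cst Pr) -ED//; [|exact: bmZ|exact: bm_cst].
apply: (E_le_resample hX (k := k) (Phi := fun y => \tr (N y k.+1 ^+ p))
  (Psi := fun y => c1 * \tr (N y k ^+ p) + c2)) => //.
  by move=> d' S Y mY; apply: bmD; [apply: bmZ; exact: bZ|exact: bm_cst].
move=> y.
have NE x : N (update y k x) k = N y k.
  by apply: resolvent_ext => i ik /=; rewrite update_lt.
have pN : psd (N y k) by exact: psd_resolvent.
have NS x : N (update y k x) k.+1 = rank1_update (N y k) (v x).
  by rewrite -(NE x) /N /= update_eq.
have bNS : bounded_measurable (fun x => \tr (N (update y k x) k.+1 ^+ p)).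
  by apply: (bZ k.+1 (Y := fun i x => update y k x i)) => i; rewrite /update; case: eqP.
have bm : bounded_measurable (fun x => moment (N y k) (v x) p.+1).
  by apply: bmx_bil => //; exact: bmx_cst.
under [leRHS]eq_Rintegral do rewrite NE.
rewrite E_cst.
apply: le_trans (_ : _ <= \int[P]_x (\tr (N y k ^+ p) - p%:R / 2 * moment (N y k) (v x) p.+1)) _.
  apply: E_le => // [|x]; first by apply: bmB; [exact: bm_cst|exact: bmZ].
  rewrite NS; apply: tr_rank1_update => //.
  apply: le_trans (_ : _ <= p%:R * (B / L)) _.
    apply: ler_wpM2l => //; rewrite /moment expr1.
    apply: le_trans (resolvent_le _ _ _ L0) _.
    by apply: ler_wpM2r => //; rewrite invr_ge0 ltW.
  have B0 : B != 0 by rewrite gt_eqF// (lt_le_trans _ B1).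
  have pn0 : p%:R != 0 :> R by rewrite gt_eqF// (lt_le_trans _ p1).
  by rewrite /L (_ : p%:R * (B / (4 * p%:R * B)) = 4^-1)//; field; rewrite pn0 B0.
rewrite EB ?E_cst; [|exact: bm_cst|exact: bmZ].
rewrite EZ// E_moment.
have si0 : 0 <= (s k)^-1 by rewrite invr_ge0 ltW.
have := tr_power_tangent p pN si0.
rewrite /c1 /c2 !invfM -[p.+1%:R]natr1 -/N.
set a := (s k)^-1; set t := \tr (N y k ^+ p); set u := \tr _.
by set e := a ^+ p; lra.
Qed.

Let E_trace k : \int[Pr]_w \tr (N (X^~ w) k ^+ p) <= d%:R * (s k)^-1 ^+ p.
Proof.
elim: k => [|k IH].
  rewrite (_ : (fun _ => _) = fun _ => d%:R * (s 0)^-1 ^+ p) ?E_cst//.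
  apply/funext => w; rewrite /N /= /s mul0r addr0.
  have -> : (L^-1%:M : 'M[R]_d) ^+ p = (L^-1 ^+ p)%:M.
    elim: (p) => [|q IH]; first by rewrite !expr0.
    by rewrite !exprS IH -mulmxE -scalar_mxM.
  by rewrite mxtrace_scalar mulr_natl.
apply: le_trans (step k) _.
have sk := s0 k; have si0 : 0 < (s k)^-1 by rewrite invr_gt0.
have p1' := p1.
have c0 : 0 <= 1 - p.+1%:R / (2 * s k).
  rewrite subr_ge0 ler_pdivrMr ?mulr_gt0// mul1r -[p.+1%:R]natr1.
  by have := L4; have : 0 <= k%:R / 2 :> R by []; rewrite /s; lra.
apply: le_trans (lerD (ler_wpM2l c0 IH) (lexx _)) _.
have -> : (1 - p.+1%:R / (2 * s k)) * (d%:R * (s k)^-1 ^+ p) +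
   d%:R / (2 * s k) * (s k)^-1 ^+ p =
   d%:R * (s k)^-1 ^+ p * (1 - p%:R * ((s k)^-1 / 2)).
  by rewrite !invfM -[p.+1%:R]natr1; ring.
(* The increment of s matches the contraction factor of [step] through [bernoulli] with x = 1 / (2 s
   k). *)
have -> : s k.+1 = s k * (1 + (s k)^-1 / 2).
  by rewrite mulrDr mulr1 mulrA mulfV ?gt_eqF// /s -[k.+1%:R]natr1 mulrDl addrA.
rewrite invfM exprMn [leRHS]mulrA; apply: ler_wpM2l.
  by apply: mulr_ge0 => //; apply: exprn_ge0; exact: ltW.
have x0 : 0 <= (s k)^-1 / 2 by rewrite divr_ge0// ltW.
have q0 : 0 < (1 + (s k)^-1 / 2) ^+ p by apply: exprn_gt0; rewrite ltr_pwDl.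
by have := bernoulli p x0; rewrite mulrC exprVn -ler_pdivlMr// div1r.
Qed.

Lemma gram_lower_tail : (0 < n)%N -> 16 * p%:R * B <= n%:R ->
  exists E : set Omega, [/\ measurable E, (Pr E <= (d%:R / 2 ^+ p)%:E)%E &
    forall w, ~ E w -> forall u, 8^-1 * sqnorm u <=
      bil (n%:R^-1 *: \sum_(i < n) v (X i w) *m (v (X i w))^T) u u].
Proof.
(* A smallest eigenvalue t of L + n S is exactly S >= 1/8. Since n >= 4 L, also 2 t <= s n, so
   Markov's inequality gives d (t / s n)^p <= d / 2^p. *)
move=> n0 nB; set t := L + n%:R / 8.
have nR : 0 < n%:R :> R by rewrite ltr0n.
have t0 : 0 < t by rewrite ltr_pwDl// divr_ge0.
have bN := seq_bm_sample X (bZ n).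
have tp0 : 0 < t^-1 ^+ p by rewrite exprn_gt0 ?invr_gt0.
exists [set w | t^-1 ^+ p <= \tr (N (X^~ w) n ^+ p)]; split.
- rewrite -[X in measurable X]setTI; have := bN.1 measurableT _ (measurable_itv `[t^-1 ^+ p, +oo[).
  by congr measurable; apply/seteqP; split => x [_ /=]; rewrite in_itv/= andbT.
- apply: le_trans (E_markov bN _ tp0 (E_trace n)) _.
    by move=> w; apply: psd_tr_ge0; apply: psdX; exact: psd_resolvent.
  rewrite lee_fin -mulrA -exprVn; apply: ler_wpM2l => //.
  rewrite -exprVn invrK -exprMn; apply: lerXn2r; rewrite ?nnegrE.
  + by rewrite mulr_ge0 ?(ltW t0)// invr_ge0 ltW.
  + by [].
  + rewrite mulrC ler_pdivrMr// /t /s.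
    by move: nB; rewrite (_ : 16 * p%:R * B = 4 * L) /L; [lra|ring].
- move=> w /= /negP; rewrite -ltNge => /ltW h u.
  have := tr_power_lower u (psd_resolvent (v \o (X^~ w)) n L0)
    (resolvent_inv (v \o (X^~ w)) n L0) t0 p0 h.
  rewrite bilDm bilZm -scalemx1 bilZm bil1 -/(sqnorm u) /t mulrDl lerD2l /=.
  by move=> {}h; rewrite [leRHS]mulrC ler_pdivlMr//; apply: le_trans h; lra.
Qed.
End lower_tail.

Section variance.
Variables (g : T -> R) (bg : bounded_measurable g).
Let m : R := \int[P]_x g x.

(** Integrating out the last point kills the cross term, and its variance is at most its second
    moment. *)
Lemma E_sqr_sum n :
  \int[Pr]_w (\sum_(i < n) (g (X i w) - m)) ^+ 2 <= n%:R * \int[P]_x g x ^+ 2.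
Proof.
have bsum k : seq_bm (fun y : nat -> T => (\sum_(i < k) (g (y i) - m)) ^+ 2).
  move=> d' S Y mY; apply: bmX; apply: bm_sum => i; apply: bmB; last exact: bm_cst.
  exact: (bm_comp (mY i) bg).
elim: n => [|n IH].
  by under eq_Rintegral do rewrite big_ord0 expr0n/=; rewrite E_cst mul0r.
rewrite -natr1 mulrDl mul1r; apply: le_trans (lerD IH (lexx _)).
rewrite -[X in _ + X](E_cst Pr) -ED; [|exact: (seq_bm_sample X (bsum n))|exact: bm_cst].
apply: (E_le_resample hX (k := n)
  (Phi := fun y => (\sum_(i < n.+1) (g (y i) - m)) ^+ 2)
  (Psi := fun y => (\sum_(i < n) (g (y i) - m)) ^+ 2 + \int[P]_x g x ^+ 2)) => //.
  by move=> d' S Y mY; apply: bmD; [exact: bsum|exact: bm_cst].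
move=> y; set a := \sum_(i < n) (g (y i) - m).
have E1 x : \sum_(i < n) (g (update y n x i) - m) = a.
  by apply: eq_bigr => i _; rewrite update_lt.
under eq_Rintegral do rewrite big_ord_recr/= E1 update_eq.
under [leRHS]eq_Rintegral do rewrite E1.
rewrite E_cst (_ : (fun x => _) = fun x => (g x ^+ 2 + 2 * (a - m) * g x) + (a - m) ^+ 2).
  rewrite ED ?E_cst; [|by apply: bmD; [exact: bmX|exact: bmZ]|exact: bm_cst].
  rewrite ED ?EZ//; [|exact: bmX|exact: bmZ].
  by rewrite -/m; have := sqr_ge0 m; set e := \int[P]_x _; lra.
by apply/funext => x; ring.
Qed.
End variance.

(** The second moments of all entries v_i v_j add up to P(|v|^4), so the Frobenius bound involves
    the dimension only through this moment. *)
Lemma gram_second_moment n : (0 < n)%N ->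
  exists E : set Omega, [/\ measurable E,
    (Pr E <= (4 * (\int[P]_x sqnorm (v x) ^+ 2) / n%:R)%:E)%E &
    forall w, ~ E w -> forall u, 8^-1 * sqnorm u <=
      bil (n%:R^-1 *: \sum_(i < n) v (X i w) *m (v (X i w))^T) u u].
Proof.
move=> n0; have nR : 0 < n%:R :> R by rewrite ltr0n.
pose g (ij : 'I_d * 'I_d) x := v x ij.1 ord0 * v x ij.2 ord0.
have bg ij : bounded_measurable (g ij) by exact: bmM.
pose D ij w := \sum_(i < n) (g ij (X i w) - \int[P]_x g ij x).
pose Z w := \sum_ij D ij w ^+ 2.
have bD ij : bounded_measurable (fun w => D ij w ^+ 2).
  apply: bmX; apply: bm_sum => i; apply: bmB; last exact: bm_cst.
  by apply: (bm_comp _ (bg ij)); exact: measurable_funP.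
have bZ : bounded_measurable Z by exact: bm_sum.
have EZle : \int[Pr]_w Z w <= n%:R * \int[P]_x sqnorm (v x) ^+ 2.
  rewrite E_sum//; apply: le_trans (ler_sum _ (fun ij _ => E_sqr_sum (bg ij) n)) _.
  rewrite -mulr_sumr -E_sum; last by move=> ij; exact: bmX.
  apply: ler_wpM2l => //; apply: E_le.
  - by apply: bm_sum => ij; exact: bmX.
  - by apply: bmX; exact: bmx_sqnorm.
  move=> x; rewrite sqnormE expr2 big_distrlr/= pair_big/=.
  by apply: ler_sum => ij _; rewrite /g exprMn.
(* Z is n^2 times the squared Frobenius norm of S - 1; below this level S >= 1/2, which is more than
   enough. *)
have c0 : 0 < n%:R ^+ 2 / 4 :> R by rewrite divr_gt0// exprn_gt0.
exists [set w | n%:R ^+ 2 / 4 <= Z w]; split.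
- rewrite -[X in measurable X]setTI; have := bZ.1 measurableT _ (measurable_itv `[n%:R ^+ 2 / 4, +oo[).
  by congr measurable; apply/seteqP; split => x [_ /=]; rewrite in_itv/= andbT.
- apply: le_trans (E_markov bZ _ c0 EZle) _.
    by move=> w; apply: sumr_ge0 => ij _; exact: sqr_ge0.
  rewrite lee_fin le_eqVlt; apply/orP; left; apply/eqP; field.
  by rewrite gt_eqF.
- move=> w /= /negP; rewrite -ltNge => Zw u; rewrite bilZm.
  set q := sqnorm u; have q0 : 0 <= q := sqnorm_ge0 u.
  have SE : bil (\sum_(i < n) v (X i w) *m (v (X i w))^T) u u =
      n%:R * q + \sum_ij u ij.1 ord0 * u ij.2 ord0 * D ij w.
    rewrite bil_suml pair_big/= /q sqnormE.
    have -> : n%:R * \sum_i u i ord0 ^+ 2 =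
        \sum_(ij : 'I_d * 'I_d) u ij.1 ord0 * u ij.2 ord0 * (n%:R * (ij.1 == ij.2)%:R).
      rewrite -(pair_big xpredT xpredT (fun i j => u i ord0 * u j ord0 * (n%:R * (i == j)%:R)))/=.
      rewrite mulr_sumr; apply: eq_bigr => i _.
      rewrite (bigD1 i)//= eqxx big1 ?addr0 => [|j ji]; first by rewrite mulr1; ring.
      by rewrite eq_sym (negbTE ji) !mulr0.
    rewrite -big_split/=; apply: eq_bigr => -[i j] _ /=.
    rewrite summxE /D /g /= sumrB sumr_const card_ord v_isotropic.
    under eq_bigr do rewrite mxE big_ord1 mxE.
    by rewrite -[_ *+ n]mulr_natl; ring.
  have CS := @sum_CS _ _ (index_enum ('I_d * 'I_d)%type)
    (fun ij => u ij.1 ord0 * u ij.2 ord0) (fun ij => D ij w).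
  have uE : \sum_(ij : 'I_d * 'I_d) (u ij.1 ord0 * u ij.2 ord0) ^+ 2 = q ^+ 2.
    rewrite /q sqnormE [RHS]expr2 big_distrlr/= pair_big/=.
    by apply: eq_bigr => ij _; rewrite exprMn.
  rewrite SE mulrDr mulKf ?gt_eqF//; move: CS; rewrite uE.
  set b := \sum_ij _; set z := \sum_ij _ => CS.
  have : b ^+ 2 <= (q * (n%:R / 2)) ^+ 2.
    apply: le_trans CS _; rewrite exprMn; apply: ler_wpM2l; first exact: sqr_ge0.
    by apply: le_trans (ltW Zw) _; rewrite exprMn exprVn; lra.
  have q2 : 0 <= q * (n%:R / 2) by rewrite mulr_ge0// divr_ge0.
  rewrite -(real_normK (num_real b)) ler_pXn2r ?nnegrE// ler_norml => /andP[lb _].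
  have : n%:R^-1 * (- (q * (n%:R / 2))) <= n%:R^-1 * b by rewrite ler_wpM2l ?invr_ge0.
  by rewrite (_ : n%:R^-1 * _ = - (q / 2)); [lra|field; rewrite gt_eqF].
Qed.
End sample_gram.

(** * Sign averages and symmetrization *)

(** For |x| <= 1/2, cosh x <= 1/(1 - x^2) <= 1 + 2 x^2. Larger x are reached by doubling: with c =
    exp(2 y^2), cosh(2y) = 2 cosh(y)^2 - 1 <= 2 c^2 - 1 <= c^4. *)
Lemma cosh_le_gauss (R : realType) (x : R) :
  (expR x + expR (- x)) / 2 <= expR (2 * x ^+ 2).
Proof.
have key k : `|x| <= 2 ^+ k / 2 -> (expR x + expR (- x)) / 2 <= expR (2 * x ^+ 2).
  elim: k x => [|k IH] {}x xk.
    have /andP[x1 x2] : - (1 / 2) <= x <= 1 / 2 by rewrite -ler_norml; move: xk; rewrite expr0.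
    have inv_exp (y : R) : y < 1 -> expR y <= (1 - y)^-1.
      move=> y1; rewrite -[y in leLHS]opprK expRN lef_pV2 ?posrE ?expR_gt0 ?subr_gt0//.
      exact: expR_ge1Dx.
    have h1 : expR x <= (1 - x)^-1 by apply: inv_exp; lra.
    have h2 : expR (- x) <= (1 + x)^-1 by rewrite -[x in leRHS]opprK; apply: inv_exp; lra.
    have h3 : 1 + 2 * x ^+ 2 <= expR (2 * x ^+ 2) by exact: expR_ge1Dx.
    apply: le_trans h3.
    have x4 : x ^+ 2 <= 1 / 4 by nra.
    have e : ((1 - x)^-1 + (1 + x)^-1) / 2 = (1 - x ^+ 2)^-1.
      by field; do ?[apply/andP; split]; apply/eqP; nra.
    apply: le_trans (_ : _ <= (1 - x ^+ 2)^-1) _; first by rewrite -e; lra.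
    have d0 : 0 < 1 - x ^+ 2 by lra.
    rewrite -div1r ler_pdivrMr//; have := sqr_ge0 x; nra.
  have -> : x = 2 * (x / 2) by rewrite mulrC divfK.
  have {}xk : `|x / 2| <= 2 ^+ k / 2.
    have n2 : `| x / 2 | = `| x | / 2 by rewrite normrM (ger0_norm (_ : 0 <= 2^-1)).
    by rewrite n2; move: xk; rewrite exprS; lra.
  have := IH _ xk; set y := x / 2.
  have e1 : expR (2 * y) = expR y ^+ 2 by rewrite expRM_natl.
  have e2 : expR (- (2 * y)) = expR (- y) ^+ 2 by rewrite -mulrN expRM_natl.
  have e3 : expR (2 * (2 * y) ^+ 2) = expR (2 * y ^+ 2) ^+ 4.
    by rewrite -expRM_natl; congr expR; ring.
  have e4 : expR y * expR (- y) = 1 by rewrite -expRD subrr expR0.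
  rewrite e1 e2 e3; have := expR_gt0 y; have := expR_gt0 (- y).
  set a := expR y in e4 *; set b := expR (- y) in e4 *; set c := expR _ => b0 a0 h.
  have : ((a + b) / 2) ^+ 2 <= c ^+ 2 by have hc := h; apply: lerXn2r h; rewrite nnegrE; move: hc a0 b0; clear; lra.
  have := sqr_ge0 (c ^+ 2 - 1).
  rewrite (_ : ((a + b) / 2) ^+ 2 = (a ^+ 2 + b ^+ 2 + 2 * (a * b)) / 4); last by field.
  rewrite e4 (_ : (c ^+ 2 - 1) ^+ 2 = c ^+ 4 - 2 * c ^+ 2 + 1); last by ring.
  lra.
have [k xk] : exists k : nat, `|x| < k%:R by exists (Num.bound `| x |); exact: archi_boundP (normr_ge0 x).
apply: (key k.+1); rewrite exprS mulrAC mulfV// mul1r.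
by apply: le_trans (ltW xk) _; rewrite -natrX ler_nat ltnW// ltn_expl.
Qed.

Section sign_average.
Context (R : realType).

(* The average of [Phi (z + \sum_(i < n) e_i *: a i)] over all signs [e]. *)
Fixpoint sign_average (V : zmodType) (n : nat) (a : nat -> V) (Phi : V -> R) (z : V) : R :=
  if n is k.+1 then
    (sign_average k a Phi (z + a k) + sign_average k a Phi (z - a k)) / 2
  else Phi z.

Lemma sign_average_ext (V : zmodType) n (a b : nat -> V) (Phi : V -> R) z :
  (forall i, (i < n)%N -> a i = b i) ->
  sign_average n a Phi z = sign_average n b Phi z.
Proof.
elim: n z => [//|n IH] z ab; rewrite /= ab// !IH// => i ni.
all: by apply: ab; exact: ltnW.
Qed.

Lemma sign_average_le (V : lmodType R) n (a : nat -> V) (Phi Psi : V -> R) z :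
  (forall e : nat -> R, (forall i, e i ^+ 2 = 1) ->
    Phi (z + \sum_(i < n) e i *: a i) <= Psi (z + \sum_(i < n) e i *: a i)) ->
  sign_average n a Phi z <= sign_average n a Psi z.
Proof.
elim: n z => [|n IH] z /= le.
  by have := le (fun _ => 1) (fun _ => expr1n _ _); rewrite big_ord0 addr0.
have sgn (s : R) : s ^+ 2 = 1 -> sign_average n a Phi (z + s *: a n) <=
    sign_average n a Psi (z + s *: a n).
  move=> s1; apply: IH => e e1.
  have := le (fun i => if i == n then s else e i).
  rewrite big_ord_recr/= eqxx.
  under eq_bigr => i _ do rewrite (ltn_eqF (ltn_ord i)).
  by rewrite addrAC addrA; apply => i; case: eqP.
have := sgn 1 (expr1n _ _); have := sgn (-1); rewrite sqrrN expr1n scale1r scaleN1r.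
by move=> /(_ erefl); lra.
Qed.

Lemma sign_average_affine (V : zmodType) n (a : nat -> V) (Phi : V -> R) (c k : R) z :
  sign_average n a (fun x => c + k * Phi x) z = c + k * sign_average n a Phi z.
Proof. by elim: n z => [//|n IH] z /=; rewrite !IH; field. Qed.

Lemma sign_average_sum (V : zmodType) (I : Type) (r : seq I) (Q : pred I) n
    (a : nat -> V) (Phi : I -> V -> R) z :
  sign_average n a (fun x => \sum_(l <- r | Q l) Phi l x) z =
  \sum_(l <- r | Q l) sign_average n a (Phi l) z.
Proof.
elim: n z => [//|n IH] z /=; rewrite !IH -big_split/= mulr_suml.
by apply: eq_bigr.
Qed.

Lemma sign_average_additive (V W : zmodType) (f : {additive V -> W}) n
    (a : nat -> V) (Phi : W -> R) z :
  sign_average n a (Phi \o f) z = sign_average n (f \o a) Phi (f z).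
Proof. by elim: n z => [//|n IH] z /=; rewrite !IH raddfD raddfB. Qed.

Lemma sqnormD d (x y : 'cV[R]_d) :
  sqnorm (x + y) = sqnorm x + sqnorm y + 2 * bil 1%:M x y.
Proof.
rewrite /sqnorm -!bil1 !(bilDl, bilDr) (bil_sym y x (psd1 R d).1); ring.
Qed.

Lemma sqnormZ d a (x : 'cV[R]_d) : sqnorm (a *: x) = a ^+ 2 * sqnorm x.
Proof. by rewrite /sqnorm -!bil1 bilZl bilZr; ring. Qed.

Lemma sqnormN d (x : 'cV[R]_d) : sqnorm (- x) = sqnorm x.
Proof. by rewrite -scaleN1r sqnormZ sqrrN expr1n mul1r. Qed.

Lemma sqnorm_CS d (x y : 'cV[R]_d) : bil 1%:M x y ^+ 2 <= sqnorm x * sqnorm y.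
Proof. by have := psd_CS x y (psd1 R d); rewrite !bil1. Qed.

(** One sign multiplies th + |z|^2 by 1 + u + w or 1 + u - w, where w^2 <= 4 u by Cauchy-Schwarz.
    Bounding 1 + x by exp x and averaging gives exp(p u) cosh(p w) <= exp(p u + 8 p^2 u) <= exp(9
    p^2 u). The shift th bounds u by |a_n|^2 / th, whatever z is, so the factors multiply. *)
Lemma sign_average_subgauss d n (a : nat -> 'cV[R]_d) (th : R) p z :
  0 < th -> (0 < p)%N ->
  sign_average n a (fun x => (th + sqnorm x) ^+ p) z <=
  (th + sqnorm z) ^+ p * expR (9 * p%:R ^+ 2 * (\sum_(i < n) sqnorm (a i)) / th).
Proof.
move=> th0 p0; have p1 : 1 <= p%:R :> R by rewrite ler1n.
elim: n z => [|n IH] z.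
  by rewrite big_ord0 mulr0 mul0r expR0 mulr1.
rewrite /= big_ord_recr/= mulrDr mulrDl expRD.
set E := expR (_ * (\sum_(i < n) _) / _) in IH *; set F := expR _.
have E0 : 0 < E by exact: expR_gt0.
suff one : ((th + sqnorm (z + a n)) ^+ p + (th + sqnorm (z - a n)) ^+ p) / 2 <=
    (th + sqnorm z) ^+ p * F.
  apply: le_trans (_ : _ <= ((th + sqnorm (z + a n)) ^+ p + (th + sqnorm (z - a n)) ^+ p) / 2 * E) _.
    by have := IH (z + a n); have := IH (z - a n); lra.
  by rewrite [E * F]mulrC mulrA ler_pM2r.
set rho := th + sqnorm z.
have rho0 : 0 < rho by rewrite ltr_pwDl// sqnorm_ge0.
set u := sqnorm (a n) / rho; set w := 2 * bil 1%:M z (a n) / rho.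
have u0 : 0 <= u by rewrite divr_ge0 ?sqnorm_ge0// ltW.
have e1 : th + sqnorm (z + a n) = rho * (1 + (u + w)).
  by rewrite sqnormD /u /w /rho; field; rewrite gt_eqF.
have e2 : th + sqnorm (z - a n) = rho * (1 + (u - w)).
  by rewrite sqnormD sqnormN -scaleN1r bilZr /u /w /rho; field; rewrite gt_eqF.
have w2 : w ^+ 2 <= 4 * u.
  rewrite /w /u exprMn exprVn mulrA ler_pdivrMr ?exprn_gt0// exprMn.
  have -> : 4 * sqnorm (a n) / rho * rho ^+ 2 = 4 * (sqnorm (a n) * rho).
    by field; rewrite gt_eqF.
  have := sqnorm_CS z (a n); have : sqnorm z <= rho by rewrite /rho lerDr ltW.
  have := sqnorm_ge0 (a n); have := sqnorm_ge0 z.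
  set A := sqnorm (a n); set Z := sqnorm z; nra.
have bnd s : 0 <= rho * (1 + s) -> (rho * (1 + s)) ^+ p <= rho ^+ p * expR (p%:R * s).
  move=> h; rewrite exprMn; apply: ler_wpM2l; first by rewrite exprn_ge0// ltW.
  rewrite expRM_natl; apply: lerXn2r; rewrite ?nnegrE ?(ltW (expR_gt0 _))//.
    by move: h; rewrite pmulr_rge0.
  exact: expR_ge1Dx.
have h1 : (rho * (1 + (u + w))) ^+ p <= rho ^+ p * expR (p%:R * (u + w)).
  by apply: bnd; rewrite -e1 addr_ge0 ?sqnorm_ge0// ltW.
have h2 : (rho * (1 + (u - w))) ^+ p <= rho ^+ p * expR (p%:R * (u - w)).
  by apply: bnd; rewrite -e2 addr_ge0 ?sqnorm_ge0// ltW.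
rewrite e1 e2; apply: le_trans (_ : _ <= rho ^+ p * (expR (p%:R * u) * ((expR (p%:R * w) + expR (- (p%:R * w))) / 2))) _.
  move: h1 h2; rewrite (mulrDr p%:R u w) (mulrBr p%:R u w) !expRD.
  set A := (_ * (1 + (u + w))) ^+ p; set B := (_ * (1 + (u - w))) ^+ p; set r := rho ^+ p.
  set x := expR (p%:R * u); set y := expR _; set y' := expR _; lra.
apply: ler_wpM2l; first by rewrite exprn_ge0// ltW.
apply: le_trans (ler_wpM2l (ltW (expR_gt0 _)) (cosh_le_gauss _)) _.
rewrite -expRD ler_expR /F.
have ut : u <= sqnorm (a n) / th.
  by apply: ler_wpM2l; [exact: sqnorm_ge0|rewrite lef_pV2 ?posrE// lerDl sqnorm_ge0].
apply: le_trans (_ : _ <= 9 * p%:R ^+ 2 * u) _.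
  have h3 := ler_wpM2l (sqr_ge0 (p%:R : R)) w2.
  have h4 : p%:R * u <= p%:R ^+ 2 * u.
    by apply: ler_wpM2r => //; rewrite expr2; apply: ler_peMr.
  by rewrite exprMn; lra.
by rewrite -[leRHS]mulrA; apply: ler_wpM2l; rewrite ?mulr_ge0 ?sqr_ge0.
Qed.
End sign_average.

(** * Maximal inequality under random signs *)

Section max_inequality.
Context (R : realType).

(** Columns index the functions of a finite family; a maximum starting at 0 covers the empty family
    too. *)
Definition max_sqnorm (d m : nat) (Z : 'M[R]_(d, m)) : R :=
  \big[Num.max/0]_(j < m) sqnorm (col j Z).

Lemma max_sqnorm_ge0 d m (Z : 'M[R]_(d, m)) : 0 <= max_sqnorm Z.
Proof. exact: bigmax_ge_id. Qed.

Lemma sqnorm_le_max d m (Z : 'M[R]_(d, m)) j : sqnorm (col j Z) <= max_sqnorm Z.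
Proof. exact: (le_bigmax _ (fun j => sqnorm (col j Z))). Qed.

Lemma max_sqnorm_le d m (Z : 'M[R]_(d, m)) c : 0 <= c ->
  (forall j, sqnorm (col j Z) <= c) -> max_sqnorm Z <= c.
Proof. by move=> c0 h; apply: bigmax_le. Qed.

Lemma sqnormD_le d (x y : 'cV[R]_d) : sqnorm (x + y) <= 2 * sqnorm x + 2 * sqnorm y.
Proof.
have := sqnorm_ge0 (x - y); rewrite !sqnormD sqnormN -scaleN1r bilZr; lra.
Qed.

Lemma sqnorm_sum_le d n (x : 'I_n -> 'cV[R]_d) :
  sqnorm (\sum_i x i) <= n%:R * \sum_i sqnorm (x i).
Proof.
have -> : \sum_i sqnorm (x i) = \sum_k \sum_i x i k ord0 ^+ 2.
  by rewrite exchange_big; apply: eq_bigr => i _; exact: sqnormE.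
rewrite sqnormE mulr_sumr; apply: ler_sum => k _; rewrite summxE.
have := @sum_CS R _ (index_enum 'I_n) (fun=> 1) (fun i => x i k ord0).
have -> : \sum_(i < n) 1 * x i k ord0 = \sum_(i < n) x i k ord0.
  by apply: eq_bigr => i _; rewrite mul1r.
have -> : \sum_(i < n) 1 ^+ 2 = n%:R :> R.
  by under eq_bigr do rewrite expr1n; rewrite sumr_const card_ord.
by [].
Qed.

(* Every column [j] is compared with a representative column [r j]; only the
   at most [exp p] representatives enter the union bound. *)
Lemma sign_average_max d m n (a : nat -> 'M[R]_(d, m)) (r : 'I_m -> 'I_m)
    (p : nat) (th D : R) :
  (0 < p)%N -> 0 < th -> 0 <= D ->
  #|[set r j | j : 'I_m]|%:R <= expR p%:R :> R ->
  (forall j, p%:R * \sum_(i < n) sqnorm (col j (a i)) <= th) ->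
  (forall j, \sum_(i < n) sqnorm (col j (a i) - col (r j) (a i)) <= D) ->
  sign_average n a (@max_sqnorm d m) 0 <= 4 * expR 10 * th + 2 * n%:R * D.
Proof.
move=> p0 th0 D0 card_r ath aD.
set J := [set r j | j : 'I_m]%SET in card_r.
(* The representatives cost exp p and the moment growth exp(9 p); dividing by t^p = th^p exp(10 p)
   cancels both exactly. *)
set t := th * expR 10; have t0 : 0 < t by rewrite mulr_gt0 ?expR_gt0.
pose K := 2 * t + 2 * n%:R * D.
pose Psi (Z : 'M[R]_(d, m)) := \sum_(l in J) (th + sqnorm (col l Z)) ^+ p.
have nR : 0 <= n%:R :> R by [].
have Psi_ge0 Z l : 0 <= (th + sqnorm (col l Z)) ^+ p.
  by rewrite exprn_ge0// addr_ge0 ?sqnorm_ge0// ltW.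
have tp0 : 0 < t^-1 ^+ p by rewrite exprn_gt0// invr_gt0.
have c0 : 0 <= 2 * t * t^-1 ^+ p by rewrite !mulr_ge0// ltW.
have K0 : 0 <= K by rewrite addr_ge0// !mulr_ge0// ltW.
apply: le_trans (_ : _ <= sign_average n a (fun Z => K + 2 * t * t^-1 ^+ p * Psi Z) 0) _.
  apply: sign_average_le => e e1; rewrite add0r; set Z := \sum_(i < n) _.
  have PsiZ0 : 0 <= Psi Z by apply: sumr_ge0.
  apply: max_sqnorm_le.
    by apply: addr_ge0 => //; exact: mulr_ge0.
  move=> j; have colZ l : col l Z = \sum_(i < n) e i *: col l (a i).
    by rewrite /Z linear_sum; apply: eq_bigr => i _; rewrite linearZ.
  have h1 : sqnorm (col j Z - col (r j) Z) <= n%:R * D.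
    rewrite !colZ -sumrB; apply: le_trans (sqnorm_sum_le _) _.
    apply: ler_wpM2l => //; apply: le_trans (aD j).
    by apply: ler_sum => i _; rewrite -scalerBr sqnormZ e1 mul1r.
  have h2 : sqnorm (col (r j) Z) / t <= 1 + t^-1 ^+ p * Psi Z.
    set y := (th + sqnorm (col (r j) Z)) / t.
    have y0 : 0 <= y by rewrite divr_ge0 ?addr_ge0 ?sqnorm_ge0 ?ltW.
    apply: le_trans (_ : _ <= y) _.
      by apply: ler_wpM2r; [rewrite invr_ge0 ltW|rewrite lerDr ltW].
    (* This makes the sum of p-th powers bound the maximum linearly, so that no p-th root of an
       average has to be taken. *)
    apply: le_trans (_ : _ <= 1 + y ^+ p) _.
      have [y1|y1] := leP y 1; first by rewrite (le_trans y1)// lerDl exprn_ge0.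
      apply: le_trans (_ : _ <= y ^+ p) _; last by rewrite lerDr.
      by rewrite -[leLHS]expr1; apply: ler_weXn2l => //; exact: ltW.
    rewrite lerD2l /y exprMn mulrC; apply: ler_wpM2l; first exact: ltW.
    rewrite /Psi (bigD1 (r j))/=; last by apply/imsetP; exists j.
    by rewrite lerDl; apply: sumr_ge0.
  have h3 : sqnorm (col (r j) Z) <= t * (1 + t^-1 ^+ p * Psi Z).
    by rewrite -ler_pdivrMl// mulrC.
  have := sqnormD_le (col j Z - col (r j) Z) (col (r j) Z); rewrite subrK /K.
  set q := t^-1 ^+ p in h3 *; set s := Psi Z in h3 *; lra.
rewrite sign_average_affine /Psi sign_average_sum.
have bnd l : l \in J -> sign_average n a (fun Z => (th + sqnorm (col l Z)) ^+ p) 0 <=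
    th ^+ p * expR (9 * p%:R).
  move=> _; have -> : sign_average n a (fun Z => (th + sqnorm (col l Z)) ^+ p) 0 =
      sign_average n (fun i => col l (a i)) (fun x => (th + sqnorm x) ^+ p) 0.
    have := @sign_average_additive R 'M[R]_(d, m) 'cV[R]_d (col l) n a
      (fun x => (th + sqnorm x) ^+ p) 0.
    by rewrite raddf0.
  apply: le_trans (sign_average_subgauss _ _ _ th0 p0) _.
  have s0 : sqnorm (0 : 'cV[R]_d) = 0 by rewrite /sqnorm mulmx0 mxE.
  rewrite s0 addr0; apply: ler_wpM2l; first by rewrite exprn_ge0// ltW.
  rewrite ler_expR ler_pdivrMr//.
  have := ler_wpM2l (_ : 0 <= 9 * p%:R) (ath l) => /(_ (mulr_ge0 _ _)); rewrite !ler0n => /(_ isT isT).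
  by rewrite (_ : 9 * p%:R ^+ 2 * _ = 9 * p%:R * (p%:R * \sum_(i < n) sqnorm (col l (a i)))); [|ring].
have sum_le : \sum_(l in J) sign_average n a (fun Z => (th + sqnorm (col l Z)) ^+ p) 0 <=
    expR p%:R * (th ^+ p * expR (9 * p%:R)).
  apply: le_trans (ler_sum _ bnd) _; rewrite sumr_const -[leLHS]mulr_natl.
  by apply: ler_wpM2r => //; rewrite mulr_ge0 ?exprn_ge0 ?(ltW (expR_gt0 _))// ltW.
have e : t^-1 ^+ p * (expR p%:R * (th ^+ p * expR (9 * p%:R))) = 1.
  have -> : t^-1 ^+ p = th^-1 ^+ p * expR (- (10 * p%:R)).
    by rewrite /t invfM exprMn -expRN -expRM_natl; congr (_ * expR _); ring.
  have thp : th^-1 ^+ p * th ^+ p = 1 by rewrite -exprMn mulVf ?expr1n// gt_eqF.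
  have ex : expR (- (10 * p%:R)) * (expR p%:R * expR (9 * p%:R)) = 1 :> R.
    by rewrite -!expRD -[RHS](@expR0 R); congr expR; ring.
  transitivity ((th^-1 ^+ p * th ^+ p) *
    (expR (- (10 * p%:R)) * (expR p%:R * expR (9 * p%:R)))); first by ring.
  by rewrite thp ex mulr1.
have := ler_wpM2l (ltW tp0) sum_le; rewrite e => h.
have t2 : 0 <= 2 * t by rewrite mulr_ge0// ltW.
have := ler_wpM2l t2 h; rewrite mulr1 mulrA => h'.
by apply: le_trans (lerD (lexx _) h') _; rewrite /K /t; lra.
Qed.
End max_inequality.

Lemma bm_max_sqnorm (R : realType) (d0 : measure_display) (S : measurableType d0)
    d m (F : S -> 'M[R]_(d, m)) :
  bounded_measurable_mx F -> bounded_measurable (fun s => max_sqnorm (F s)).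
Proof.
move=> bF; apply: bm_bigmax => j; apply: bmx_sqnorm => i k.
by apply: bm_ext (bF i j) => s; rewrite mxE.
Qed.

Lemma bm_sign_average (R : realType) (d0 : measure_display) (S : measurableType d0)
    d m n (a : nat -> S -> 'M[R]_(d, m)) (z : S -> 'M[R]_(d, m)) :
  (forall i, bounded_measurable_mx (a i)) -> bounded_measurable_mx z ->
  bounded_measurable (fun s => sign_average n (a^~ s) (@max_sqnorm R d m) (z s)).
Proof.
move=> ba; elim: n z => [|n IH] z bz /=; first exact: bm_max_sqnorm.
apply: bmM; last exact: bm_cst.
by apply: bmD; apply: IH; [exact: bmxD|exact: bmxB].
Qed.

(** * Symmetrization, one sample point at a time *)

Section symmetrization.
Context (R : realType) (dX dO : measure_display) (T : measurableType dX)
  (Omega : measurableType dO) (P : probability T R) (Pr : probability Omega R)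
  (X : nat -> {RV Pr >-> T}).
Hypothesis hX : iid P X.
Context (d m : nat) (g : T -> 'M[R]_(d, m)).
Hypothesis bg : bounded_measurable_mx g.
Let G : 'M[R]_(d, m) := \matrix_(i, j) \int[P]_x g x i j.
Let Psi := @max_sqnorm R d m.

Let bPsi (F : T -> 'M[R]_(d, m)) : bounded_measurable_mx F ->
  bounded_measurable (fun x => Psi (F x)).
Proof. exact: bm_max_sqnorm. Qed.

(** For each entry the mean of (c - g)^2 is (c - mean)^2 plus a variance; the maximum over columns
    then only grows when taken inside the integral. *)
Let jensen (w : 'M[R]_(d, m)) : Psi (w - G) <= \int[P]_y Psi (w - g y).
Proof.
have bw : bounded_measurable_mx (fun y => w - g y).
  by apply: bmxB => //; exact: bmx_cst.
apply: max_sqnorm_le; first by apply: E_ge0 => x; exact: max_sqnorm_ge0.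
move=> j; have bj i : bounded_measurable (fun y => (w i j - g y i j) ^+ 2).
  by apply: bmX; apply: bmB => //; exact: bm_cst.
apply: le_trans (_ : _ <= \int[P]_y \sum_i (w i j - g y i j) ^+ 2) _; last first.
  apply: E_le; [exact: bm_sum|exact: bPsi|move=> y].
  apply: le_trans (sqnorm_le_max _ j); rewrite sqnormE.
  by apply: ler_sum => i _; rewrite !mxE.
rewrite E_sum// sqnormE; apply: ler_sum => i _; rewrite !mxE.
set c := w i j; set e := \int[P]_x g x i j.
rewrite (_ : (fun y => _) = fun y => (g y i j - e) ^+ 2 + ((c - e) ^+ 2 - 2 * (c - e) * (g y i j - e))).
  have bge : bounded_measurable (fun y => g y i j - e) by apply: bmB => //; exact: bm_cst.
  rewrite ED; [|exact: bmX|by apply: bmB; [exact: bm_cst|exact: bmZ]].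
  rewrite EB ?E_cst; [|exact: bm_cst|exact: bmZ].
  rewrite EZ// EB ?E_cst//; last exact: bm_cst.
  by rewrite -/e subrr mulr0 subr0 lerDr; apply: E_ge0 => y; exact: sqr_ge0.
by apply/funext => y; ring.
Qed.

(** After [jensen] introduces an independent copy y, z + g x - g y is the midpoint of z + 2 g x and
    z - 2 g y. Convexity separates x from y, which leaves a random sign in front of 2 g x. *)
Let one_step (z : 'M[R]_(d, m)) : \int[P]_x Psi (z + (g x - G)) <=
  (\int[P]_x Psi (z + 2 *: g x) + \int[P]_x Psi (z - 2 *: g x)) / 2.
Proof.
have b2 : bounded_measurable_mx (fun x => 2 *: g x) by apply: bmxZ => //; exact: bm_cst.
have bp : bounded_measurable (fun x => Psi (z + 2 *: g x)).
  by apply: bPsi; apply: bmxD => //; exact: bmx_cst.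
have bq : bounded_measurable (fun x => Psi (z - 2 *: g x)).
  by apply: bPsi; apply: bmxB => //; exact: bmx_cst.
rewrite mulrDl [X in _ + X]mulrC [X in X + _]mulrC -EZ// -[X in _ + X](E_cst P) -ED; last first.
- exact: bm_cst.
- exact: bmZ.
apply: E_le.
- by apply: bPsi; apply: bmxD; [exact: bmx_cst|apply: bmxB => //; exact: bmx_cst].
- by apply: bmD; [exact: bmZ|exact: bm_cst].
move=> x; rewrite addrA; apply: le_trans (jensen _) _.
rewrite -EZ// -[X in _ <= X + _](E_cst P) -ED; [|exact: bm_cst|exact: bmZ].
apply: E_le.
- by apply: bPsi; apply: bmxB => //; exact: bmx_cst.
- by apply: bmD; [exact: bm_cst|exact: bmZ].
move=> y; apply: max_sqnorm_le.
  by rewrite addr_ge0// mulr_ge0// max_sqnorm_ge0.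
move=> j; have := sqnorm_le_max (z + 2 *: g x) j; have := sqnorm_le_max (z - 2 *: g y) j.
have -> : col j (z + g x - g y) =
    2^-1 *: (col j (z + 2 *: g x) + col j (z - 2 *: g y)).
  by apply/matrixP => i k; rewrite !mxE; lra.
have := sqnormD_le (col j (z + 2 *: g x)) (col j (z - 2 *: g y)).
by rewrite sqnormZ /Psi; set q := sqnorm (_ + _); lra.
Qed.

Let one_step_average k (a : nat -> 'M[R]_(d, m)) z :
  \int[P]_x sign_average k a Psi (z + (g x - G)) <=
  (\int[P]_x sign_average k a Psi (z + 2 *: g x) +
   \int[P]_x sign_average k a Psi (z - 2 *: g x)) / 2.
Proof.
have b2 : bounded_measurable_mx (fun x => 2 *: g x) by apply: bmxZ => //; exact: bm_cst.
have bG : bounded_measurable_mx (fun x => g x - G) by apply: bmxB => //; exact: bmx_cst.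
elim: k z => [|k IH] z /=; first exact: one_step.
have bA F w : bounded_measurable_mx F ->
    bounded_measurable (fun x : T => sign_average k a Psi (F x + w)).
  move=> bF; apply: (@bm_sign_average R _ T d m k (fun i _ => a i) (fun x => F x + w)) => [i|].
    exact: bmx_cst.
  by apply: bmxD => //; exact: bmx_cst.
have E2 (f1 f2 : T -> R) : bounded_measurable f1 -> bounded_measurable f2 ->
    \int[P]_x ((f1 x + f2 x) / 2) = (\int[P]_x f1 x + \int[P]_x f2 x) / 2.
  move=> b1 b3; under eq_Rintegral do rewrite mulrC.
  by rewrite EZ; [rewrite ED// mulrC|exact: bmD].
have b z' : bounded_measurable_mx (fun x => z' + (g x - G)).
  by apply: bmxD => //; exact: bmx_cst.
have b' z' : bounded_measurable_mx (fun x => z' + 2 *: g x).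
  by apply: bmxD => //; exact: bmx_cst.
have b'' z' : bounded_measurable_mx (fun x => z' - 2 *: g x).
  by apply: bmxB => //; exact: bmx_cst.
rewrite !E2; try exact: bA.
have := IH (z + a k); have := IH (z - a k).
have sw F (s : 'M[R]_(d, m)) : (fun x : T => sign_average k a Psi (z + s + F x)) =
   (fun x => sign_average k a Psi (z + F x + s)).
  by apply/funext => x; rewrite addrAC.
by rewrite !sw; lra.
Qed.

Lemma symmetrization n :
  \int[Pr]_w Psi (\sum_(i < n) (g (X i w) - G)) <=
  \int[Pr]_w sign_average n (fun i => 2 *: g (X i w)) Psi 0.
Proof.
(* Hybrids: the points before k carry signs, the others are still centred. Passing from k to k+1
   alters coordinate k only. *)
pose Phi k (y : nat -> T) := sign_average k (fun i => 2 *: g (y i)) Psi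
  (\sum_(k <= i < n) (g (y i) - G)).
have bPhi k : seq_bm (Phi k).
  move=> d' S Y mY.
  have bgY i : bounded_measurable_mx (fun s => g (Y i s)).
    by move=> a b; exact: (bm_comp (mY i) (bg a b)).
  apply: (@bm_sign_average R _ S d m k (fun i s => 2 *: g (Y i s))) => [i|].
    by apply: bmxZ => //; exact: bm_cst.
  by apply: bmx_sum => i; apply: bmxB => //; exact: bmx_cst.
have H k : (k <= n)%N -> \int[Pr]_w Phi 0%N (X^~ w) <= \int[Pr]_w Phi k (X^~ w).
  elim: k => [//|k IH] kn; apply: le_trans (IH (ltnW kn)) _.
  apply: (E_le_resample hX (k := k)) => // y.
  set a := fun i => 2 *: g (y i); set r := \sum_(k.+1 <= i < n) (g (y i) - G).
  have rE x : \sum_(k.+1 <= i < n) (g (update y k x i) - G) = r.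
    rewrite /r big_nat_cond [RHS]big_nat_cond; apply: eq_bigr => i /andP[/andP[ki _] _].
    by rewrite /update gtn_eqF.
  have E1 x : Phi k (update y k x) = sign_average k a Psi (r + (g x - G)).
    rewrite /Phi big_ltn// update_eq rE addrC; apply: sign_average_ext => i ik.
    by rewrite update_lt.
  have E2 x : Phi k.+1 (update y k x) =
      (sign_average k a Psi (r + 2 *: g x) + sign_average k a Psi (r - 2 *: g x)) / 2.
    rewrite /Phi /= rE update_eq; congr ((_ + _) / _); apply: sign_average_ext => i ik;
      by rewrite update_lt.
  rewrite (funext E1); have {}E2 := fun x => etrans (E2 x) (mulrC _ _).
  rewrite (funext E2).
  have b2 : bounded_measurable_mx (fun x => 2 *: g x) by apply: bmxZ => //; exact: bm_cst.
  have bA F : bounded_measurable_mx F ->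
      bounded_measurable (fun x : T => sign_average k a Psi (r + F x)).
    move=> bF; apply: (@bm_sign_average R _ T d m k (fun i _ => a i) (fun x => r + F x)) => [i|].
      exact: bmx_cst.
    by apply: bmxD => //; exact: bmx_cst.
  rewrite EZ; last by apply: bmD; apply: bA => //; exact: bmxN.
  rewrite ED; [|by apply: bA|by apply: (bA (fun x => - (2 *: g x))); exact: bmxN].
  by rewrite mulrC; exact: one_step_average.
have := H n (leqnn n); rewrite /Phi /=.
rewrite (_ : (fun w => _) = fun w => Psi (\sum_(i < n) (g (X i w) - G))); last first.
  by apply/funext => w; rewrite big_mkord.
move/le_trans; apply; rewrite le_eqVlt; apply/orP; left; apply/eqP.
by apply: eq_Rintegral => w _; rewrite big_geq.
Qed.
End symmetrization.

Lemma sqrD_le4 (R : realFieldType) (a b c : R) :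
  a ^+ 2 <= c -> b ^+ 2 <= c -> (a + b) ^+ 2 <= 4 * c.
Proof. by have := sqr_ge0 (a - b); nra. Qed.

(** * Inequalities between the constants of the maximal inequality *)

Section arithmetic.
Variable R : realFieldType.
Implicit Types E s n M B b x y S mu g V K k : R.

Lemma arith_V2 E s n M B (delta : R) :
  32 * n ^+ 2 * B ^+ 2 * M ^+ 2 * delta <=
    32 * n ^+ 2 * B ^+ 2 * M ^+ 2 * (s ^+ 2 * M ^+ 2) ->
  16 * E * (s ^+ 2 * n * n * (M ^+ 2 * B) ^+ 2) +
    8 * n * (4 * B ^+ 2 * M ^+ 2 * (n * delta)) <=
  (16 * E + 32) * (s ^+ 2 * n * n * (M ^+ 2 * B) ^+ 2).
Proof. by lra. Qed.

Lemma arith_sum n g S mu x : n * mu <= n * g -> S - n * mu <= x -> S <= n * g + x.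
Proof. by lra. Qed.

Lemma arith_th b E V : 0 <= b -> 0 <= E -> V <= (16 * E + 32) * b ->
  (b + V) / 2 <= (17 + 8 * E) * b.
Proof. by nra. Qed.

Lemma arith_disc n B s M (delta : R) :
  n ^+ 2 * B * (8 * delta) <= n ^+ 2 * B * (s ^+ 3 * M ^+ 2) ->
  8 * n * (B * (n * delta)) <= s ^+ 2 * n * (n * (M ^+ 2 * B) * s).
Proof. by lra. Qed.

Lemma arith_k E : 0 <= E -> 1 <= 17 + 8 * E.
Proof. by lra. Qed.

Lemma arith_final K k x y : 0 <= x -> 0 <= y -> K * x <= K * k * x ->
  K * x + K * k * y + y <= (K * k + 1) * x + (K * k + 1) * y.
Proof. by lra. Qed.
End arithmetic.

(** * Maximal inequality for the weighted residuals *)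

Section maximal_inequality.
Context (R : realType) (dX dO : measure_display) (T : measurableType dX)
  (Omega : measurableType dO) (P : probability T R) (Pr : probability Omega R)
  (X : nat -> {RV Pr >-> T}).
Hypothesis hX : iid P X.

(** The sample is frozen when [sign_average_max] is applied, hence [th] and the representatives may
    depend on w. The doubling of g in the symmetrization multiplies th and D by 4. *)
Lemma E_max_le_of_nets (d m n p : nat) (g : T -> 'M[R]_(d, m)) (th : Omega -> R) (D : R) :
  bounded_measurable_mx g -> bounded_measurable th ->
  (0 < p)%N -> (forall w, 0 < th w) -> 0 <= D ->
  (forall w j, p%:R * \sum_(i < n) sqnorm (col j (g (X i w))) <= th w) ->
  (forall w, exists r : 'I_m -> 'I_m, #|[set r j | j : 'I_m]|%:R <= expR p%:R :> R /\
    forall j, \sum_(i < n) sqnorm (col j (g (X i w)) - col (r j) (g (X i w))) <= D) ->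
  \int[Pr]_w max_sqnorm (\sum_(i < n) (g (X i w) - \matrix_(i, j) \int[P]_x g x i j)) <=
  16 * expR 10 * \int[Pr]_w th w + 8 * n%:R * D.
Proof.
move=> bg bth p0 th0 D0 gth nets.
apply: le_trans (symmetrization hX bg n) _.
have bgX i : bounded_measurable_mx (fun w => g (X i w)).
  by move=> a b; apply: (bm_comp _ (bg a b)); exact: measurable_funP.
rewrite -EZ// -[X in _ <= _ + X](E_cst Pr) -ED; [|exact: bmZ|exact: bm_cst].
apply: E_le.
- apply: (@bm_sign_average R _ Omega d m n (fun i w => 2 *: g (X i w))) => [i|].
    by apply: bmxZ => //; exact: bm_cst.
  exact: bmx_cst.
- by apply: bmD; [exact: bmZ|exact: bm_cst].
move=> w; have [r [card_r rD]] := nets w.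
have := @sign_average_max R d m n (fun i => 2 *: g (X i w)) r p (4 * th w) (4 * D)
  p0 _ _ card_r.
rewrite mulr_gt0// mulr_ge0// => /(_ isT isT) H.
have cz l x : col l (2 *: g x) = 2 *: col l (g x) by rewrite linearZ.
apply: le_trans (H _ _) _.
- move=> j; under eq_bigr do rewrite cz sqnormZ.
  by rewrite -mulr_sumr; have := gth w j; set s := \sum_(i < n) _; lra.
- move=> j; under eq_bigr do rewrite !cz -scalerBr sqnormZ.
  by rewrite -mulr_sumr; have := rD j; set s := \sum_(i < n) _; lra.
- by rewrite le_eqVlt; apply/orP; left; apply/eqP; ring.
Qed.

Section weighted_residuals.
Context (d m n p : nat) (v : T -> 'cV[R]_d) (eps : 'I_m -> T -> R).
(** Here s stands for sqrt(p / n) and delta for the squared radius of the net of residuals. *)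
Variables (B M gamma2 delta s : R).
Hypotheses (bv : bounded_measurable_mx v) (be : forall j, bounded_measurable (eps j)).
Hypotheses (vB : forall x, sqnorm (v x) <= B) (eM : forall j x, `|eps j x| <= M).
Hypotheses (B0 : 0 < B) (M0 : 0 < M) (g0 : 0 <= gamma2) (n0 : (0 < n)%N) (p0 : (0 < p)%N).
Hypothesis orth : forall i j, \int[P]_x (eps j x * v x i ord0) = 0.
Hypothesis eg : forall j, \int[P]_x (sqnorm (v x) * eps j x ^+ 2) <= gamma2.
Hypothesis nets : forall w, exists r : 'I_m -> 'I_m,
  #|[set r j | j : 'I_m]|%:R <= expR p%:R :> R /\
  forall j, \sum_(i < n) (eps j (X i w) - eps (r j) (X i w)) ^+ 2 <= n%:R * delta.
Hypotheses (s0 : 0 < s) (s1 : s <= 1) (sp : s ^+ 2 * n%:R = p%:R).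
Hypotheses (d0 : 0 <= delta) (ds : 8 * delta <= s ^+ 3 * M ^+ 2).

Let nR : 0 < n%:R :> R. Proof. by rewrite ltr0n. Qed.
Let L2 := M ^+ 2 * B.
Let L20 : 0 < L2. Proof. by rewrite mulr_gt0// exprn_gt0. Qed.
Let q x := sqnorm (v x).
Let q0 x : 0 <= q x. Proof. exact: sqnorm_ge0. Qed.
Let bq : bounded_measurable q. Proof. exact: bmx_sqnorm. Qed.
Let e2 j x : eps j x ^+ 2 <= M ^+ 2.
Proof. by rewrite -(real_normK (num_real _)); apply: lerXn2r; rewrite ?nnegrE// ltW. Qed.
Let delta_le : delta <= s ^+ 2 * M ^+ 2.
Proof.
have s2 : 0 <= s ^+ 2 * M ^+ 2 by rewrite mulr_ge0 ?sqr_ge0.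
have h : s ^+ 3 * M ^+ 2 <= s ^+ 2 * M ^+ 2.
  by rewrite exprS -mulrA; apply: ler_piMl.
by apply: le_trans (le_trans ds h); rewrite ler_peMl// ler1n.
Qed.

(** Real functions seen as columns of height 1, so that the same maximal inequality controls the
    fluctuation of \sum_i q eps_j^2. *)
Let g2 x : 'M[R]_(1, m) := \row_j (q x * eps j x ^+ 2).
Let bg2 : bounded_measurable_mx g2.
Proof.
move=> i j; apply: bm_ext (bmM bq (bmX 2 (be j))) => x.
by rewrite mxE.
Qed.
Let sqnorm1 (z : 'cV[R]_1) : sqnorm z = z ord0 ord0 ^+ 2.
Proof. by rewrite sqnormE big_ord1. Qed.
Let V2 w := max_sqnorm (\sum_(i < n) (g2 (X i w) - \matrix_(i, j) \int[P]_x g2 x i j)).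
Let bV2 : bounded_measurable V2.
Proof.
apply: bm_max_sqnorm; apply: bmx_sum => i; apply: bmxB; last exact: bmx_cst.
by move=> a b; apply: (bm_comp _ (bg2 a b)); exact: measurable_funP.
Qed.

(** Each q eps_j^2 is at most L2, which gives the scale p n L2^2; factoring eps_j^2 - eps_r^2 costs
    4 B^2 M^2 in the net error. *)
Let E_V2 : \int[Pr]_w V2 w <= (16 * expR 10 + 32) * (p%:R * n%:R * L2 ^+ 2).
Proof.
have := @E_max_le_of_nets 1 m n p g2 (fun _ => p%:R * n%:R * L2 ^+ 2)
  (4 * B ^+ 2 * M ^+ 2 * (n%:R * delta)) bg2 (bm_cst _ _) p0.
rewrite E_cst => H; apply: le_trans (H _ _ _ _) _.
- by move=> _; rewrite !mulr_gt0 ?exprn_gt0 ?ltr0n.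
- by rewrite !mulr_ge0 ?sqr_ge0// ltW.
- move=> w j; rewrite -mulrA; apply: ler_wpM2l => //.
  apply: le_trans (_ : _ <= \sum_(i < n) L2 ^+ 2) _; last first.
    by rewrite sumr_const card_ord -[leLHS]mulr_natl.
  apply: ler_sum => i _; rewrite sqnorm1 !mxE; apply: lerXn2r; rewrite ?nnegrE ?(ltW L20)//.
    by rewrite mulr_ge0 ?sqr_ge0.
  by rewrite /L2 [leRHS]mulrC; apply: ler_pM; rewrite ?sqr_ge0 ?vB ?e2.
- move=> w; have [r [cr rd]] := nets w; exists r; split => // j.
  have K0 : 0 <= 4 * B ^+ 2 * M ^+ 2.
    exact: (mulr_ge0 (mulr_ge0 (ler0n _ 4) (sqr_ge0 _)) (sqr_ge0 _)).
  apply: le_trans (ler_wpM2l K0 (rd j)).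
  rewrite mulr_sumr; apply: ler_sum => i _; rewrite sqnorm1 !mxE -mulrBr exprMn subr_sqr exprMn.
  have h1 : q (X i w) ^+ 2 <= B ^+ 2 by apply: lerXn2r; rewrite ?nnegrE ?(ltW B0)//; exact: vB.
  have h2 : (eps j (X i w) + eps (r j) (X i w)) ^+ 2 <= 4 * M ^+ 2.
    exact: sqrD_le4.
  set e := (_ - _) ^+ 2; have e0 : 0 <= e by exact: sqr_ge0.
  rewrite [_ * (_ + _) ^+ 2]mulrC mulrA -mulrA.
  rewrite mulrA; apply: ler_wpM2r => //.
  rewrite (_ : 4 * B ^+ 2 * M ^+ 2 = B ^+ 2 * (4 * M ^+ 2)); last by ring.
  by apply: ler_pM => //; exact: sqr_ge0.
have h := ler_wpM2l (_ : 0 <= 32 * n%:R ^+ 2 * B ^+ 2 * M ^+ 2) delta_le.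
rewrite -sp /L2; have {}h := h (mulr_ge0 (mulr_ge0 (mulr_ge0 (ler0n _ _) (sqr_ge0 _)) (sqr_ge0 _)) (sqr_ge0 _)).
exact: arith_V2 h.
Qed.

Let g1 x : 'M[R]_(d, m) := \matrix_(i, j) (eps j x * v x i ord0).
Let bg1 : bounded_measurable_mx g1.
Proof. by move=> i j; apply: bm_ext (bmM (be j) (bv i ord0)) => x; rewrite mxE. Qed.
Let col_g1 j x : col j (g1 x) = eps j x *: v x.
Proof. by apply/matrixP => i k; rewrite !mxE (ord1 k). Qed.

(** The parameter in y <= (b + y^2 / b) / 2, applied to the fluctuation y of \sum_i q eps_j^2. It
    balances the two terms, as b^2 = p n L2^2 is the order of the mean of V2. *)
Let b := n%:R * L2 * s.
Let b0 : 0 < b. Proof. by rewrite !mulr_gt0. Qed.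
Let th w := p%:R * (n%:R * gamma2 + (b + V2 w / b) / 2).

Let sum_le w j : \sum_(i < n) q (X i w) * eps j (X i w) ^+ 2 <=
  n%:R * gamma2 + (b + V2 w / b) / 2.
Proof.
set S := \sum_(i < n) _; set mu := \int[P]_x (q x * eps j x ^+ 2).
have h : (S - n%:R * mu) ^+ 2 <= V2 w.
  apply: le_trans (sqnorm_le_max _ j); rewrite sqnorm1 mxE summxE.
  rewrite (_ : \sum_(i < n) _ = S - n%:R * mu)//.
  under eq_bigr do rewrite !mxE; rewrite sumrB sumr_const card_ord -[_ *+ n]mulr_natl.
  by congr (_ - _ * _); apply: eq_Rintegral => x _; rewrite mxE.
have h2 : S - n%:R * mu <= (b + V2 w / b) / 2.
  apply: le_trans (_ : _ <= (b + (S - n%:R * mu) ^+ 2 / b) / 2) _; last first.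
    by rewrite ler_pM2r// lerD2l ler_pM2r ?invr_gt0.
  set y := S - _; rewrite -subr_ge0.
  rewrite (_ : _ - y = (y - b) ^+ 2 / (2 * b)); last by field; rewrite gt_eqF.
  by rewrite divr_ge0 ?sqr_ge0// mulr_ge0// ltW.
have := eg j; rewrite -/mu => h3.
exact: arith_sum (ler_wpM2l (ltW nR) h3) h2.
Qed.

Lemma E_max_weighted_residuals :
  \int[Pr]_w max_sqnorm (\sum_(i < n) \matrix_(i', j) (eps j (X i w) * v (X i w) i' ord0)) <=
  (16 * expR 10 * (17 + 8 * expR 10) + 1) * (p%:R * n%:R * (gamma2 + L2 * s)).
Proof.
have V0 w : 0 <= V2 w by exact: max_sqnorm_ge0.
have bth : bounded_measurable th.
  apply: bmZ; apply: bmD; first exact: bm_cst.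
  apply: bmM; last exact: bm_cst.
  by apply: bmD; [exact: bm_cst|apply: bmM => //; exact: bm_cst].
have := @E_max_le_of_nets d m n p g1 th (B * (n%:R * delta)) bg1 bth p0.
have G0 : \matrix_(i, j) \int[P]_x g1 x i j = 0.
  apply/matrixP => i j; rewrite !mxE -[RHS](orth i j).
  by apply: eq_Rintegral => x _; rewrite mxE.
rewrite G0 => H.
under eq_Rintegral => w _ do under eq_bigr do rewrite -[\matrix_(i', j) _]subr0.
apply: le_trans (H _ _ _ _) _.
- move=> w; rewrite mulr_gt0 ?ltr0n//; apply: ltr_wpDl; first by rewrite mulr_ge0.
  by rewrite divr_gt0// ltr_pwDl// divr_ge0// ltW.
- by rewrite !mulr_ge0// ltW.
- move=> w j; apply: ler_wpM2l => //; apply: le_trans (sum_le w j).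
  by apply: ler_sum => i _; rewrite col_g1 sqnormZ mulrC.
- move=> w; have [r [cr rd]] := nets w; exists r; split => // j.
  apply: le_trans (ler_wpM2l (ltW B0) (rd j)); rewrite mulr_sumr.
  apply: ler_sum => i _; rewrite !col_g1 -scalerBl sqnormZ mulrC.
  by apply: ler_wpM2r; [exact: sqr_ge0|exact: vB].
have Eth : \int[Pr]_w th w <= p%:R * (n%:R * gamma2 + (17 + 8 * expR 10) * b).
  have -> : \int[Pr]_w th w = p%:R * (n%:R * gamma2 + (b + (\int[Pr]_w V2 w) / b) / 2).
    rewrite (_ : th = fun w => p%:R * (n%:R * gamma2 + b / 2) + (p%:R / (2 * b)) * V2 w).
      rewrite ED ?E_cst; [|exact: bm_cst|exact: bmZ].
      by rewrite EZ//; field; rewrite gt_eqF.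
    by apply/funext => w; rewrite /th; field; rewrite gt_eqF.
  apply: ler_wpM2l => //; rewrite lerD2l.
  have h : (\int[Pr]_w V2 w) / b <= (16 * expR 10 + 32) * b.
    rewrite ler_pdivrMr//; apply: le_trans E_V2 _.
    by rewrite -mulrA -sp /b /L2 le_eqVlt; apply/orP; left; apply/eqP; ring.
  exact: arith_th (ltW b0) (ltW (expR_gt0 10)) h.
have k0 : 0 < 16 * expR 10 :> R by rewrite mulr_gt0// expR_gt0.
apply: le_trans (lerD (ler_wpM2l (ltW k0) Eth) (lexx _)) _.
(* The hypothesis on delta is tuned so that the discretization error is no larger than the
   fluctuation term p b. *)
have h8 : 8 * n%:R * (B * (n%:R * delta)) <= p%:R * b.
  have c0 : 0 <= n%:R ^+ 2 * B by rewrite mulr_ge0 ?sqr_ge0// ltW.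
  by rewrite -sp; exact: arith_disc (ler_wpM2l c0 ds).
have bE : p%:R * b = p%:R * n%:R * (L2 * s) by rewrite /b; ring.
have hg : 0 <= p%:R * n%:R * gamma2 by rewrite !mulr_ge0.
have hL : 0 <= p%:R * n%:R * (L2 * s) by rewrite !mulr_ge0// ltW.
have e10 := expR_gt0 (10 : R).
set K := 16 * expR 10 in k0 *.
set k := 17 + 8 * expR 10; have k1 : 1 <= k by exact: arith_k (ltW e10).
have hk : K * (p%:R * n%:R * gamma2) <= K * k * (p%:R * n%:R * gamma2).
  by rewrite -[leRHS]mulrA; apply: ler_wpM2l; [exact: ltW|exact: ler_peMl].
apply: le_trans (lerD (lexx _) h8) _; rewrite bE.
have -> : K * (p%:R * (n%:R * gamma2 + k * b)) =
  K * (p%:R * n%:R * gamma2) + K * k * (p%:R * n%:R * (L2 * s)) by rewrite /b; ring.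
rewrite (mulrDr (p%:R * n%:R)) (mulrDr (K * k + 1)); set x := p%:R * n%:R * gamma2 in hg hk *.
set y := p%:R * n%:R * (L2 * s) in hL *.
exact: arith_final hg hL hk.
Qed.
End weighted_residuals.
End maximal_inequality.

(** * Nets from the VC condition *)

(** The empirical measure of the sample, to which the uniform entropy condition is applied. *)
Lemma empirical_probability (R : realType) (d : measure_display)
    (T : measurableType d) (n : nat) (y : nat -> T) : (0 < n)%N ->
  exists Q : probability T R, forall g : T -> R, measurable_fun setT g ->
    (forall x, 0 <= g x) -> (\int[Q]_x (g x)%:E)%E = (n%:R^-1 * \sum_(i < n) g (y i))%:E.
Proof.
move=> n0; have nR : 0 < n%:R :> R by rewrite ltr0n.
have c0 : 0 <= n%:R^-1 :> R by rewrite invr_ge0 ltW.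
pose c : {nonneg R} := NngNum c0.
pose m := mscale c (msum (fun i => \d_(y i) : {measure set T -> \bar R}) n).
have mT : m setT = 1%E.
  rewrite /m /mscale/= /msum (eq_bigr (fun=> 1%:E)); last first.
    by move=> i _; rewrite /= diracE in_setT.
  by rewrite sumEFin -EFinM sumr_const card_ord mulVf// gt_eqF.
pose Q : probability T R := HB.pack m (Measure_isProbability.Build _ _ _ m mT).
exists Q => g mg g0; rewrite ge0_integral_mscale//; last 2 first.
- exact/measurable_EFinP.
- by move=> x _; rewrite lee_fin.
rewrite ge0_integral_measure_sum//; last 2 first.
- by move=> x _; rewrite lee_fin.
- exact/measurable_EFinP.
rewrite /= EFinM -sumEFin; congr (_ * _)%E; apply: eq_bigr => i _.
by rewrite integral_dirac//; [rewrite diracE in_setT mul1e|exact/measurable_EFinP].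
Qed.

Section L2_nets.
Import HBNNSimple.
Context (R : realType) (d : measure_display) (T : measurableType d)
  (Q : probability T R).

Lemma Lnorm2_lt (g : T -> R) (a : R) : (('N[Q]_2%:E [EFin \o g]) < a%:E)%E ->
  (\int[Q]_x (g x ^+ 2)%:E <= (a ^+ 2)%:E)%E.
Proof.
have -> : (\int[Q]_x (g x ^+ 2)%:E = 'N[Q]_2%:E [EFin \o g] `^ 2)%E.
  rewrite poweR_Lnorm//; apply: eq_integral => x _ /=.
  by rewrite powR_mulrn// real_normK// num_real.
have := Lnorm_ge0 Q 2%:E (EFin \o g).
case: ('N[Q]_2%:E [EFin \o g])%E => [r| |//]; last by move=> _; rewrite ltNge leey.
rewrite lee_fin lte_fin => r0 ra; rewrite poweR_EFin lee_fin powR_mulrn//.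
by apply: lerXn2r; rewrite ?nnegrE// ltW// (le_lt_trans r0).
Qed.

(* [g] need not be measurable: the integral of a nonnegative function is then
   its lower integral. *)
Lemma Lnorm2_le (g : T -> R) (U : R) : (forall x, 0 <= g x <= U) -> 0 <= U ->
  ('N[Q]_2%:E [EFin \o g] <= U%:E)%E.
Proof.
move=> gU U0; rewrite unlock.
have h : (\int[Q]_x (`|(EFin \o g) x| `^ 2) <= (U ^+ 2)%:E)%E.
  rewrite ge0_integralTE; last by move=> x; exact: poweR_ge0.
  apply: ge_ereal_sup => _ [h hg <-].
  rewrite -integralT_nnsfun; apply: (@le_trans _ _ (\int[Q]_x (cst (U ^+ 2)%:E) x)%E).
    apply: ge0_le_integral => //.
    - by move=> x _; rewrite lee_fin; exact: fun_ge0.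
    - exact/measurable_EFinP.
    - move=> x _; apply: le_trans (hg x) _ => /=.
      have /andP[g0 gU'] := gU x; rewrite ger0_norm// lee_fin powR_mulrn//.
      by apply: lerXn2r; rewrite ?nnegrE.
  rewrite integral_cst// [X in (_ * X)%E](@probability_setT _ _ _ Q) mule1//.
apply: (@le_trans _ _ (((U ^+ 2)%:E) `^ 2^-1)%E).
  apply: gt0_ler_poweR => //; rewrite in_itv/= ?leey ?andbT.
  - by apply: integral_ge0 => x _; rewrite lee_fin powR_ge0.
  - by rewrite lee_fin sqr_ge0.
rewrite poweR_EFin lee_fin -powR_mulrn// -powRrM mulfV// powRr1//.
Qed.

(** Each f_j is labelled by a ball containing it. Centres need not lie in F, so functions with equal
    labels are compared through their centre, which doubles the radius. *)
Lemma VC_cells (F : set (T -> R)) (Fenv : T -> R) (v A U eta : R) (m : nat)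
    (f : 'I_m -> T -> R) :
  VC_class F Fenv v A -> (forall x, 0 <= Fenv x <= U) -> 0 <= U -> 0 < eta < 1 ->
  (forall j, F (f j)) -> (forall j, measurable_fun setT (f j)) ->
  exists N : nat, N%:R <= (A / eta) `^ v + 1 /\ exists c : 'I_m -> 'I_N,
    forall j l, c j = c l ->
      (\int[Q]_x ((f j x - f l x) ^+ 2)%:E <= (4 * (eta * U) ^+ 2)%:E)%E.
Proof.
move=> hVC FU U0 eta01 Ff mf; have [eta0 _] := andP eta01.
have := hVC eta eta01 Q; rewrite /covering_number.
(* The covering number is an infimum; adding 1 gives strict room to extract an actual cover. *)
move=> /le_lt_trans /(_ (_ : _ < ((A / eta) `^ v + 1)%:E)%E).
rewrite lte_fin ltrDl ltr01 => /(_ isT) /ereal_inf_lt[_ [N [c [cL Fc]] <-]].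
rewrite lte_fin => /ltW Nle; exists N; split => //.
have rad : (eta%:E * 'N[Q]_2%:E [EFin \o Fenv] <= (eta * U)%:E)%E.
  by rewrite EFinM; apply: lee_wpmul2l; [rewrite lee_fin ltW|exact: Lnorm2_le].
have /choice[k kP] : forall j, exists i : 'I_N,
    (\int[Q]_x ((c i x - f j x) ^+ 2)%:E <= ((eta * U) ^+ 2)%:E)%E.
  move=> j; have [i _ ci] := Fc _ (Ff j); exists i.
  by apply: Lnorm2_lt; exact: lt_le_trans ci rad.
exists k => j l kjl.
have mc : measurable_fun setT (c (k j)).
  exact: (set_mem (sub_Lfun_mfun (cL (k j)))).
have msq (g : T -> R) : measurable_fun setT g -> measurable_fun setT (fun x => (2 * (c (k j) x - g x) ^+ 2)%:E).
  move=> mg; apply/measurable_EFinP; apply: measurable_funM => //.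
  by apply: measurable_funX; exact: measurable_funB.
have Eg (g : T -> R) : measurable_fun setT g -> (\int[Q]_x ((c (k j) x - g x) ^+ 2)%:E <= ((eta * U) ^+ 2)%:E)%E ->
    (\int[Q]_x (2 * (c (k j) x - g x) ^+ 2)%:E <= (2 * (eta * U) ^+ 2)%:E)%E.
  move=> mg h; under eq_integral do rewrite EFinM.
  rewrite ge0_integralZl//; last 2 first.
  - by apply/measurable_EFinP; apply: measurable_funX; exact: measurable_funB.
  - by move=> x _; rewrite lee_fin sqr_ge0.
  by rewrite EFinM; apply: lee_wpmul2l.
have h1 := Eg _ (mf j) (kP j).
have h2 : (\int[Q]_x (2 * (c (k j) x - f l x) ^+ 2)%:E <= (2 * (eta * U) ^+ 2)%:E)%E.
  by apply: Eg => //; rewrite kjl; exact: kP.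
apply: (@le_trans _ _ (\int[Q]_x ((2 * (c (k j) x - f j x) ^+ 2)%:E +
    (2 * (c (k j) x - f l x) ^+ 2)%:E))%E).
  apply: ge0_le_integral => //.
  - by move=> x _; rewrite lee_fin sqr_ge0.
  - by apply/measurable_EFinP; apply: measurable_funX; exact: measurable_funB.
  - by apply: emeasurable_funD; exact: msq.
  - move=> x _; rewrite -EFinD lee_fin.
    by have := sqr_ge0 ((c (k j) x - f j x) + (c (k j) x - f l x)); nra.
rewrite ge0_integralD//; last 4 first.
- by move=> x _; rewrite lee_fin mulr_ge0// sqr_ge0.
- exact: msq.
- by move=> x _; rewrite lee_fin mulr_ge0// sqr_ge0.
- exact: msq.
apply: le_trans (leeD h1 h2) _; rewrite -EFinD lee_fin; lra.
Qed.
End L2_nets.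

(** Labels are pairs of cells, one for P and one for the empirical measure, so one representative is
    close in both norms; this squares the cardinality. *)
Lemma VC_representatives (R : realType) (d : measure_display) (T : measurableType d)
    (P : probability T R) (F : set (T -> R)) (Fenv : T -> R) (v A U eta : R)
    (m n : nat) (f : 'I_m -> T -> R) (y : nat -> T) : (0 < n)%N ->
  VC_class F Fenv v A -> (forall x, 0 <= Fenv x <= U) -> 0 <= U -> 0 < eta < 1 ->
  (forall j, F (f j)) -> (forall j, bounded_measurable (f j)) ->
  exists r : 'I_m -> 'I_m,
    #|[set r j | j : 'I_m]|%:R <= ((A / eta) `^ v + 1) ^+ 2 /\
    forall j, \int[P]_x ((f j x - f (r j) x) ^+ 2) <= 4 * (eta * U) ^+ 2 /\
      \sum_(i < n) (f j (y i) - f (r j) (y i)) ^+ 2 <= n%:R * (4 * (eta * U) ^+ 2).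
Proof.
move=> n0 hVC FU U0 eta01 Ff bf; have nR : 0 < n%:R :> R by rewrite ltr0n.
have mf j : measurable_fun setT (f j) by case: (bf j).
have [Q QE] := empirical_probability R y n0.
have [N1 [N1le [c1 c1P]]] := VC_cells P hVC FU U0 eta01 Ff mf.
have [N2 [N2le [c2 c2P]]] := VC_cells Q hVC FU U0 eta01 Ff mf.
pose k j := (c1 j, c2 j).
(* The choice depends on j only through its label; the default is never reached, because j itself
   has that label. *)
pose r j := odflt j [pick l | k l == k j].
have kr j : k (r j) = k j.
  by rewrite /r; case: pickP => [l /eqP //|/(_ j)]; rewrite eqxx.
have rE j l : k j = k l -> r j = r l.
  by rewrite /r => ->; case: pickP => // /(_ l); rewrite eqxx.
exists r; split.
  apply: le_trans (_ : _ <= (N1 * N2)%:R) _.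
    rewrite ler_nat -(card_in_imset (f := k)); last first.
      by move=> _ _ /imsetP[j _ ->] /imsetP[l _ ->]; rewrite !kr => /rE.
    by rewrite (leq_trans (max_card _))// card_prod !card_ord.
  by rewrite natrM expr2; apply: ler_pM.
move=> j; have [e1 e2] : c1 j = c1 (r j) /\ c2 j = c2 (r j).
  by have := kr j; rewrite /k => -[-> ->].
split.
  have := c1P _ _ e1; rewrite E_EFin ?lee_fin//.
  by apply: bmX; exact: bmB.
have := c2P _ _ e2; rewrite QE; last 2 first.
- by apply: measurable_funX; exact: measurable_funB.
- by move=> x; exact: sqr_ge0.
by rewrite lee_fin ler_pdivrMl.
Qed.

(** * Whitening and regression *)

Section whitening.
Variable R : rcfType.

(** One step of a block Cholesky factorization: W whitens the Schur complement of a. *)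
Lemma whitening_block d (a : R) (b : 'cV[R]_d) (C W : 'M[R]_d) : 0 < a ->
  W *m (C - a^-1 *: (b *m b^T)) *m W^T = 1%:M ->
  exists V : 'M[R]_(1 + d), V *m block_mx a%:M b^T b C *m V^T = 1%:M.
Proof.
move=> a0 WS; have a1 := mulVf (lt0r_neq0 a0).
pose al := (Num.sqrt a)^-1.
have al2 : al * a * al = 1.
  have s0 : Num.sqrt a != 0 by rewrite gt_eqF// sqrtr_gt0.
  by rewrite -[a in _ * a * _]sqr_sqrtr ?ltW// expr2 /al mulrA mulVf// mul1r mulfV.
exists (block_mx al%:M 0 (- a^-1 *: (W *m b)) W).
rewrite mulmx_block !mul0mx !addr0 -scalar_mxM mul_scalar_mx.
have -> : - a^-1 *: (W *m b) *m a%:M + W *m b = 0.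
  by rewrite -scalemxAl mul_mx_scalar scalerA mulNr a1 scaleN1r addNr.
have -> : - a^-1 *: (W *m b) *m b^T + W *m C = W *m (C - a^-1 *: (b *m b^T)).
  by rewrite mulmxBr -scalemxAl scaleNr addrC -scalemxAr mulmxA.
rewrite tr_block_mx mulmx_block !(tr_scalar_mx, trmx0, mul0mx, mulmx0, add0r, addr0) WS.
rewrite -scalar_mxM al2.
have -> : (al * a)%:M *m (- a^-1 *: (W *m b))^T + al *: b^T *m W^T = 0.
  rewrite linearZ/= trmx_mul mul_scalar_mx scalerA -scalemxAl.
  by rewrite mulrN -mulrA [a * _]mulrC a1 mulr1 scaleNr addNr.
by rewrite -scalar_mx_block.
Qed.

Lemma whitening_pd d (G : 'M[R]_d) : G^T = G ->
  (forall x : 'cV[R]_d, x != 0 -> 0 < bil G x x) ->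
  exists W : 'M[R]_d, W *m G *m W^T = 1%:M.
Proof.
elim: d => [|d IH] in G *; first by move=> _ _; exists 1%:M; apply/matrixP => -[].
rewrite -[d.+1]/(1 + d)%N in G * => sG G0.
pose a := G ord0 ord0; pose b : 'cV[R]_d := dlsubmx G; pose C := drsubmx G.
have aE : ulsubmx G = a%:M.
  apply/matrixP => i j; rewrite !mxE (ord1 i) (ord1 j) eqxx mulr1n /a.
  by congr (G _ _); apply: val_inj.
have bE : ursubmx G = b^T by rewrite /b trmx_dlsub sG.
have sC : C^T = C by rewrite /C trmx_drsub sG.
have GE : G = block_mx a%:M b^T b C by rewrite -aE -bE submxK.
have a0 : 0 < a.
  have e0 : delta_mx ord0 ord0 != 0 :> 'cV[R]_(1 + d).
    by apply/eqP => /matrixP /(_ ord0 ord0) /eqP; rewrite !mxE !eqxx oner_eq0.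
  by have := G0 _ e0; rewrite bil_delta -colE mxE.
have [||W WS] := IH (C - a^-1 *: (b *m b^T)).
- by rewrite linearB linearZ/= trmx_mul trmxK sC.
(* This t minimizes the form over the first coordinate, and the minimum is the Schur complement at
   y. *)
- move=> y y0; pose t := - a^-1 *: (b^T *m y).
  have x0 : col_mx t y != 0.
    by apply: contra_neq y0 => /(congr1 dsubmx); rewrite col_mxKd linear0.
  have := G0 _ x0; rewrite /bil GE tr_col_mx mul_row_block mul_row_col.
  have -> : t^T *m a%:M + y^T *m b = 0.
    rewrite /t linearZ/= trmx_mul trmxK -scalemxAl mul_mx_scalar scalerA.
    by rewrite mulNr mulVf ?gt_eqF// scaleN1r addNr.
  rewrite mul0mx add0r; congr (0 < _ ord0 ord0).
  have -> : t^T *m b^T = - (y^T *m (a^-1 *: (b *m b^T))).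
    by rewrite /t linearZ/= trmx_mul trmxK -scalemxAl scaleNr -scalemxAr mulmxA.
  by rewrite addrC mulmxBr.
have [V VG] := whitening_block a0 WS; exists V.
by rewrite GE.
Qed.

Lemma whitening d (G : 'M[R]_d) : psd G -> G \in unitmx ->
  exists2 W : 'M[R]_d, W \in unitmx & W *m G *m W^T = 1%:M.
Proof.
move=> pG uG; have [sG G0] := pG.
have [|W WG] := whitening_pd sG; last by exists W => //; rewrite -mulmxA in WG; case: (mulmx1_unit WG).
move=> x x0; rewrite lt_neqAle G0 andbT eq_sym.
apply: contra_neq x0 => Gx.
have Gx0 : G *m x = 0.
  apply/matrixP => i j; rewrite (ord1 j) -bil_delta mxE.
  have := psd_CS (delta_mx i ord0) x pG; rewrite Gx mulr0 => h.
  by apply/eqP; rewrite -sqrf_eq0 eq_le h sqr_ge0.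
by rewrite -[x](mulKmx uG) Gx0 mulmx0.
Qed.
End whitening.

Section matrix_means.
Context (R : realType) (d0 : measure_display) (T : measurableType d0) (P : probability T R).

Lemma mx_meanMl m n k (A : 'M[R]_(m, n)) (F : T -> 'M[R]_(n, k)) :
  bounded_measurable_mx F -> mx_mean P (fun x => A *m F x) = A *m mx_mean P F.
Proof.
move=> bF; apply/matrixP => i j; rewrite !mxE.
under eq_Rintegral do rewrite mxE.
rewrite E_sum; last by move=> l; apply: bmZ; exact: bF.
by apply: eq_bigr => l _; rewrite mxE EZ.
Qed.

Lemma mx_mean_tr m n (F : T -> 'M[R]_(m, n)) :
  mx_mean P (fun x => (F x)^T) = (mx_mean P F)^T.
Proof.
by apply/matrixP => i j; rewrite !mxE; apply: eq_Rintegral => x _; rewrite mxE.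
Qed.

Lemma mx_meanMr m n k (A : 'M[R]_(n, k)) (F : T -> 'M[R]_(m, n)) :
  bounded_measurable_mx F -> mx_mean P (fun x => F x *m A) = mx_mean P F *m A.
Proof.
move=> bF; apply: trmx_inj; rewrite -mx_mean_tr trmx_mul -mx_mean_tr.
rewrite -mx_meanMl; last exact: bmx_tr.
by congr mx_mean; apply/funext => x; rewrite trmx_mul.
Qed.

Lemma integrable_sumE (I : Type) (r : seq I) (f : I -> T -> R) :
  (forall i, P.-integrable setT (EFin \o f i)) ->
  P.-integrable setT (EFin \o (fun x => \sum_(i <- r) f i x)) /\
  \int[P]_x (\sum_(i <- r) f i x) = \sum_(i <- r) \int[P]_x f i x.
Proof.
move=> hf; elim: r => [|i r [IH1 IH2]].
  rewrite big_nil (_ : (fun x => _) = fun=> 0); last by apply/funext => x; rewrite big_nil.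
  by split; [exact: (bm_integrableP P (bm_cst _ _))|rewrite E_cst].
rewrite big_cons -IH2 (_ : (fun x => _) = fun x => f i x + \sum_(i <- r) f i x); last first.
  by apply/funext => x; rewrite big_cons.
split; last exact: RintegralD.
by have := integrableD measurableT (hf i) IH1; apply: eq_integrable.
Qed.

(** Only square integrability is available here: boundedness of the features is deduced from the
    leverage after whitening, which relies on this lemma. *)
Lemma psd_gram d (h : T -> 'cV[R]_d) :
  (forall i, (fun x => h x i ord0) \in Lfun P 2%:E) -> psd (gram P h).
Proof.
move=> hL.
have gE i j : gram P h i j = \int[P]_x (h x i ord0 * h x j ord0).
  rewrite mxE; apply: eq_Rintegral => x _.
  by rewrite /gram_at mxE big_ord1 mxE.
have hI i j : P.-integrable setT (EFin \o (fun x => h x i ord0 * h x j ord0)).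
  exact/Lfun1_integrable/(Lfun2_mul_Lfun1 (hL i) (hL j)).
split.
  by apply/matrixP => i j; rewrite mxE !gE; apply: eq_Rintegral => x _; rewrite mulrC.
move=> x; rewrite bil_suml pair_big/=.
pose f (ij : 'I_d * 'I_d) t := x ij.1 ord0 * x ij.2 ord0 * (h t ij.1 ord0 * h t ij.2 ord0).
have fI ij : P.-integrable setT (EFin \o f ij).
  have := integrableZl measurableT (x ij.1 ord0 * x ij.2 ord0) (hI ij.1 ij.2).
  by apply: eq_integrable.
have [_ fE] := integrable_sumE (index_enum _) fI.
have -> : \sum_(p : 'I_d * 'I_d) x p.1 ord0 * gram P h p.1 p.2 * x p.2 ord0 =
    \sum_(p : 'I_d * 'I_d) \int[P]_t f p t.
  apply: eq_bigr => -[i j] _; rewrite /f /= gE.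
  by rewrite RintegralZl// mulrAC.
rewrite -fE; apply: E_ge0 => t.
rewrite (_ : \sum_ij f ij t = (\sum_i x i ord0 * h t i ord0) ^+ 2) ?sqr_ge0//.
rewrite expr2 big_distrlr/= pair_big/=; apply: eq_bigr => -[i j] _.
by rewrite /f /=; ring.
Qed.
End matrix_means.

(** * Least squares in whitened coordinates *)

Section regression.
Context (R : realType) (dX : measure_display) (T : measurableType dX)
  (P : probability T R) (d : nat) (h : T -> 'cV[R]_d).
Hypothesis fh : feature_map P h.
Variable B : R.
Hypothesis qB : forall x, leverage P h x <= B.

Lemma whitened_features : exists2 W : 'M[R]_d, W \in unitmx &
  [/\ invmx (gram P h) = W^T *m W, bounded_measurable_mx (fun x => W *m h x),
      forall x, sqnorm (W *m h x) = leverage P h x &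
      forall i j, \int[P]_x ((W *m h x) i ord0 * (W *m h x) j ord0) = (i == j)%:R].
Proof.
have [_ hL uG] := fh.
have [W uW WG] := whitening (psd_gram hL) uG.
have GW : gram P h *m (W^T *m W) = 1%:M.
  apply: (can_inj (mulKmx uW)); rewrite mulmx1.
  by rewrite !mulmxA WG mul1mx.
have iG : invmx (gram P h) = W^T *m W.
  by apply: (can_inj (mulKmx uG)); rewrite mulmxV.
have qE x : sqnorm (W *m h x) = leverage P h x.
  by rewrite /sqnorm /leverage iG trmx_mul !mulmxA.
have bv : bounded_measurable_mx (fun x => W *m h x).
  move=> i j; rewrite (ord1 j); split.
    rewrite (_ : (fun x => _) = fun x => \sum_k W i k * h x k ord0).
      apply: measurable_sum => k; apply: measurable_funM => //.
      exact: (set_mem (sub_Lfun_mfun (hL k))).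
    by apply/funext => x; rewrite mxE.
  (* Since |v|^2 = q_n <= B, each entry t satisfies |t| <= 1 + t^2 <= 1 + B. *)
  exists (1 + B) => x.
  have h1 : (W *m h x) i ord0 ^+ 2 <= B.
    apply: le_trans (qB x); rewrite -qE sqnormE (bigD1 i)//= lerDl.
    by apply: sumr_ge0 => k _; exact: sqr_ge0.
  rewrite ler_norml; set t := (_ *m _) _ _ in h1 *.
  by apply/andP; split; have := sqr_ge0 (t - 1); have := sqr_ge0 (t + 1); nra.
exists W => //; split => // i j.
(* h = W^-1 v inherits boundedness, so means commute with multiplication by W. *)
have bh : bounded_measurable_mx h.
  move=> k l; apply: bm_ext (bmxM (bmx_cst _ (invmx W)) bv k l) => x.
  by rewrite mulKmx.
have /matrixP/(_ i j) : mx_mean P (fun x => W *m gram_at h x *m W^T) = 1%:M.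
  rewrite mx_meanMr ?mx_meanMl//.
    by rewrite /gram_at; apply: bmxM bh (bmx_tr bh).
  by apply: bmxM (bmx_cst _ _) _; rewrite /gram_at; apply: bmxM bh (bmx_tr bh).
rewrite !mxE => <-; apply: eq_Rintegral => x _; rewrite /gram_at.
have -> : W *m (h x *m (h x)^T) *m W^T = (W *m h x) *m (W *m h x)^T.
  by rewrite trmx_mul !mulmxA.
by rewrite [RHS]mxE big_ord1 [_^T _ _]mxE.
Qed.

Section whitened.
Variable W : 'M[R]_d.
Hypotheses (uW : W \in unitmx) (iG : invmx (gram P h) = W^T *m W).
Variable v : T -> 'cV[R]_d.
Hypothesis vE : forall x, v x = W *m h x.
Hypotheses (bv : bounded_measurable_mx v) (vq : forall x, sqnorm (v x) = leverage P h x).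
Hypothesis iso : forall i j, \int[P]_x (v x i ord0 * v x j ord0) = (i == j)%:R.

Let mean_v (f : T -> R) := mx_mean P (fun x => f x *: v x).
Let dot (x y : 'cV[R]_d) := bil 1%:M x y.

Let bh : bounded_measurable_mx h.
Proof.
move=> k l; apply: bm_ext (bmxM (bmx_cst _ (invmx W)) bv k l) => x.
by rewrite vE mulKmx.
Qed.

Let bdot u : bounded_measurable (fun x => dot (v x) u).
Proof. by apply: bmx_bil => //; exact: bmx_cst. Qed.

Let linfeatE b x : linfeat h b x = dot (v x) ((invmx W)^T *m b).
Proof.
rewrite /linfeat /dot bil1 vE trmx_mul mulmxA -(mulmxA (h x)^T).
by rewrite -trmx_mul mulVmx// trmx1 mulmx1.
Qed.

Let residualE f x : bounded_measurable f ->
  residual P h f x = f x - dot (v x) (mean_v f).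
Proof.
move=> bf; rewrite /residual linfeatE /beta iG; congr (_ - dot _ _).
rewrite !mulmxA -trmx_mul mulmxV// trmx1 mul1mx -mx_meanMl; last exact: bmxZ.
by congr mx_mean; apply/funext => y; rewrite vE scalemxAr.
Qed.

Lemma bm_residual f : bounded_measurable f -> bounded_measurable (residual P h f).
Proof.
move=> bf; apply: bm_ext (bmB bf (bdot (mean_v f))) => x.
by rewrite residualE.
Qed.

Let E_dot f u : bounded_measurable f -> \int[P]_x (f x * dot (v x) u) = dot (mean_v f) u.
Proof.
move=> bf; rewrite /dot bil1 mxE.
transitivity (\int[P]_x \sum_i u i ord0 * (f x * v x i ord0)).
  apply: eq_Rintegral => x _; rewrite bil1 mxE mulr_sumr; apply: eq_bigr => i _.
  by rewrite mxE; ring.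
have b i : bounded_measurable (fun x => f x * v x i ord0) by exact: bmM.
rewrite E_sum; last by move=> i; exact: bmZ.
apply: eq_bigr => i _; rewrite EZ// mulrC !mxE; congr (_ * _).
by apply: eq_Rintegral => x _; rewrite mxE.
Qed.

Let E_dot2 u : \int[P]_x (dot (v x) u ^+ 2) = sqnorm u.
Proof.
have := E_moment bv iso (u *m u^T) 1.
rewrite expr1 mxtrace_mulC /mxtrace big_ord1 -/(sqnorm u) => <-.
apply: eq_Rintegral => x _; rewrite /moment expr1 bil_rank1 /dot bil1 expr2.
by congr (_ * _); rewrite -!bil1 (bil_sym _ _ (psd1 R d).1).
Qed.

Let E_sqr_sub f u : bounded_measurable f ->
  \int[P]_x ((f x - dot (v x) u) ^+ 2) =
  \int[P]_x (f x ^+ 2) - 2 * dot (mean_v f) u + sqnorm u.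
Proof.
move=> bf; have bfd := bmM bf (bdot u).
rewrite (_ : (fun x => _) = fun x => f x ^+ 2 - 2 * (f x * dot (v x) u) + dot (v x) u ^+ 2).
  rewrite ED ?E_dot2; [|by apply: bmB; [exact: bmX|exact: bmZ]|exact: bmX].
  by rewrite EB ?EZ ?E_dot//; [exact: bmX|exact: bmZ].
by apply/funext => x; ring.
Qed.

Let dotE u : dot u u = sqnorm u. Proof. by rewrite /dot bil1. Qed.

Let bessel f : bounded_measurable f -> sqnorm (mean_v f) <= \int[P]_x (f x ^+ 2).
Proof.
move=> bf; have := E_sqr_sub (mean_v f) bf; rewrite dotE.
have : 0 <= \int[P]_x ((f x - dot (v x) (mean_v f)) ^+ 2).
  by apply: E_ge0 => x; exact: sqr_ge0.
by move=> h0 e; move: h0; rewrite e; lra.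
Qed.

Lemma residual_orth f i : bounded_measurable f ->
  \int[P]_x (residual P h f x * v x i ord0) = 0.
Proof.
move=> bf; have dE x : v x i ord0 = dot (v x) (delta_mx i ord0).
  by rewrite /dot (bil_sym _ _ (psd1 R d).1) bil_delta mul1mx.
under eq_Rintegral => x _ do rewrite dE.
rewrite (E_dot _ (bm_residual bf)) (_ : mean_v _ = 0) /dot ?bil1 ?trmx0 ?mul0mx ?mxE//.
apply/matrixP => k l; rewrite !mxE (ord1 l).
transitivity (\int[P]_x (f x * v x k ord0 - \sum_j (mean_v f) j ord0 * (v x j ord0 * v x k ord0))).
  apply: eq_Rintegral => x _; rewrite mxE residualE// mulrBl; congr (_ - _).
  rewrite /dot bil1 mxE mulr_suml; apply: eq_bigr => j _; rewrite mxE; ring.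
have b j : bounded_measurable (fun x => v x j ord0 * v x k ord0) by exact: bmM.
rewrite EB; [|exact: bmM|by apply: bm_sum => j; exact: bmZ].
rewrite E_sum; last by move=> j; exact: bmZ.
rewrite (bigD1 k)//= EZ// iso eqxx mulr1 big1 ?addr0 => [|j jk].
  by rewrite mxE; apply/eqP; rewrite subr_eq0; apply/eqP/eq_Rintegral => x _; rewrite mxE.
by rewrite EZ// iso (negbTE jk) mulr0.
Qed.

(** Pythagoras in L^2(P): the residual is orthogonal to the coordinates of v, and these are
    orthonormal. *)
Lemma risk_excess f b : bounded_measurable f ->
  risk P h f b - risk P h f (beta P h f) = sqnorm ((invmx W)^T *m (b - beta P h f)).
Proof.
move=> bf; set u := _ *m _; have br := bm_residual bf.
have -> : risk P h f (beta P h f) = \int[P]_x (residual P h f x ^+ 2) by [].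
have -> : risk P h f b = \int[P]_x ((residual P h f x - dot (v x) u) ^+ 2).
  apply: eq_Rintegral => x _; rewrite -linfeatE /residual /linfeat mulmxBr.
  have subE (C D : 'M[R]_1) : (C - D) ord0 ord0 = C ord0 ord0 - D ord0 ord0 by rewrite !mxE.
  by rewrite subE; congr (_ ^+ 2); ring.
rewrite E_sqr_sub// (_ : mean_v _ = 0) ?[dot 0 u]bil1 ?trmx0 ?mul0mx ?mxE; first by ring.
apply/matrixP => k l; rewrite !mxE (ord1 l) -[RHS](residual_orth k bf).
by apply: eq_Rintegral => x _; rewrite mxE.
Qed.

(** The difference of residuals is f - g minus its projection. At x the projection is controlled by
    |v(x)|^2 <= B and Bessel's inequality, hence the L^2(P) distance on the right. *)
Lemma residual_sub_le f g x : bounded_measurable f -> bounded_measurable g ->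
  (residual P h f x - residual P h g x) ^+ 2 <=
  2 * (f x - g x) ^+ 2 + 2 * B * \int[P]_y ((f y - g y) ^+ 2).
Proof.
move=> bf bg; have bfg := bmB bf bg; rewrite !residualE//.
have mE : mean_v (fun x => f x - g x) = mean_v f - mean_v g.
  apply/matrixP => i j; rewrite !mxE -EB.
  - by apply: eq_Rintegral => y _; rewrite !mxE mulrBl.
  - by apply: bm_ext (bmM bf (bv i j)) => y; rewrite mxE.
  - by apply: bm_ext (bmM bg (bv i j)) => y; rewrite mxE.
have dE : dot (v x) (mean_v f) - dot (v x) (mean_v g) = dot (v x) (mean_v (fun x => f x - g x)).
  by rewrite mE /dot !bil1 mulmxBr [RHS]mxE [X in _ = _ + X]mxE.
have h1 : dot (v x) (mean_v (fun x => f x - g x)) ^+ 2 <= B * \int[P]_y ((f y - g y) ^+ 2).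
  apply: le_trans (sqnorm_CS _ _) _; apply: ler_pM; rewrite ?sqnorm_ge0 ?vq//.
  exact: bessel.
rewrite (_ : _ - _ = (f x - g x) - dot (v x) (mean_v (fun x => f x - g x))); last by rewrite -dE; ring.
move: h1; set t := dot _ _; set I := \int[P]_y _; set s := f x - g x => h1.
by have := sqr_ge0 (s + t); nra.
Qed.

Section ols.
Context (dO : measure_display) (Omega : measurableType dO)
  (pinv : forall m : nat, 'M[R]_m -> 'M[R]_m)
  (X : nat -> Omega -> T) (n : nat) (w : Omega).

(** The whitened normal equations read S u = P_n(v eps_f), and (|u|^2 / 8)^2 <= (u^T S u)^2 <= |u|^2
    |S u|^2 gives the factor 64. The lower bound on S also makes the sample Gram matrix invertible,
    so the pseudo-inverse branch does not occur. *)
Lemma ols_excess_le f : bounded_measurable f ->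
  (forall u, 8^-1 * sqnorm u <=
    bil (n%:R^-1 *: \sum_(i < n) v (X i w) *m (v (X i w))^T) u u) ->
  risk P h f (beta_ols pinv X n h f w) - risk P h f (beta P h f) <=
  64 * (n%:R^-1 ^+ 2 *
    sqnorm (\sum_(i < n) residual P h f (X i w) *: v (X i w))).
Proof.
move=> bf lower; rewrite risk_excess//.
set bh' := beta_ols _ _ _ _ _ _; set u := _ *m _.
set S := n%:R^-1 *: _ in lower; set z := \sum_(i < n) _.
have SE : S = W *m emp_gram X n h w *m W^T.
  rewrite /S /emp_gram /mx_emp_mean -scalemxAr -scalemxAl mulmx_sumr mulmx_suml.
  by congr (_ *: _); apply: eq_bigr => i _; rewrite /gram_at vE trmx_mul !mulmxA.
have uG : emp_gram X n h w \in unitmx.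
  (* A row r of the left kernel of S satisfies |r|^2 / 8 <= r S r^T = 0. *)
  have uS : S \in unitmx.
    rewrite -row_free_unit -kermx_eq0; apply/eqP/row_matrixP => k.
    rewrite row0; set r := row k _.
    have rS : r *m S = 0 by rewrite /r -row_mul mulmx_ker row0.
    have := lower r^T; rewrite /bil trmxK rS mul0mx mxE => h0.
    have {}h0 : sqnorm r^T = 0.
      by apply/eqP; rewrite eq_le sqnorm_ge0 andbT -(pmulr_rle0 _ (_ : 0 < 8^-1)).
    apply/matrixP => a b; rewrite (ord1 a) [RHS]mxE.
    have : r^T b ord0 ^+ 2 <= 0.
      rewrite -h0 sqnormE (bigD1 b)//= lerDl; apply: sumr_ge0 => c _; exact: sqr_ge0.
    by rewrite le_eqVlt ltNge sqr_ge0 orbF sqrf_eq0 mxE => /eqP.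
  by move: uS; rewrite SE !unitmx_mul unitmx_tr uW/= andbT.
have bE : emp_gram X n h w *m (bh' - beta P h f) =
    n%:R^-1 *: \sum_(i < n) residual P h f (X i w) *: h (X i w).
  rewrite mulmxBr /bh' /beta_ols uG mulKVmx// /emp_gram /mx_emp_mean.
  rewrite -scalemxAl -scalerBr; congr (_ *: _); rewrite mulmx_suml -sumrB.
  apply: eq_bigr => i _; rewrite /gram_at /residual scalerBl; congr (_ - _).
  by rewrite -mulmxA [(h _)^T *m _]mx11_scalar mul_mx_scalar.
have Su : S *m u = n%:R^-1 *: z.
  rewrite SE /u !mulmxA -(mulmxA _ W^T) -trmx_mul mulVmx// trmx1 mulmx1.
  rewrite -mulmxA bE -scalemxAr mulmx_sumr; congr (_ *: _); apply: eq_bigr => i _.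
  by rewrite -scalemxAr vE.
have := lower u; have CS := sqnorm_CS u (S *m u).
have e : bil S u u = dot u (S *m u) by rewrite /dot bil1 /bil (mulmxA u^T S u).
rewrite e -sqnormZ -Su; move: CS; rewrite -/(dot u (S *m u)).
set t := dot _ _; set s := sqnorm (S *m u) => CS lo.
have u0 := sqnorm_ge0 u; move: u0; rewrite le_eqVlt => /predU1P[<-|up].
  by rewrite mulr_ge0// sqnorm_ge0.
have t0 : 0 <= t by apply: le_trans lo; rewrite mulr_ge0// ltW.
have h2 : (8^-1 * sqnorm u) ^+ 2 <= t ^+ 2.
  by have lo' := lo; apply: lerXn2r lo'; rewrite nnegrE// mulr_ge0// ltW.
have h3 : sqnorm u * sqnorm u <= sqnorm u * (64 * s) by move: h2 CS; lra.
by move: h3; rewrite ler_pM2l.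
Qed.
End ols.
End whitened.
End regression.

(** * Tail of the excess risk *)

Section measurable_ols.
Context (R : realType) (d0 : measure_display) (S : measurableType d0).

Definition measurable_mx m n (F : S -> 'M[R]_(m, n)) : Prop :=
  forall i j, measurable_fun setT (fun s => F s i j).

Lemma measurable_mulmx m n k (F : S -> 'M[R]_(m, n)) (G : S -> 'M[R]_(n, k)) :
  measurable_mx F -> measurable_mx G -> measurable_mx (fun s => F s *m G s).
Proof.
move=> mF mG i j; rewrite (_ : (fun s => _) = fun s => \sum_l F s i l * G s l j).
  by apply: measurable_sum => l; exact: measurable_funM.
by apply/funext => s; rewrite mxE.
Qed.

Lemma measurable_scalemx m n (f : S -> R) (F : S -> 'M[R]_(m, n)) :
  measurable_fun setT f -> measurable_mx F -> measurable_mx (fun s => f s *: F s).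
Proof.
move=> mf mF i j; rewrite (_ : (fun s => _) = fun s => f s * F s i j).
  exact: measurable_funM.
by apply/funext => s; rewrite mxE.
Qed.

Lemma measurable_summx (I : Type) (r : seq I) m n (F : I -> S -> 'M[R]_(m, n)) :
  (forall i, measurable_mx (F i)) -> measurable_mx (fun s => \sum_(i <- r) F i s).
Proof.
move=> mF i j; rewrite (_ : (fun s => _) = fun s => \sum_(l <- r) F l s i j).
  by apply: measurable_sum => l; exact: mF.
by apply/funext => s; rewrite summxE.
Qed.

Lemma measurable_det n (F : S -> 'M[R]_n) :
  measurable_mx F -> measurable_fun setT (fun s => \det (F s)).
Proof.
move=> mF; apply: measurable_sum => p; apply: measurable_funM => //.
by apply: measurable_prod => i _; exact: mF.
Qed.

(** The adjugate formula is a measurable expression in the entries, and invertibility is the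
    measurable condition det != 0. *)
Lemma measurable_invmx n (F G : S -> 'M[R]_n) : measurable_mx F -> measurable_mx G ->
  measurable_mx (fun s => if F s \in unitmx then invmx (F s) else G s).
Proof.
move=> mF mG; have mdet := measurable_det mF.
have madj : measurable_mx (fun s => (\det (F s))^-1 *: \adj (F s)).
  apply: measurable_scalemx; first by apply: measurableT_comp mdet; exact: measurable_inv.
  move=> i j; rewrite (_ : (fun s => _) = fun s => cofactor (F s) j i); last first.
    by apply/funext => s; rewrite mxE.
  apply: measurable_funM => //; apply: measurable_det => a b.
  by rewrite (_ : (fun s => _) = fun s => F s (lift j a) (lift i b)) //;
    apply/funext => s; rewrite !mxE.
move=> i j; rewrite (_ : (fun s => _) = fun s =>
    if \det (F s) == 0 then G s i j else ((\det (F s))^-1 *: \adj (F s)) i j).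
  by apply: measurable_fun_ifT => //; exact: measurable_fun_eqr.
apply/funext => s; rewrite [_ \in unitmx]unitfE; case: eqP => //= d0'.
by rewrite /invmx unitmxE unitfE; case: eqP.
Qed.

Lemma measurable_sqnorm n (F : S -> 'cV[R]_n) :
  measurable_mx F -> measurable_fun setT (fun s => sqnorm (F s)).
Proof.
move=> mF; rewrite (_ : (fun s => _) = fun s => \sum_i F s i ord0 ^+ 2).
  by apply: measurable_sum => i; exact: measurable_funX.
by apply/funext => s; exact: sqnormE.
Qed.
End measurable_ols.

Lemma countable_range (U : Type) (F : set U) : countable F -> F !=set0 ->
  exists f : nat -> U, F = range f.
Proof.
move=> cF [u0 Fu0]; have /pfcard_geP[F0|[g]] := cF.
  by rewrite F0 in Fu0.
pose f k := if pselect (F (g k)) is left _ then g k else u0.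
exists f; apply/seteqP; split => [u Fu|_ [k _ <-]].
  have [k _ gk] := @surj _ _ _ _ g u Fu; exists k => //.
  by rewrite /f; case: pselect => //=; rewrite gk.
by rewrite /f; case: pselect.
Qed.

Lemma measure_bigcup_le (R : realType) (d : measure_display) (T : measurableType d)
    (P : probability T R) (F : nat -> set T) (b : \bar R) :
  (forall k, measurable (F k)) -> (forall k l, (k <= l)%N -> F k `<=` F l) ->
  (forall k, (P (F k) <= b)%E) -> (P (\bigcup_k F k) <= b)%E.
Proof.
move=> mF ndF Fb.
have cF : P \o F @ \oo --> P (\bigcup_k F k).
  apply: nondecreasing_cvg_mu => //; first exact: bigcupT_measurable.
  by move=> k l kl; apply/subsetPset; exact: ndF.
rewrite -(cvg_lim _ cF)//; apply: lime_le; first by apply/cvg_ex; exists (P (\bigcup_k F k)).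
by apply: nearW => k /=.
Qed.

Section deviation.
Context (R : realType) (dX dO : measure_display) (T : measurableType dX)
  (Omega : measurableType dO) (P : probability T R) (Pr : probability Omega R)
  (X : nat -> {RV Pr >-> T}).
Context (F : set (T -> R)) (f_ : nat -> T -> R).
Hypotheses (FE : F = range f_) (bf : forall k, bounded_measurable (f_ k)).
Context (d : nat) (h : T -> 'cV[R]_d) (fh : feature_map P h).
Variable pinv : forall m : nat, 'M[R]_m -> 'M[R]_m.
Context (n : nat) (n0 : (0 < n)%N).
Hypothesis mpinv : forall i j,
  measurable_fun [set: Omega] (fun w => pinv (emp_gram X n h w) i j).

Let mh i : measurable_fun setT (fun x => h x i ord0).
Proof. by have [_ hL _] := fh; exact: (set_mem (sub_Lfun_mfun (hL i))). Qed.

Let mhX i : measurable_mx (fun w => h (X i w)).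
Proof. by move=> a b; rewrite (ord1 b); exact: measurableT_comp (mh a) _. Qed.

Lemma measurable_beta_ols k :
  measurable_mx (fun w => beta_ols pinv X n h (f_ k) w).
Proof.
have [mf _] := bf k.
apply: measurable_mulmx; last first.
  apply: (measurable_scalemx (f := fun=> n%:R^-1)) => //.
  apply: measurable_summx => i; apply: measurable_scalemx => //.
  by apply: measurableT_comp mf _; exact: measurable_funP.
apply: measurable_invmx => //.
apply: (measurable_scalemx (f := fun=> n%:R^-1)) => //.
apply: measurable_summx => i; apply: measurable_mulmx => // a b.
rewrite (_ : (fun s => _) = fun s => h (X i s) b a); first exact: mhX.
by apply/funext => w; rewrite mxE.
Qed.

Variables (W : 'M[R]_d) (v : T -> 'cV[R]_d).
Hypotheses (uW : W \in unitmx) (iG : invmx (gram P h) = W^T *m W).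
Hypothesis vE : forall x, v x = W *m h x.
Hypotheses (bv : bounded_measurable_mx v).
Hypothesis iso : forall i j, \int[P]_x (v x i ord0 * v x j ord0) = (i == j)%:R.

Let excess k w := risk P h (f_ k) (beta_ols pinv X n h (f_ k) w)
  - risk P h (f_ k) (beta P h (f_ k)).

Let excessE k w : excess k w =
  sqnorm ((invmx W)^T *m (beta_ols pinv X n h (f_ k) w - beta P h (f_ k))).
Proof. exact: (risk_excess uW iG vE bv iso). Qed.

Let excess_ge0 k w : 0 <= excess k w.
Proof. by rewrite excessE; exact: sqnorm_ge0. Qed.

Let measurable_excess k : measurable_fun setT (excess k).
Proof.
rewrite (_ : excess k = fun w => excess k w)// (funext (excessE k)).
apply: measurable_sqnorm; apply: measurable_mulmx => [i j|i j] //.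
rewrite (_ : (fun s => _) = fun s => beta_ols pinv X n h (f_ k) s i j + (- beta P h (f_ k)) i j).
  by apply: measurable_funD => //; exact: measurable_beta_ols.
by apply/funext => w; rewrite mxE.
Qed.

(** Outside E, a large excess risk of some f_k forces a large maximum over the first k+1 functions.
    These events increase with the number of functions, and b does not depend on it, so Markov's
    bound survives the union. *)
Lemma excess_deviation (b c : R) (E : set Omega) : 0 < c -> measurable E ->
  (forall w, ~ E w -> forall u, 8^-1 * sqnorm u <=
    bil (n%:R^-1 *: \sum_(i < n) v (X i w) *m (v (X i w))^T) u u) ->
  (forall m, \int[Pr]_w max_sqnorm (\sum_(i < n)
     \matrix_(i' < d, j < m) (residual P h (f_ j) (X i w) * v (X i w) i' ord0)) <= b) ->
  (Pr [set w | c%:E < `|sup_excess_risk P F pinv X n h w|]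
    <= Pr E + (64 * n%:R^-1 ^+ 2 * b / c)%:E)%E.
Proof.
move=> c0 mE low Eb.
have YE w : (`|sup_excess_risk P F pinv X n h w| = ereal_sup (range (fun k => (excess k w)%:E)))%E.
  have -> : sup_excess_risk P F pinv X n h w = ereal_sup (range (fun k => (excess k w)%:E)).
    rewrite /sup_excess_risk FE; congr ereal_sup; apply/seteqP; split => [_ [_ [k _ <-] <-]|_ [k _ <-]].
      by exists k.
    by exists (f_ k) => //; exists k.
  rewrite gee0_abs//; apply: le_trans (_ : ((excess 0%N w)%:E <= _)%E); first by rewrite lee_fin.
  by apply: ereal_sup_ubound; exists 0%N.
have setE : [set w | c%:E < `|sup_excess_risk P F pinv X n h w|]%E =
    \bigcup_k [set w | c < excess k w].
  apply/seteqP; split => w /=; rewrite ?YE.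
    by move=> /ereal_sup_gt[_ [k _ <-]]; rewrite lte_fin => hk; exists k.
  move=> [k _ hk]; apply: lt_le_trans (_ : (c%:E < (excess k w)%:E)%E) _; first by rewrite lte_fin.
  by apply: ereal_sup_ubound; exists k.
have msup : measurable [set w | c%:E < `|sup_excess_risk P F pinv X n h w|]%E.
  rewrite setE; apply: bigcupT_measurable => k.
  rewrite -[X in measurable X]setTI; have := measurable_excess k measurableT (measurable_itv `]c, +oo[).
  by congr measurable; apply/seteqP; split => x [_ /=]; rewrite in_itv/= andbT.
have br k := bm_residual uW iG vE bv (bf k).
pose Z m w := max_sqnorm (\sum_(i < n)
   \matrix_(i' < d, j < m) (residual P h (f_ j) (X i w) * v (X i w) i' ord0)).
have bZ m : bounded_measurable (Z m).
  apply: bm_max_sqnorm; apply: bmx_sum => i a j.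
  have mX : measurable_fun setT (X i) by exact: measurable_funP.
  by apply: bm_ext (bmM (bm_comp mX (br j)) (bm_comp mX (bv a ord0))) => w; rewrite mxE.
have nR : 0 < n%:R :> R by rewrite ltr0n.
(* The level at which the bound 64 n^-2 |z|^2 of [ols_excess_le] reaches c. *)
pose t := c * n%:R ^+ 2 / 64.
have t0 : 0 < t by rewrite divr_gt0// mulr_gt0// exprn_gt0.
pose A m := [set w | t <= Z m w].
have mA m : measurable (A m).
  rewrite -[X in measurable X]setTI; have := (bZ m).1 measurableT _ (measurable_itv `[t, +oo[).
  by congr measurable; apply/seteqP; split => x [_ /=]; rewrite in_itv/= andbT.
have colZ m (j : 'I_m) w : col j (\sum_(i < n)
    \matrix_(i' < d, j < m) (residual P h (f_ j) (X i w) * v (X i w) i' ord0)) =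
    \sum_(i < n) residual P h (f_ j) (X i w) *: v (X i w).
  apply/matrixP => a b'; rewrite (ord1 b') mxE !summxE; apply: eq_bigr => i _.
  by rewrite !mxE.
have ndA m l : (m <= l)%N -> A m `<=` A l.
  move=> ml w /= tZ; apply: le_trans tZ _; apply: max_sqnorm_le; first exact: max_sqnorm_ge0.
  move=> j; apply: le_trans (sqnorm_le_max _ (widen_ord ml j)).
  by rewrite !colZ.
have PA m : (Pr (A m) <= (64 * n%:R^-1 ^+ 2 * b / c)%:E)%E.
  apply: le_trans (E_markov (bZ m) _ t0 (Eb m)) _ => [w|]; first exact: max_sqnorm_ge0.
  rewrite lee_fin le_eqVlt; apply/orP; left; apply/eqP; rewrite /t; field.
  by rewrite !gt_eqF.
have mUA : measurable (\bigcup_m A m) by exact: bigcupT_measurable.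
apply: (@le_trans _ _ (Pr (E `|` \bigcup_m A m))).
  apply: le_measure; rewrite ?inE//; first exact: measurableU.
  rewrite setE => w [k _ /= hk]; have [Ew|nEw] := pselect (E w); [by left|right].
  (* f_k is the last column of the matrix built from the first k+1 functions. *)
  exists k.+1 => //=; have := @ols_excess_le _ _ _ _ _ _ _ uW iG _ vE bv iso _ _ pinv
    (fun i => X i) n w _ (bf k) (low w nEw).
  rewrite -/(excess k w) => h1.
  apply: le_trans (sqnorm_le_max _ (ord_max : 'I_k.+1)); rewrite colZ /=.
  set z := sqnorm _ in h1 *.
  have h2 : c < 64 * (n%:R^-1 ^+ 2 * z) by exact: lt_le_trans h1.
  rewrite /t ler_pdivrMr// -ler_pdivlMr ?exprn_gt0//.
  by apply: le_trans (ltW h2) _; rewrite exprVn; lra.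
apply: le_trans (measureU2 _ _ _) _ => //.
by apply: leeD => //; exact: measure_bigcup_le.
Qed.
End deviation.

(** The factor obtained in [E_max_weighted_residuals]. *)
Definition chaining_const (R : realType) : R := 16 * expR 10 * (17 + 8 * expR 10) + 1.

Section tail_bound.
Context (R : realType) (dX dO : measure_display) (T : measurableType dX)
  (Omega : measurableType dO) (P : probability T R) (Pr : probability Omega R)
  (X : nat -> {RV Pr >-> T}).
Hypothesis hX : iid P X.
Context (F : set (T -> R)) (f_ : nat -> T -> R) (Fenv : T -> R) (vc A U : R).
Hypotheses (FE : F = range f_) (bf : forall k, bounded_measurable (f_ k)).
Hypotheses (F_VC : VC_class F Fenv vc A) (FU : forall x, 0 <= Fenv x <= U) (U0 : 0 <= U).
Context (d : nat) (h : T -> 'cV[R]_d) (fh : feature_map P h).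
Variable pinv : forall m : nat, 'M[R]_m -> 'M[R]_m.
Context (n : nat) (n0 : (0 < n)%N).
Hypothesis mpinv : forall i j,
  measurable_fun [set: Omega] (fun w => pinv (emp_gram X n h w) i j).
Context (B M g2 : R).
Hypotheses (qB : forall x, leverage P h x <= B) (B1 : 1 <= B).
Hypotheses (resM : forall k x, `|residual P h (f_ k) x| <= M) (M0 : 0 < M).
Hypotheses (resg : forall k, \int[P]_x (leverage P h x * residual P h (f_ k) x ^+ 2) <= g2)
  (g20 : 0 <= g2).
Context (p : nat) (s eta : R).
Hypotheses (p0 : (0 < p)%N) (s0 : 0 < s) (s1 : s <= 1) (sp : s ^+ 2 * n%:R = p%:R).
Hypotheses (eta01 : 0 < eta < 1) (cover : ((A / eta) `^ vc + 1) ^+ 2 <= expR p%:R).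
Hypothesis fine_net : 128 * B * (eta * U) ^+ 2 <= s ^+ 3 * M ^+ 2.

(** The alternative selects [gram_second_moment] or [gram_lower_tail] for the event of probability
    at most e1; the other term is Markov's inequality at level c. *)
Lemma excess_tail (e1 c : R) : 0 < c ->
  (4 * (\int[P]_x leverage P h x ^+ 2) / n%:R <= e1 \/
   exists p' : nat, [/\ (0 < p')%N, 16 * p'%:R * B <= n%:R & d%:R / 2 ^+ p' <= e1]) ->
  (Pr [set w | c%:E < `|sup_excess_risk P F pinv X n h w|] <=
   (e1 + 64 * n%:R^-1 ^+ 2 *
     (chaining_const R * (p%:R * n%:R * (g2 + (M ^+ 2 * B) * s))) / c)%:E)%E.
Proof.
move=> c0 lower.
have B0 : 0 < B by exact: lt_le_trans B1.
have [W uW [iG bv vq iso]] := whitened_features fh qB.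
set v := fun x => W *m h x in bv vq iso.
have vE x : v x = W *m h x by [].
have [E [mE PE low]] : exists E : set Omega, [/\ measurable E, (Pr E <= e1%:E)%E &
    forall w, ~ E w -> forall u, 8^-1 * sqnorm u <=
      bil (n%:R^-1 *: \sum_(i < n) v (X i w) *m (v (X i w))^T) u u].
  case: lower => [qe|[p' [p'0 p'B p'd]]].
    have [E [mE PE low]] := gram_second_moment hX bv iso n0.
    exists E; split => //; apply: le_trans PE _; rewrite lee_fin; apply: le_trans qe.
    by under eq_Rintegral do rewrite vq.
  have vB x : sqnorm (v x) <= B by rewrite vq.
  have [E [mE PE low]] := gram_lower_tail hX bv iso B1 vB p'0 n0 p'B.
  by exists E; split => //; apply: le_trans PE _; rewrite lee_fin.
apply: le_trans (excess_deviation FE bf fh n0 mpinv uW iG vE bv iso c0 mE low _) _; last first.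
  by rewrite EFinD; apply: leeD => //; exact: lexx.
(* Cells have squared diameter 4 (eta U)^2, so [residual_sub_le] gives 8 (1 + B) (eta U)^2, at most
   delta because B >= 1. Then 8 delta is the left side of [fine_net]. *)
move=> m; pose delta := 16 * B * (eta * U) ^+ 2.
have d0 : 0 <= delta by apply: mulr_ge0; [apply: mulr_ge0 => //; exact: ltW|exact: sqr_ge0].
apply: (@E_max_weighted_residuals _ _ _ _ _ _ _ _ hX d m n p v
  (fun j : 'I_m => residual P h (f_ j)) B M g2 delta s) => //.
- by move=> j; exact: (bm_residual uW iG vE bv (bf j)).
- by move=> x; rewrite vq.
- by move=> i j; exact: (residual_orth uW iG vE bv iso i (bf j)).
- move=> j; apply: le_trans (resg j); rewrite le_eqVlt; apply/orP; left; apply/eqP.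
  by apply: eq_Rintegral => x _; rewrite vq.
- move=> w; have [||r [rN rD]] := VC_representatives P (f := fun j : 'I_m => f_ j) (X^~ w) n0 F_VC FU U0 eta01.
  + by move=> j; rewrite FE; exists j.
  + by move=> j; exact: bf.
  exists r; split; first exact: le_trans cover.
  move=> j; have [r1 r2] := rD j; set z := 4 * _ in r1 r2.
  apply: (@le_trans _ _ (\sum_(i < n) (2 * (f_ j (X i w) - f_ (r j) (X i w)) ^+ 2 +
      2 * B * \int[P]_y ((f_ j y - f_ (r j) y) ^+ 2)))).
    by apply: ler_sum => i _; exact: (residual_sub_le qB uW iG vE bv vq iso (X i w) (bf j) (bf (r j))).
  rewrite big_split/= -mulr_sumr sumr_const card_ord -[_ *+ n]mulr_natl.
  have nR : 0 <= n%:R :> R by [].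
  have h1 : n%:R * (2 * B * \int[P]_y ((f_ j y - f_ (r j) y) ^+ 2)) <= n%:R * (2 * B * z).
    by apply: ler_wpM2l => //; apply: ler_wpM2l => //; rewrite mulr_ge0// ltW.
  have z0 : 0 <= z by apply: mulr_ge0 => //; exact: sqr_ge0.
  have h2 : n%:R * z <= n%:R * (B * z) by apply: ler_wpM2l => //; rewrite ler_peMl.
  rewrite (_ : delta = 4 * (B * z)); last by rewrite /delta /z; ring.
  by lra.
- by apply: le_trans fine_net; rewrite le_eqVlt /delta; apply/orP; left; apply/eqP; ring.
Qed.
End tail_bound.

Lemma ereal_sup_EFin (R : realType) (I : Type) (D : set I) (u : I -> R) (b : R) :
  D !=set0 -> (forall i, D i -> u i <= b) ->
  exists2 s : R, ereal_sup [set (u i)%:E | i in D] = s%:E & forall i, D i -> u i <= s.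
Proof.
move=> [i0 Di0] ub; set S := ereal_sup _.
have S_ge i : D i -> ((u i)%:E <= S)%E by move=> Di; apply: ereal_sup_ubound; exists i.
have Sb : (S <= b%:E)%E by apply: ge_ereal_sup => _ [i Di <-]; rewrite lee_fin; exact: ub.
have Sfin : S \is a fin_num.
  rewrite fin_numE; apply/andP; split; apply/eqP => SE.
    by have := S_ge _ Di0; rewrite SE leeNy_eq.
  by move: Sb; rewrite SE leye_eq.
exists (fine S); first by rewrite fineK.
by move=> i Di; rewrite -lee_fin fineK//; exact: S_ge.
Qed.

(** * Finiteness of the suprema *)

Section suprema.
Context (R : realType) (dX : measure_display) (T : measurableType dX)
  (P : probability T R).
Context (F : set (T -> R)) (U : R) (F0 : F !=set0).
Hypotheses (bF : forall f, F f -> bounded_measurable f)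
  (FU : forall f, F f -> forall x, `|f x| <= U).
Context (d : nat) (h : T -> 'cV[R]_d) (fh : feature_map P h).
Hypothesis q_fin : (supnorm (leverage P h) < +oo)%E.

Let pt : T.
Proof.
have /set0P/cid[x _] // : [set: T] != set0.
by apply/eqP => T0; have := @probability_setT _ _ _ P; rewrite T0 measure0 => -[/eqP]; rewrite eq_sym oner_eq0.
Qed.

Lemma leverage_supnorm : exists B : R,
  [/\ supnorm (leverage P h) = B%:E, 1 <= B & forall x, leverage P h x <= B].
Proof.
have [||B BE Bq] := @ereal_sup_EFin R T setT (fun x => `|leverage P h x|) (fine (supnorm (leverage P h))).
- by exists pt.
- move=> x _; rewrite -lee_fin fineK; first by apply: ereal_sup_ubound; exists x.
  rewrite fin_real// q_fin andbT (@lt_le_trans _ _ (`|leverage P h pt|%:E))%E ?ltNyr//.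
  by apply: ereal_sup_ubound; exists pt.
have qB x : leverage P h x <= B by apply: le_trans (Bq x _); rewrite ?ler_norm.
exists B; split => //.
have [W uW [iG bv vq iso]] := whitened_features fh qB.
(* The mean of the leverage is d >= 1, so its supremum is at least 1. *)
have [d0 _ _] := fh; apply: (@le_trans _ _ d%:R); first by rewrite ler1n.
rewrite -(E_sqnorm bv iso) -(E_cst P B); apply: E_le.
- exact: bmx_sqnorm.
- exact: bm_cst.
- by move=> x; rewrite vq.
Qed.

Lemma sup_residual_gamma_sq : exists M g2 : R,
  [/\ sup_residual P F h = M%:E, gamma_sq P F h = g2%:E,
      0 <= M /\ (forall f, F f -> forall x, `|residual P h f x| <= M) &
      0 <= g2 /\ (forall f, F f -> \int[P]_x (leverage P h x * residual P h f x ^+ 2) <= g2)].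
Proof.
have [B [_ B1 qB]] := leverage_supnorm.
have [W uW [iG bv vq iso]] := whitened_features fh qB.
have B0 : 0 <= B by exact: le_trans B1.
have U0 : 0 <= U by have [f Ff] := F0; exact: le_trans (FU Ff pt).
have q0 x : 0 <= leverage P h x by rewrite -vq sqnorm_ge0.
have bq : bounded_measurable (leverage P h) by exact: bm_ext vq (bmx_sqnorm bv).
(* All residuals are compared with that of the zero function; 2 |t| <= 1 + t^2 turns the quadratic
   comparison into a bound uniform over F. *)
pose z : T -> R := fun _ => 0.
have bz : bounded_measurable z := bm_cst T 0.
have br f : bounded_measurable f -> bounded_measurable (residual P h f).
  by move=> bf; exact: (bm_residual uW iG (fun=> erefl) bv bf).
have [_ [C zC]] := br _ bz.
have f2 f x : F f -> f x ^+ 2 <= U ^+ 2.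
  by move=> Ff; rewrite -(real_normK (num_real _)) ler_pXn2r ?nnegrE//; exact: FU.
have resC f x : F f -> `|residual P h f x| <= C + 1 + (2 * U ^+ 2 + 2 * B * U ^+ 2).
  move=> Ff; have bf := bF Ff.
  have := residual_sub_le qB uW iG (fun=> erefl) bv vq iso x bf bz.
  rewrite /z subr0; under eq_Rintegral do rewrite subr0.
  have : \int[P]_y f y ^+ 2 <= U ^+ 2.
    rewrite -(E_cst P (U ^+ 2)); apply: E_le => [||y]; [exact: bmX|exact: bm_cst|exact: f2].
  have := zC x; rewrite -/z; have := f2 _ x Ff.
  set a := residual P h f x; set b := residual P h _ x; set I := \int[P]_y _; set V := U ^+ 2.
  move=> h1; rewrite !ler_norml => /andP[h2 h3] h4 h5.
  have h6 : B * I <= B * V by exact: ler_wpM2l.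
  have := sqr_ge0 (a - b - 1); have := sqr_ge0 (a - b + 1).
  by move=> h7 h8; apply/andP; split; lra.
set b := C + 1 + _ in resC.
have b0 : 0 <= b by have [f Ff] := F0; exact: le_trans (resC _ pt Ff).
have sn f : F f -> exists2 s : R, supnorm (residual P h f) = s%:E & forall x, `|residual P h f x| <= s.
  move=> Ff; have [||s sE sP] := @ereal_sup_EFin R T setT (fun x => `|residual P h f x|) b.
  - by exists pt.
  - by move=> x _; exact: resC.
  by exists s => // x; exact: sP.
have snE f : F f -> supnorm (residual P h f) = (fine (supnorm (residual P h f)))%:E.
  by move=> /sn[s ->].
have [|M ME MP] := @ereal_sup_EFin R _ F (fun f => fine (supnorm (residual P h f))) b F0.
  move=> f Ff; have [s sE _] := sn f Ff; rewrite sE /= -lee_fin -sE.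
  by apply: ge_ereal_sup => _ [x _ <-]; rewrite lee_fin; exact: resC.
have resM f x : F f -> `|residual P h f x| <= M.
  by move=> Ff; have [s sE sP] := sn f Ff; have := MP f Ff; rewrite sE/=; exact: le_trans.
have M0 : 0 <= M by have [f Ff] := F0; exact: le_trans (resM f pt Ff).
have bi f : F f -> bounded_measurable (fun x => leverage P h x * residual P h f x ^+ 2).
  by move=> Ff; apply: bmM => //; apply: bmX; apply: br; exact: bF.
have [|g2 gE gP] := @ereal_sup_EFin R _ F
    (fun f => \int[P]_x (leverage P h x * residual P h f x ^+ 2)) (B * M ^+ 2) F0.
  move=> f Ff; rewrite -(E_cst P (B * M ^+ 2)); apply: E_le => [||x]; [exact: bi|exact: bm_cst|].
  apply: ler_pM => //; first exact: sqr_ge0.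
  by rewrite -(real_normK (num_real _)) ler_pXn2r ?nnegrE//; exact: resM.
exists M, g2; split.
- rewrite -ME; congr ereal_sup; apply/seteqP; split => _ [f Ff <-]; exists f => //.
    by rewrite -snE.
  by rewrite snE.
- rewrite -gE; congr ereal_sup; apply/seteqP; split => _ [f Ff <-]; exists f => //.
    by rewrite E_EFin//; exact: bi.
  by rewrite E_EFin//; exact: bi.
- by split => // f Ff x; exact: resM.
- split => //; have [f Ff] := F0; apply: le_trans (gP f Ff).
  by apply: E_ge0 => x; rewrite mulr_ge0// sqr_ge0.
Qed.
End suprema.

(** * Asymptotics *)

Lemma ln_le_sqrt (R : realType) (x : R) : 0 < x -> ln x <= 2 * Num.sqrt x.
Proof.
move=> x0; have s0 : 0 < Num.sqrt x by rewrite sqrtr_gt0.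
rewrite -{1}(sqr_sqrtr (ltW x0)) lnXn// -[_ *+ 2]mulr_natl ler_pM2l//.
have := expR_ge1Dx (ln (Num.sqrt x)); rewrite lnK ?posrE//; lra.
Qed.

(** With y = v (ln A + k ln x) the left side is (exp y + 1)^2 <= exp(2 (y + 1)), and ln x >= 1
    absorbs the constants into the multiple of ln x. *)
Lemma covering_exponent (R : realType) (v A x c : R) (k : nat) :
  0 < v -> 1 <= A -> 1 <= ln x -> 0 < x -> 2 * v * ln A + 2 * v * k%:R + 2 <= c ->
  ((A / x ^- k) `^ v + 1) ^+ 2 <= expR (c * ln x).
Proof.
move=> v0 A1 l1 x0 hc; have A0 : 0 < A by exact: lt_le_trans A1.
have Ax0 : 0 < A / x ^- k by rewrite invrK mulr_gt0// exprn_gt0.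
have xk0 : 0 < x ^+ k by rewrite exprn_gt0.
have lA : 0 <= ln A by rewrite ln_ge0.
have yE : (A / x ^- k) `^ v = expR (v * (ln A + k%:R * ln x)).
  rewrite -[LHS]lnK ?posrE ?powR_gt0// ln_powR invrK lnM ?posrE// lnXn//.
  by rewrite -[_ *+ k]mulr_natl.
have kl : 0 <= k%:R * ln x by rewrite mulr_ge0// (le_trans _ l1).
rewrite yE; set y := v * _; have y0 : 0 <= y by rewrite mulr_ge0 ?addr_ge0// ltW.
have h1 : expR y + 1 <= expR (y + 1).
  have ey1 : 1 <= expR y by rewrite -expR0 ler_expR.
  have e2 := expR_ge1Dx (1 : R); rewrite expRD.
  have : expR y * (1 + 1) <= expR y * expR 1 by rewrite ler_pM2l// expR_gt0.
  by lra.
apply: le_trans (_ : _ <= expR (y + 1) ^+ 2) _.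
  by rewrite ler_pXn2r// nnegrE ?addr_ge0// ?expR_ge0.
rewrite -expRM_natl ler_expR.
apply: le_trans (_ : (2 * v * ln A + 2 * v * k%:R + 2) * ln x <= _); last first.
  by rewrite ler_wpM2r// (le_trans _ l1).
have vl0 : 0 <= v * ln A by rewrite mulr_ge0// ltW.
have : v * ln A <= v * ln A * ln x by rewrite ler_peMr.
rewrite /y; lra.
Qed.

Lemma scale_choice (R : realType) (v A U : R) (a k : nat) : 0 < v -> 1 <= A ->
  exists2 c : R, 0 < c & exists x0 : R, forall n (B M : R), x0 <= n%:R ->
    1 <= B -> B <= n%:R ^+ k -> n%:R ^- a <= M ->
    exists p : nat, exists s : R, exists eta : R,
      [/\ (0 < p)%N, 0 < s, s <= 1, s ^+ 2 * n%:R = p%:R & 0 < eta < 1] /\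
      [/\ ((A / eta) `^ v + 1) ^+ 2 <= expR p%:R,
          128 * B * (eta * U) ^+ 2 <= s ^+ 3 * M ^+ 2 & p%:R <= c * ln n%:R].
Proof.
(* The radius is n^-K. As s^3 >= s^4 = (p/n)^2 >= n^-2, it suffices that 128 U^2 n^k n^(-2K) <=
   n^(-2-2a); this K reduces it to 128 U^2 n^k <= n^(2k+2). *)
move=> v0 A1; pose K := (k + a + 2)%N.
have lA : 0 <= ln A by rewrite ln_ge0.
pose c2 := 2 * v * ln A + 2 * v * K%:R + 2.
have c20 : 0 < c2.
  by rewrite ltr_wpDl//; apply: addr_ge0; apply: mulr_ge0 => //; apply: mulr_ge0 => //; exact: ltW.
pose c := c2 + 1; have c0 : 0 < c by rewrite addr_gt0.
(* The three terms ensure ln n >= 1, the absorption of 128 U^2 by one factor n, and 2 c <= sqrt n.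
   The last one gives c ln n <= n, hence s <= 1. *)
exists c => //; exists (expR 1 + 128 * U ^+ 2 + 4 * c ^+ 2) => n B M hx B1 Bk Ma.
have e1 : 0 < expR 1 :> R := expR_gt0 1.
have U2 : 0 <= U ^+ 2 := sqr_ge0 U.
have c22 : 0 <= c ^+ 2 := sqr_ge0 c.
have xe : expR 1 <= n%:R :> R by lra.
have xU : 128 * U ^+ 2 <= n%:R :> R by lra.
have xc : 4 * c ^+ 2 <= n%:R :> R by lra.
clear hx; have x0 : 0 < n%:R :> R by exact: lt_le_trans xe.
have x1 : 1 < n%:R :> R by have := expR_ge1Dx (1 : R); lra.
have l1 : 1 <= ln n%:R :> R by rewrite -ler_expR lnK ?posrE.
set x : R := n%:R in xe xU xc x0 x1 l1 Bk Ma *.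
(* Rounding up to an integer costs at most 1 <= ln n, which is why c = c2 + 1. *)
pose p := (Num.truncn (c2 * ln x)).+1.
have cl0 : 0 <= c2 * ln x by rewrite mulr_ge0 ?(ltW c20)// (le_trans _ l1).
have /andP[pl pu] := truncn_itv cl0.
have pc : p%:R <= c * ln x by rewrite (_ : c * ln x = c2 * ln x + ln x) 1?(_ : p%:R = (Num.truncn (c2 * ln x))%:R + 1) ?lerD// ?natr1// /c mulrDl mul1r.
have p1 : 1 <= p%:R :> R by rewrite ler1n.
pose s := Num.sqrt (p%:R / x); have sx : s ^+ 2 = p%:R / x by rewrite sqr_sqrtr// divr_ge0// ltW.
have s0 : 0 < s by rewrite sqrtr_gt0 divr_gt0// (lt_le_trans _ p1).
have s1 : s <= 1.
  rewrite -[leRHS]sqrtr1 ler_wsqrtr// ler_pdivrMr// mul1r; apply: le_trans pc _.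
  have q2 := sqr_sqrtr (ltW x0); have q0 := sqrtr_ge0 x; have := ln_le_sqrt x0.
  set q := Num.sqrt x in q2 q0 * => lq.
  have : 2 * c <= q.
    by rewrite -(ler_pXn2r (_ : 0 < 2)%N) ?nnegrE ?mulr_ge0 ?(ltW c0)// q2; lra.
  by move=> cq; have := ler_wpM2l (ltW c0) lq; have := ler_wpM2r q0 cq; lra.
have xi0 : 0 < x^-1 by rewrite invr_gt0.
exists p, s, (x ^- K); split; split => //.
- by rewrite sx divfK ?gt_eqF.
- apply/andP; split; first by rewrite invr_gt0 exprn_gt0.
  by rewrite invf_lt1 ?exprn_gt0// exprn_egt1// /K addn2.
- by apply: le_trans (covering_exponent (c := c2) v0 A1 l1 x0 (lexx _)) _; rewrite ler_expR ltW.
- have s4 : x ^- 2 <= s ^+ 3.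
    apply: le_trans (_ : _ <= s ^+ 4) _.
      rewrite (_ : s ^+ 4 = (s ^+ 2) ^+ 2); last by rewrite -exprM.
      rewrite sx -exprVn ler_pXn2r ?nnegrE ?(ltW xi0)//; first by rewrite ler_peMl// ltW.
      by rewrite divr_ge0// ltW.
    by rewrite exprS ler_piMl// exprn_ge0// ltW.
  apply: le_trans (_ : x ^- 2 * (x ^- a) ^+ 2 <= _); last first.
    apply: ler_pM => //; try by rewrite ?exprn_ge0// invr_ge0 exprn_ge0// ltW.
    by rewrite ler_pXn2r// nnegrE ?(le_trans _ Ma)// invr_ge0 exprn_ge0// ltW.
  have xk0 i : 0 < x ^+ i by rewrite exprn_gt0.
  apply: le_trans (_ : 128 * x ^+ k * (x ^- K * U) ^+ 2 <= _).
    by rewrite ler_wpM2r ?sqr_ge0// ler_wpM2l.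
  rewrite (_ : x ^- 2 * (x ^- a) ^+ 2 = x ^+ (2 * k + 2) * (x ^- K) ^+ 2); last first.
    rewrite /K (mulnC 2%N) !exprD exprM; field; rewrite !gt_eqF//.
  rewrite exprMn [leLHS](_ : _ = 128 * U ^+ 2 * x ^+ k * (x ^- K) ^+ 2); last by ring.
  rewrite ler_wpM2r ?sqr_ge0//; apply: le_trans (_ : _ <= x * x ^+ k) _.
    by rewrite ler_wpM2r// ltW.
  by rewrite -exprS ler_weXn2l ?(ltW x1)// -addn1 leq_add// leq_pmull.
Qed.

Lemma log_inv_bigO_poly (R : realType) (M : nat -> R) (N : nat -> \bar R) :
  (forall n, (0 < n)%N -> 0 <= M n) -> (forall n, (0 < n)%N -> N n = (M n)%:E) ->
  log_inv_bigO N -> exists a : nat, \forall n \near \oo, n%:R ^- a <= M n.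
Proof.
move=> M0 NE [C NC]; exists (Num.bound `|C|); near=> n.
have n0 : (0 < n)%N by near: n; exact: nbhs_infty_gt.
have nR : 0 < n%:R :> R by rewrite ltr0n.
have ln0 : 0 <= ln n%:R :> R by rewrite ln_ge0// ler1n.
have : (maxe (lne (N n)^-1) 0 <= (C * ln n%:R)%:E)%E by near: n.
rewrite NE// ge_max => /andP[+ _]; have [->|Mn0] := eqVneq (M n) 0; first by rewrite inve0.
have Mp : 0 < M n by rewrite lt_neqAle eq_sym Mn0 M0.
rewrite inver (gt_eqF Mp) lneV// lne_EFin// -EFinN lee_fin => h.
rewrite -ler_ln ?posrE ?invr_gt0 ?exprn_gt0// lnV ?posrE ?exprn_gt0// lnXn//.
rewrite lerNl -[_ *+ _]mulr_natl; apply: le_trans h _.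
by apply: ler_wpM2r => //; apply: le_trans (ler_norm _) (ltW (archi_boundP _)).
Unshelve. all: by end_near. Qed.

(** In the second regime even B n <= n eventually, because ln(2 d_n) >= ln 2. *)
Lemma gram_regime_poly (R : realType) (B q2 : nat -> R) (d : nat -> nat) :
  (forall n, (0 < n)%N -> 1 <= B n) -> (forall n, (0 < n)%N -> (0 < d n)%N) ->
  (q2 =o_\oo (fun n => n%:R : R) /\ (fun n => ln (B n)) =O_\oo (fun n => ln n%:R : R))
  \/ (fun n => B n * ln (2 * d n)%:R) =o_\oo (fun n => n%:R : R) ->
  exists k : nat, \forall n \near \oo, B n <= n%:R ^+ k.
Proof.
move=> B1 d0 [[_ /eqO_exP[C C0 CP]]|/eqoP oP].
  exists (Num.bound `|C|); near=> n.
  have n0 : (0 < n)%N by near: n; exact: nbhs_infty_gt.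
  have nR : 0 < n%:R :> R by rewrite ltr0n.
  have ln0 : 0 <= ln n%:R :> R by rewrite ln_ge0// ler1n.
  have Bp : 0 < B n by rewrite (lt_le_trans _ (B1 n n0)).
  have : `|ln (B n)| <= C * `|ln n%:R| by near: n.
  rewrite (ger0_norm ln0) => h.
  rewrite -ler_ln ?posrE ?exprn_gt0// lnXn// -[_ *+ _]mulr_natl.
  apply: le_trans (ler_norm _) _; apply: le_trans h _.
  by apply: ler_wpM2r => //; apply: le_trans (ler_norm _) (ltW (archi_boundP _)).
have l2 : 0 < ln 2 :> R by rewrite ln_gt0// ltr1n.
exists 1%N; near=> n.
have n0 : (0 < n)%N by near: n; exact: nbhs_infty_gt.
have : `|B n * ln (2 * d n)%:R| <= ln 2 * `|n%:R : R| by near: n; exact: oP.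
rewrite [ `|n%:R|]ger0_norm// => h.
have B0 : 0 <= B n by rewrite (le_trans _ (B1 n n0)).
have ld : ln 2 <= ln (2 * d n)%:R :> R.
  by rewrite ler_ln ?posrE ?ltr0n ?muln_gt0 ?d0// ler_nat leq_pmulr ?d0.
have := le_trans (ler_norm _) h; have := ler_wpM2l B0 ld; rewrite expr1 => h1 h2.
by have := le_trans h1 h2; rewrite mulrC ler_pM2l.
Unshelve. all: by end_near. Qed.

Lemma gram_regime_tail (R : realType) (B q2 : nat -> R) (d : nat -> nat) (eps : R) :
  (forall n, (0 < n)%N -> 1 <= B n) -> (forall n, (0 < n)%N -> (0 < d n)%N) ->
  (q2 =o_\oo (fun n => n%:R : R) /\ (fun n => ln (B n)) =O_\oo (fun n => ln n%:R : R))
  \/ (fun n => B n * ln (2 * d n)%:R) =o_\oo (fun n => n%:R : R) ->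
  0 < eps ->
  \forall n \near \oo, 4 * q2 n / n%:R <= eps \/
    exists p : nat, [/\ (0 < p)%N, 16 * p%:R * B n <= n%:R & (d n)%:R / 2 ^+ p <= eps].
Proof.
move=> B1 d0 hyp eps0; case: hyp => [[/eqoP oP _]|/eqoP oP].
  near=> n; left.
  have n0 : (0 < n)%N by near: n; exact: nbhs_infty_gt.
  have nR : 0 < n%:R :> R by rewrite ltr0n.
  have : `|q2 n| <= eps / 4 * `|n%:R : R| by near: n; apply: oP; rewrite divr_gt0.
  rewrite [ `|n%:R|]ger0_norm// => h; rewrite ler_pdivrMr//.
  by have := le_trans (ler_norm _) h; lra.
have l2 : 0 < ln 2 :> R by rewrite ln_gt0// ltr1n.
pose K := Num.bound eps^-1.
have KP : eps^-1 <= 2 ^+ K.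
  apply: le_trans (ltW (archi_boundP _)) _; first by rewrite invr_ge0 ltW.
  by rewrite -natrX ler_nat ltnW// ltn_expl.
have c0 : 0 < ln 2 / (16 * (K.+2)%:R) :> R by rewrite divr_gt0// mulr_gt0.
near=> n; right.
have n0 : (0 < n)%N by near: n; exact: nbhs_infty_gt.
have : `|B n * ln (2 * d n)%:R| <= ln 2 / (16 * (K.+2)%:R) * `|n%:R : R| by near: n; exact: oP.
rewrite [ `|n%:R|]ger0_norm// => h.
have B0 : 0 <= B n by rewrite (le_trans _ (B1 n n0)).
have dn := d0 n n0; pose t := trunc_log 2 (d n).
have /andP[tl tu] : (2 ^ t <= d n < 2 ^ t.+1)%N by exact: trunc_log_bounds.
(* d < 2^(t+1) and 1/eps <= 2^K give d / 2^p <= eps. Moreover p <= (K + 2)(t + 1) and (t + 1) ln 2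
   <= ln(2 d), which explains the constant ln 2 / (16 (K + 2)) used for the little-o. *)
exists (t.+1 + K)%N; split => //; last first.
  rewrite ler_pdivrMr ?exprn_gt0// exprD.
  apply: le_trans (_ : 2 ^+ t.+1 <= _); first by rewrite -natrX ler_nat ltnW.
  by rewrite mulrCA ler_peMr ?exprn_ge0// -ler_pdivrMl// mulr1.
have tl2 : t.+1%:R * ln 2 <= ln (2 * d n)%:R :> R.
  rewrite mulr_natl -lnXn// ler_ln ?posrE ?exprn_gt0// ?ltr0n ?muln_gt0//.
  by rewrite -natrX ler_nat expnS leq_mul2l tl orbT.
have Kt : (t.+1 + K)%:R <= K.+2%:R * t.+1%:R :> R.
  rewrite -natrM ler_nat mulSn leq_add2l.
  by rewrite (leq_trans (leqnSn K))// leq_pmulr.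
have := le_trans (ler_norm _) h => {}h.
have h1 : B n * (t.+1%:R * ln 2) <= ln 2 / (16 * K.+2%:R) * n%:R.
  by apply: le_trans h; exact: ler_wpM2l.
have K0 : 0 < K.+2%:R :> R by [].
have h2 : B n * t.+1%:R * (16 * K.+2%:R) <= n%:R.
  rewrite -ler_pdivlMr ?mulr_gt0// -(ler_pM2r l2).
  by move: h1; rewrite mulrA [ln 2 / _ * _]mulrC mulrA [n%:R * ln 2 / _]mulrAC.
apply: le_trans h2; have := ler_wpM2l B0 Kt; lra.
Unshelve. all: by end_near. Qed.

(** With w = sqrt(l / x), s^2 = p / x <= c w^2 gives s <= (c + 1) w, so g + L s is at most c + 2
    times the maximum in the rate. The constant 128 is 64 doubled, to leave only half of eps. *)
Lemma markov_ratio_le (R : realType) (K c eps x p s g L l t : R) :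
  0 < K -> 0 < c -> 0 < eps -> 0 < x -> 0 < p -> p <= c * l -> 0 < s -> s ^+ 2 * x = p ->
  0 <= g -> 0 < L -> 0 < l ->
  128 * K * c * (c + 2) / eps * (Num.max g (L * Num.sqrt (l / x)) * (l / x)) <= t ->
  0 < t /\ 64 * x^-1 ^+ 2 * (K * (p * x * (g + L * s))) / t <= eps / 2.
Proof.
move=> K0 c0 e0 x0 p0 pc s0 sx g0 L0 l0; have lx : 0 < l / x by rewrite divr_gt0.
have w2 := sqr_sqrtr (ltW lx); have w0 : 0 < Num.sqrt (l / x) by rewrite sqrtr_gt0.
set w := Num.sqrt _ in w2 w0 *; set m := Num.max _ _.
have mg : g <= m by rewrite le_max lexx.
have mL : L * w <= m by rewrite le_max lexx orbT.
have m0 : 0 < m by rewrite (lt_le_trans _ mL)// mulr_gt0.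
have sw : s <= (c + 1) * w.
  rewrite -(ler_pXn2r (_ : 0 < 2)%N) ?nnegrE ?mulr_ge0 ?addr_ge0 ?(ltW s0) ?(ltW c0) ?(ltW w0)//.
  rewrite exprMn w2; apply: le_trans (_ : c * (l / x) <= _).
    by rewrite mulrA ler_pdivlMr// sx.
  rewrite ler_wpM2r ?(ltW lx)//; nra.
have gs : g + L * s <= (c + 2) * m.
  have : L * s <= (c + 1) * m.
    apply: le_trans (ler_wpM2l (ltW L0) sw) _; by rewrite mulrCA ler_wpM2l// addr_ge0// ltW.
  by lra.
have gs0 : 0 <= g + L * s by rewrite addr_ge0// ltW// mulr_gt0.
set a := 128 * K * c * (c + 2).
have a0 : 0 < a.
  have c2 : 0 < c + 2 by rewrite addr_gt0.
  by rewrite /a; apply: mulr_gt0 => //; apply: mulr_gt0 => //; apply: mulr_gt0.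
have b0 : 0 < a / eps * (m * (l / x)) by rewrite mulr_gt0// ?divr_gt0// mulr_gt0.
move=> ht; have t0 : 0 < t := lt_le_trans b0 ht.
split => //; rewrite ler_pdivrMr//.
apply: le_trans (ler_wpM2l (_ : 0 <= eps / 2) ht); last by rewrite divr_ge0// ltW.
have -> : 64 * x^-1 ^+ 2 * (K * (p * x * (g + L * s))) = 64 * K * x^-1 * (p * (g + L * s)).
  by field; rewrite gt_eqF.
have -> : eps / 2 * (a / eps * (m * (l / x))) = 64 * K * x^-1 * (c * l * ((c + 2) * m)).
  by rewrite /a; field; rewrite !gt_eqF.
apply: ler_wpM2l; first by apply: mulr_ge0; [rewrite mulr_ge0// ltW|rewrite invr_ge0 ltW].
by apply: ler_pM => //; exact: ltW.
Qed.

Lemma chaining_const_gt0 (R : realType) : 0 < chaining_const R.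
Proof.
have e0 : 0 < expR 10 :> R := expR_gt0 _.
by rewrite /chaining_const addr_gt0// !mulr_gt0// addr_gt0// mulr_gt0.
Qed.

Section tail_rate.
Context (R : realType) (dX dO : measure_display) (T : measurableType dX)
  (Omega : measurableType dO) (P : probability T R) (Pr : probability Omega R)
  (X : nat -> {RV Pr >-> T}).
Hypothesis hX : iid P X.
Context (F : set (T -> R)) (f_ : nat -> T -> R) (Fenv : T -> R) (v A U : R).
Hypotheses (FE : F = range f_) (bf : forall k, bounded_measurable (f_ k)).
Hypotheses (F_VC : VC_class F Fenv v A) (FU : forall x, 0 <= Fenv x <= U) (U0 : 0 <= U).
Hypotheses (v0 : 0 < v) (A1 : 1 <= A).
Context (d : nat -> nat) (h : forall n, T -> 'cV[R]_(d n)).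
Hypothesis fh : forall n, (0 < n)%N -> feature_map P (h n).
Variable pinv : forall m : nat, 'M[R]_m -> 'M[R]_m.
Hypothesis mpinv : forall n, (0 < n)%N -> forall i j,
  measurable_fun [set: Omega] (fun w => pinv (emp_gram X n (h n) w) i j).
Variables (B M g2 : nat -> R).
Hypotheses (B1 : forall n, (0 < n)%N -> 1 <= B n)
  (qB : forall n, (0 < n)%N -> forall x, leverage P (h n) x <= B n).
Hypothesis resM : forall n, (0 < n)%N -> forall k x, `|residual P (h n) (f_ k) x| <= M n.
Hypothesis g20 : forall n, (0 < n)%N -> 0 <= g2 n.
Hypothesis resg : forall n, (0 < n)%N -> forall k,
  \int[P]_x (leverage P (h n) x * residual P (h n) (f_ k) x ^+ 2) <= g2 n.
Hypothesis regime :
  ((fun n => \int[P]_x (leverage P (h n) x ^+ 2)) =o_\oo (fun n => n%:R : R)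
    /\ (fun n => ln (B n)) =O_\oo (fun n => ln n%:R : R))
  \/ (fun n => B n * ln (2 * d n)%:R) =o_\oo (fun n => n%:R : R).
Variable a : nat.
Hypothesis M_poly : \forall n \near \oo, n%:R ^- a <= M n.

(** Half of eps pays for a bad Gram matrix, half for Markov's inequality. Admitting every larger t
    lets each of the two announced rates use its own threshold. *)
Lemma excess_tail_rate (eps : R) : 0 < eps -> exists2 C : R, 0 < C &
  \forall n \near \oo, forall t,
    C * (Num.max (g2 n) (M n ^+ 2 * B n * Num.sqrt (ln n%:R / n%:R)) * (ln n%:R / n%:R)) <= t ->
    (Pr [set w | t%:E < `|sup_excess_risk P F pinv X n (h n) w|] <= eps%:E)%E.
Proof.
move=> eps0; have d0 n : (0 < n)%N -> (0 < d n)%N by move=> /fh[].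
have [k kP] := gram_regime_poly B1 d0 regime.
have [c c0 [x0 cP]] := scale_choice U a k v0 A1.
have e2 : 0 < eps / 2 by rewrite divr_gt0.
have low := gram_regime_tail B1 d0 regime e2.
have K0 := chaining_const_gt0 R.
exists (128 * chaining_const R * c * (c + 2) / eps).
  rewrite divr_gt0// mulr_gt0//; last by rewrite addr_gt0.
  by rewrite mulr_gt0// mulr_gt0.
near=> n => t ht.
have n0 : (0 < n)%N by near: n; exact: nbhs_infty_gt.
have nR : 0 < n%:R :> R by rewrite ltr0n.
have n1 : (1 < n)%N by near: n; exact: nbhs_infty_gt.
have ln0 : 0 < ln n%:R :> R by rewrite ln_gt0// ltr1n.
have Ma : n%:R ^- a <= M n by near: n.
have M0 : 0 < M n by apply: lt_le_trans Ma; rewrite invr_gt0 exprn_gt0.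
have nx0 : x0 <= n%:R by near: n; exact: nbhs_infty_ger.
have Bk : B n <= n%:R ^+ k by near: n.
have B0 : 0 < B n by rewrite (lt_le_trans _ (B1 n0)).
have [p [s [eta [[p0 s0 s1 sp eta01] [cover net pc]]]]] := cP n _ _ nx0 (B1 n0) Bk Ma.
have L0 : 0 < M n ^+ 2 * B n by rewrite mulr_gt0// exprn_gt0.
have pR : 0 < p%:R :> R by rewrite ltr0n.
have [t0 tb] := markov_ratio_le K0 c0 eps0 nR pR pc s0 sp (g20 n0) L0 ln0 ht.
have lown : 4 * (\int[P]_x leverage P (h n) x ^+ 2) / n%:R <= eps / 2 \/
   exists p' : nat, [/\ (0 < p')%N, 16 * p'%:R * B n <= n%:R & (d n)%:R / 2 ^+ p' <= eps / 2].
  by near: n.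
apply: le_trans (excess_tail hX FE bf F_VC FU U0 (fh n0) n0 (mpinv n0) (qB n0) (B1 n0)
  (resM n0) M0 (resg n0) (g20 n0) p0 s0 s1 sp eta01 cover net t0 lown) _.
by rewrite lee_fin; lra.
Unshelve. all: by end_near. Qed.
End tail_rate.

Lemma limn_esup_le_near (R : realType) (u : nat -> \bar R) (b : \bar R) :
  (\forall n \near \oo, (u n <= b)%E) -> (limn_esup u <= b)%E.
Proof.
move=> ub; apply: (@le_trans _ _ (ereal_sup (u @` [set n | (u n <= b)%E]))).
  by apply: ereal_inf_lbound; exists [set n | (u n <= b)%E].
by apply: ge_ereal_sup => _ [n /= un <-].
Qed.

Theorem corollary1
    (R : realType) (dX dO : measure_display)
    (T : measurableType dX) (Omega : measurableType dO)
    (P : probability T R) (Pr : probability Omega R)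
    (X : nat -> {RV Pr >-> T})
    (F : set (T -> R)) (Fenv : T -> R) (v A : R)
    (d : nat -> nat) (h : forall n, T -> 'cV[R]_(d n))
    (pinv : forall m : nat, 'M[R]_m -> 'M[R]_m)
    (hX : iid P X)
    (F_nonempty : F !=set0)
    (F_meas : forall f, F f -> measurable_fun [set: T] f)
    (h_feature : forall n, (0 < n)%N -> feature_map P (h n))
    (q_bounded : forall n, (0 < n)%N -> (supnorm (leverage P (h n)) < +oo)%E)
    (pinvP : forall m (G : 'M[R]_m), is_pseudo_inverse G (pinv m G))
    (pinv_meas : forall n, (0 < n)%N -> forall i j,
      measurable_fun [set: Omega] (fun w => pinv (d n) (emp_gram X n (h n) w) i j))
    (hyp1 :
      ((fun n => \int[P]_x (leverage P (h n) x ^+ 2)) =o_\oo (fun n => n%:R : R)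
       /\ (fun n => ln (fine (supnorm (leverage P (h n)))))
            =O_\oo (fun n => ln n%:R : R))
      \/ (fun n => fine (supnorm (leverage P (h n))) * ln (2 * d n)%:R)
            =o_\oo (fun n => n%:R : R))
    (F_countable : countable F)
    (F_env : envelope F Fenv)
    (Fenv_bounded : (supnorm Fenv < +oo)%E)
    (v_gt0 : 0 < v) (A_ge1 : 1 <= A)
    (F_VC : VC_class F Fenv v A)
    (log_M : log_inv_bigO (fun n => sup_residual P F (h n))) :
  bigO_prob Pr
    (fun n => sup_excess_risk P F pinv X n (h n))
    (fun n => (maxe (gamma_sq P F (h n))
                    (L_sq P F (h n) * (Num.sqrt (ln n%:R / n%:R))%:E)
               * (ln n%:R / n%:R)%:E)%E)
  /\ ((fun n => fine (L_sq P F (h n)))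
        =O_\oo (fun n => fine (gamma_sq P F (h n)) * Num.sqrt (n%:R / ln n%:R)) ->
      bigO_prob Pr
        (fun n => sup_excess_risk P F pinv X n (h n))
        (fun n => (gamma_sq P F (h n) * (ln n%:R / n%:R)%:E)%E)).
Proof.
have [env0 envF] := F_env.
have [U FU U0] : exists2 U : R, (forall x, Fenv x <= U) & 0 <= U.
  exists (Num.max (fine (supnorm Fenv)) 0) => [x|]; last by rewrite le_max lexx orbT.
  rewrite le_max; apply/orP; left.
  have : (`|Fenv x|%:E <= supnorm Fenv)%E by apply: ereal_sup_ubound; exists x.
  move: Fenv_bounded; case: (supnorm Fenv) => [r _||]//=.
  by rewrite lee_fin; apply: le_trans; exact: ler_norm.
have fU f : F f -> forall x, `|f x| <= U by move=> Ff x; exact: le_trans (envF f Ff x) (FU x).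
have bF f : F f -> bounded_measurable f by move=> Ff; split; [exact: F_meas|exists U; exact: fU].
have [f_ FE] := countable_range F_countable F_nonempty.
have Ff k : F (f_ k) by rewrite FE; exists k.
pose B n := fine (supnorm (leverage P (h n))).
pose M n := fine (sup_residual P F (h n)).
pose g2 n := fine (gamma_sq P F (h n)).
have HB n : (0 < n)%N -> [/\ supnorm (leverage P (h n)) = (B n)%:E, 1 <= B n &
    forall x, leverage P (h n) x <= B n].
  move=> n0; have [b [bE b1 bq]] := leverage_supnorm (h_feature n n0) (q_bounded n n0).
  by rewrite /B bE.
have HM n : (0 < n)%N -> [/\ sup_residual P F (h n) = (M n)%:E, gamma_sq P F (h n) = (g2 n)%:E,
      0 <= M n /\ (forall f, F f -> forall x, `|residual P (h n) f x| <= M n) &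
      0 <= g2 n /\ (forall f, F f ->
        \int[P]_x (leverage P (h n) x * residual P (h n) f x ^+ 2) <= g2 n)].
  move=> n0; have [m [g [mE gE m0 g0]]] :=
    sup_residual_gamma_sq F_nonempty bF fU (h_feature n n0) (q_bounded n n0).
  by rewrite /M /g2 mE gE.
have LE n : (0 < n)%N -> L_sq P F (h n) = (M n ^+ 2 * B n)%:E.
  by move=> n0; have [qE _ _] := HB n n0; have [sE _ _ _] := HM n n0; rewrite /L_sq qE sE -EFin_expe.
have [a aP] : exists a : nat, \forall n \near \oo, n%:R ^- a <= M n.
  by apply: log_inv_bigO_poly log_M => n n0; have [sE _ [m0 _] _] := HM n n0.
have tail eps : 0 < eps -> exists2 C : R, 0 < C & \forall n \near \oo, forall t,
    C * (Num.max (g2 n) (M n ^+ 2 * B n * Num.sqrt (ln n%:R / n%:R)) * (ln n%:R / n%:R)) <= t ->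
    (Pr [set w | t%:E < `|sup_excess_risk P F pinv X n (h n) w|] <= eps%:E)%E.
  apply: (excess_tail_rate hX FE (fun k => bF _ (Ff k)) F_VC (U := U) _ U0 v_gt0 A_ge1
    h_feature pinv_meas _ _ _ _ _ hyp1 aP).
  - by move=> x; rewrite env0 FU.
  - by move=> n n0; have [] := HB n n0.
  - by move=> n n0; have [] := HB n n0.
  - by move=> n n0 k x; have [_ _ [_ ub] _] := HM n n0; exact: ub.
  - by move=> n n0; have [_ _ _ []] := HM n n0.
  - by move=> n n0 k; have [_ _ _ [_ ub]] := HM n n0; exact: ub.
split => [|/eqO_exP[k k0 kP]] eps eps0; have [C C0 CP] := tail eps eps0.
  exists C => //; apply: limn_esup_le_near; near=> n.
  have n0 : (0 < n)%N by near: n; exact: nbhs_infty_gt.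
  have [_ gE _ _] := HM n n0; rewrite gE LE// -!EFinM -EFin_max -!EFinM.
  have CPn : forall t,
    C * (Num.max (g2 n) (M n ^+ 2 * B n * Num.sqrt (ln n%:R / n%:R)) * (ln n%:R / n%:R)) <= t ->
    (Pr [set w | t%:E < `|sup_excess_risk P F pinv X n (h n) w|] <= eps%:E)%E by near: n.
  by apply: CPn; rewrite mulrC.
exists (C * (k + 1)); first by rewrite mulr_gt0// addr_gt0.
apply: limn_esup_le_near; near=> n.
have n0 : (0 < n)%N by near: n; exact: nbhs_infty_gt.
have nR : 0 < n%:R :> R by rewrite ltr0n.
have n1 : (1 < n)%N by near: n; exact: nbhs_infty_gt.
have ln0 : 0 < ln n%:R :> R by rewrite ln_gt0// ltr1n.
have [_ gE _ [g0 _]] := HM n n0; rewrite gE -!EFinM.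
have CPn : forall t,
  C * (Num.max (g2 n) (M n ^+ 2 * B n * Num.sqrt (ln n%:R / n%:R)) * (ln n%:R / n%:R)) <= t ->
  (Pr [set w | t%:E < `|sup_excess_risk P F pinv X n (h n) w|] <= eps%:E)%E by near: n.
apply: CPn.
have : `|fine (L_sq P F (h n))| <= k * `|fine (gamma_sq P F (h n)) * Num.sqrt (n%:R / ln n%:R)|.
  by near: n.
rewrite LE//= -/(g2 n) [X in _ <= _ * X]ger0_norm ?mulr_ge0 ?sqrtr_ge0// => hL.
have {}hL := le_trans (ler_norm _) hL.
have w1 : Num.sqrt (n%:R / ln n%:R) * Num.sqrt (ln n%:R / n%:R) = 1 :> R.
  rewrite -sqrtrM ?divr_ge0 ?(ltW ln0)// (_ : _ * _ = 1) ?sqrtr1//.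
  by field; rewrite !gt_eqF.
(* The extra hypothesis says L_n^2 <= k gamma_n^2 sqrt(n / ln n), and the two square roots cancel,
   so the maximum collapses to a multiple of gamma_n^2. *)
have hm : Num.max (g2 n) (M n ^+ 2 * B n * Num.sqrt (ln n%:R / n%:R)) <= (k + 1) * g2 n.
  rewrite ge_max; apply/andP; split; first by rewrite ler_peMl// lerDr ltW.
  apply: le_trans (ler_wpM2r (sqrtr_ge0 _) hL) _.
  by rewrite -!mulrA w1 mulr1 ler_wpM2r// lerDl.
rewrite (_ : _ * (C * (k + 1)) = C * ((k + 1) * g2 n * (ln n%:R / n%:R))); last by ring.
rewrite ler_wpM2l ?(ltW C0)// ler_wpM2r//.
by rewrite divr_ge0// ltW.
Unshelve. all: by end_near. Qed.
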